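(* Let $H=U_q(\mathfrak{sl}_2)$ and $C=\mathbb{C}_q[\mathrm{SL}_2]$. The subalgebra ${}^+(H\otimes C)^+=\{x\in H\otimes C\mid E\blacktriangleright x=0=x\blacktriangleleft E\}$ of highest-weight bivectors in $H\otimes C$ is locally finite (each of its elements generates a finite-dimensional $D(H)$-sub-bimodule of $D(H)^*$) and is generated as an algebra by $\{\mathbf{v}_1,\mathbf{v}_2,\mathbf{v}_3,\mathbf{v}_4\}$.
   Context: The ground field is $\mathbb{C}(q)$. $H=U_q(\mathfrak{sl}_2)$ is the Hopf algebra generated by $K^{\pm1},E,F$ with $KEK^{-1}=q^2E$, $KFK^{-1}=q^{-2}F$, $EF-FE=\frac{K-K^{-1}}{q-q^{-1}}$, $\Delta K=K\otimes K$, $\Delta E=E\otimes K+1\otimes E$, $\Delta F=F\otimes 1+K^{-1}\otimes F$, $\varepsilon(K)=1$, $\varepsilon(E)=\varepsilon(F)=0$, $SK=K^{-1}$, $SE=-EK^{-1}$, $SF=-KF$. $C=\mathbb{C}_q[\mathrm{SL}_2]$ is the Hopf algebra generated by $a,b,c,d$ with $ba=qab$, $ca=qac$, $db=qbd$, $dc=qcd$, $cb=bc$, $ad-q^{-1}bc=da-qbc=1$, $\Delta a=a\otimes a+b\otimes c$, $\Delta b=a\otimes b+b\otimes d$, $\Delta c=c\otimes a+d\otimes c$, $\Delta d=c\otimes b+d\otimes d$, $\varepsilon(a)=\varepsilon(d)=1$, $\varepsilon(b)=\varepsilon(c)=0$, $Sa=d$, $Sb=-qb$, $Sc=-q^{-1}c$,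 $Sd=a$. The Hopf pairing $\phi\colon C\otimes H\to\mathbb{C}(q)$ (so $\phi(\gamma,hh')=\phi(\gamma_{(1)},h)\phi(\gamma_{(2)},h')$, $\phi(\gamma\gamma',h)=\phi(\gamma,h_{(1)})\phi(\gamma',h_{(2)})$, $\phi(1,h)=\varepsilon(h)$, $\phi(\gamma,1)=\varepsilon(\gamma)$, $\phi(S\gamma,h)=\phi(\gamma,Sh)$) is determined by $\phi(a,K^{\pm1})=q^{\pm1}$, $\phi(d,K^{\pm1})=q^{\mp1}$, $\phi(b,E)=1$, $\phi(c,F)=1$, and $0$ on all other pairs of generators. The quantum double $D(H)$ is $C\otimes H$ with the tensor product coalgebra structure, containing $C^{\mathrm{op}}$ and $H$ as subalgebras, with cross-relation $h\cdot\gamma=\gamma_{(2)}\cdot h_{(2)}\,\phi(\gamma_{(1)},Sh_{(1)})\,\phi(\gamma_{(3)},h_{(3)})$ for $h\in H$, $\gamma\in C$. $D(H)^*$ is an algebra with product dual to the coproduct, and a $D(H)$-bimodule via $(x\blacktriangleright f)(y)=f(yx)$, $(f\blacktriangleleft x)(y)=f(xy)$. The tensor product algebra $H\otimes C$ (in which elements of $H$ and of $C$ commute; the tensor sign is suppressed) is a subalgebra and sub-bimodule of $D(H)^*$ via $\langle\gamma\cdot h,\bar h\bar\gamma\rangle=\phi(\gamma,\bar h)\phi(\bar\gamma,h)$. In $H\otimes C$ put $\mathbf{v}_4=EF+\frac{q^{-1}K+qK^{-1}}{(q-q^{-1})^2}$, $\mathbf{v}_3=EK^{-1}$, $\mathbf{v}_1=(q-q^{-1})EK^{-1}ac-c^2$,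 and $\mathbf{v}_2=(q-q^{-1})\mathbf{v}_4\,ac-\frac{q+q^{-1}}{q-q^{-1}}Kac-q^{-2}FKc^2+Ea^2$. *)

(* Defs.v *)
From HB Require Import structures.
From mathcomp Require Import all_boot all_order all_algebra generic_quotient.
From mathcomp Require Import boolp classical_sets functions reals complex.
From mathcomp Require Import fraction ring.

Set Implicit Arguments.
Unset Strict Implicit.
Unset Printing Implicit Defensive.

Import GRing.Theory.

Local Open Scope ring_scope.
Local Open Scope quotient_scope.

Section Terms.
Variables (K : fieldType) (X : Type).

Inductive term : Type :=
| Gen of X
| Cst of K
| Add of term & term
| Mul of term & term.

Fixpoint teval (B : algType K) (f : X -> B) (t : term) : B :=
  match t with
  | Gen x => f x
  | Cst k => k%:A
  | Add s t => teval f s + teval f t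
  | Mul s t => teval f s * teval f t
  end.

HB.instance Definition _ := gen_eqMixin term.
HB.instance Definition _ := gen_choiceMixin term.
End Terms.

Arguments Gen {K X}.
Arguments Cst {K X}.

Declare Scope term_scope.
Delimit Scope term_scope with T.
Bind Scope term_scope with term.
Notation "s + t" := (Add s t) : term_scope.
Notation "s * t" := (Mul s t) : term_scope.
Notation "1" := (Cst 1) : term_scope.
Notation "k *: t" := (Mul (Cst k) t) : term_scope.
Notation "s - t" := (Add s (Mul (Cst (-1)) t)) : term_scope.

(* The character [paug], compatible with the relations, certifies that the
   presented algebra is nonzero, as mathcomp's [algType] requires.  For a
   Hopf algebra it is the counit. *)
Record presentation (K : fieldType) := Presentation {
  pgen : Type;
  prel : term K pgen -> term K pgen -> Prop;
  paug : pgen -> K^o;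
  paugP : forall s t, prel s t -> teval paug s = teval paug t
}.

Section PresentedAlgebra.
Variables (K : fieldType) (P : presentation K).
Local Notation tm := (term K (pgen P)).

Inductive pcong : tm -> tm -> Prop :=
| pc_rel s t : prel s t -> pcong s t
| pc_refl s : pcong s s
| pc_sym s t : pcong s t -> pcong t s
| pc_trans s t u : pcong s t -> pcong t u -> pcong s u
| pc_add s s' t t' : pcong s s' -> pcong t t' -> pcong (s + t) (s' + t')
| pc_mul s s' t t' : pcong s s' -> pcong t t' -> pcong (s * t) (s' * t')
| pc_addA s t u : pcong (s + (t + u)) (s + t + u)
| pc_addC s t : pcong (s + t) (t + s)
| pc_add0 s : pcong (Cst 0 + s) s
| pc_mul0 s : pcong (Cst 0 * s) (Cst 0)
| pc_mulA s t u : pcong (s * (t * u)) (s * t * u)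
| pc_mul1 s : pcong (1 * s) s
| pc_mulDl s t u : pcong ((s + t) * u) (s * u + t * u)
| pc_mulDr s t u : pcong (s * (t + u)) (s * t + s * u)
| pc_cstD k l : pcong (Cst (k + l)%R) (Cst k + Cst l)
| pc_cstM k l : pcong (Cst (k * l)%R) (Cst k * Cst l)
| pc_cstC k s : pcong (k *: s) (s * Cst k).

Definition pcongb : rel tm := fun s t => `[< pcong s t >].

Lemma pcongb_refl : reflexive pcongb.
Proof. by move=> s; apply/asboolP; apply: pc_refl. Qed.
Lemma pcongb_sym : symmetric pcongb.
Proof. by move=> s t; apply/asboolP/asboolP; apply: pc_sym. Qed.
Lemma pcongb_trans : transitive pcongb.
Proof.
by move=> t s u /asboolP st /asboolP tu; apply/asboolP; apply: pc_trans tu.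
Qed.

Canonical pcong_equiv := EquivRel pcongb pcongb_refl pcongb_sym pcongb_trans.

Definition palg : Type := {eq_quot pcong_equiv}.
HB.instance Definition _ := Choice.on palg.
HB.instance Definition _ := EqQuotient.on palg.

Definition pcls (t : tm) : palg := \pi_palg t.

Lemma pclsP s t : pcls s = pcls t <-> pcong s t.
Proof. by split => [/eqmodP/asboolP|st] //; apply/eqmodP/asboolP. Qed.

Lemma pcls_surj (x : palg) : exists t, x = pcls t.
Proof. by exists (repr x); rewrite /pcls reprK. Qed.

Lemma pcong_repr t : pcong (repr (pcls t)) t.
Proof. by apply/pclsP; rewrite /pcls reprK. Qed.

Definition pa_add (x y : palg) := pcls (repr x + repr y).
Definition pa_mul (x y : palg) := pcls (repr x * repr y).
Definition pa_scale (k : K) (x : palg) := pcls (k *: repr x).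
Definition pa_opp (x : palg) := pa_scale (-1) x.

Lemma pa_addE s t : pa_add (pcls s) (pcls t) = pcls (s + t).
Proof. by apply/pclsP; apply: pc_add; apply: pcong_repr. Qed.
Lemma pa_mulE s t : pa_mul (pcls s) (pcls t) = pcls (s * t).
Proof. by apply/pclsP; apply: pc_mul; apply: pcong_repr. Qed.
Lemma pa_scaleE k t : pa_scale k (pcls t) = pcls (k *: t).
Proof.
by apply/pclsP; apply: pc_mul; [apply: pc_refl|apply: pcong_repr].
Qed.

Definition pa_E := (pa_addE, pa_mulE, pa_scaleE).

Lemma pa_addA : associative pa_add.
Proof.
move=> x y z; have [[s ->] [t ->] [u ->]] :=
  And3 (pcls_surj x) (pcls_surj y) (pcls_surj z).
by rewrite !pa_E; apply/pclsP; apply: pc_addA.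
Qed.
Lemma pa_addC : commutative pa_add.
Proof.
move=> x y; have [[s ->] [t ->]] := conj (pcls_surj x) (pcls_surj y).
by rewrite !pa_E; apply/pclsP; apply: pc_addC.
Qed.
Lemma pa_add0 : left_id (pcls (Cst 0)) pa_add.
Proof.
move=> x; have [s ->] := pcls_surj x.
by rewrite !pa_E; apply/pclsP; apply: pc_add0.
Qed.
Lemma pa_mulA : associative pa_mul.
Proof.
move=> x y z; have [[s ->] [t ->] [u ->]] :=
  And3 (pcls_surj x) (pcls_surj y) (pcls_surj z).
by rewrite !pa_E; apply/pclsP; apply: pc_mulA.
Qed.
Lemma pa_mul1 : left_id (pcls 1) pa_mul.
Proof.
move=> x; have [s ->] := pcls_surj x.
by rewrite !pa_E; apply/pclsP; apply: pc_mul1.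
Qed.
Lemma pa_mulx1 : right_id (pcls 1) pa_mul.
Proof.
move=> x; have [s ->] := pcls_surj x.
rewrite !pa_E; apply/pclsP; apply: pc_trans (pc_mul1 s).
by apply: pc_sym; apply: pc_cstC.
Qed.
Lemma pa_mulDl : left_distributive pa_mul pa_add.
Proof.
move=> x y z; have [[s ->] [t ->] [u ->]] :=
  And3 (pcls_surj x) (pcls_surj y) (pcls_surj z).
by rewrite !pa_E; apply/pclsP; apply: pc_mulDl.
Qed.
Lemma pa_mulDr : right_distributive pa_mul pa_add.
Proof.
move=> x y z; have [[s ->] [t ->] [u ->]] :=
  And3 (pcls_surj x) (pcls_surj y) (pcls_surj z).
by rewrite !pa_E; apply/pclsP; apply: pc_mulDr.
Qed.
Lemma pa_scaleMul k x : pa_scale k x = pa_mul (pcls (Cst k)) x.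
Proof. by have [s ->] := pcls_surj x; rewrite !pa_E. Qed.
Lemma pa_cstC k x : pa_mul (pcls (Cst k)) x = pa_mul x (pcls (Cst k)).
Proof.
by have [s ->] := pcls_surj x; rewrite !pa_E; apply/pclsP; apply: pc_cstC.
Qed.
Lemma pa_cstD k l : pcls (Cst (k + l)) = pa_add (pcls (Cst k)) (pcls (Cst l)).
Proof. by rewrite !pa_E; apply/pclsP; apply: pc_cstD. Qed.
Lemma pa_cstM k l : pcls (Cst (k * l)) = pa_mul (pcls (Cst k)) (pcls (Cst l)).
Proof. by rewrite !pa_E; apply/pclsP; apply: pc_cstM. Qed.

Lemma pa_mul0 x : pa_mul (pcls (Cst 0)) x = pcls (Cst 0).
Proof.
by have [s ->] := pcls_surj x; rewrite !pa_E; apply/pclsP; apply: pc_mul0.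
Qed.
Lemma pa_addN : left_inverse (pcls (Cst 0)) pa_opp pa_add.
Proof.
move=> x; rewrite /pa_opp pa_scaleMul -[in X in pa_add _ X](pa_mul1 x).
by rewrite -pa_mulDl -pa_cstD addNr pa_mul0.
Qed.

HB.instance Definition _ := GRing.isZmodule.Build palg
  pa_addA pa_addC pa_add0 pa_addN.
HB.instance Definition _ := GRing.Zmodule_isPzRing.Build palg
  pa_mulA pa_mul1 pa_mulx1 pa_mulDl pa_mulDr.

Lemma pa_scaleA k l x : pa_scale k (pa_scale l x) = pa_scale (k * l) x.
Proof. by rewrite !pa_scaleMul pa_mulA -pa_cstM. Qed.
Lemma pa_scale1 : left_id 1 pa_scale.
Proof. by move=> x; rewrite pa_scaleMul pa_mul1. Qed.
Lemma pa_scaleDr : right_distributive pa_scale +%R.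
Proof. by move=> k x y; rewrite !pa_scaleMul; apply: pa_mulDr. Qed.
Lemma pa_scaleDl x : {morph pa_scale^~ x : k l / k + l}.
Proof. by move=> k l; rewrite !pa_scaleMul pa_cstD; apply: pa_mulDl. Qed.

HB.instance Definition _ := GRing.Zmodule_isLmodule.Build K palg
  pa_scaleA pa_scale1 pa_scaleDr pa_scaleDl.

Lemma pa_scalec (k : K) (x : palg) : k *: x = pcls (Cst k) * x.
Proof. exact: pa_scaleMul. Qed.
Lemma pa_scaleAl (k : K) (x y : palg) : k *: (x * y) = k *: x * y.
Proof. by rewrite !pa_scalec mulrA. Qed.
Lemma pa_scaleAr (k : K) (x y : palg) : k *: (x * y) = x * (k *: y).
Proof.
rewrite !pa_scalec !mulrA; congr (_ * _); exact: pa_cstC.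
Qed.

Section Lift.
Variables (B : algType K) (f : pgen P -> B).
Hypothesis fP : forall s t, prel s t -> teval f s = teval f t.

Lemma teval_pcong s t : pcong s t -> teval f s = teval f t.
Proof.
elim=> {s t} /=.
- exact: fP.
- by [].
- by move=> s t _ ->.
- by move=> s t u _ -> _ ->.
- by move=> s s' t t' _ -> _ ->.
- by move=> s s' t t' _ -> _ ->.
- by move=> s t u; rewrite addrA.
- by move=> s t; rewrite addrC.
- by move=> s; rewrite scale0r add0r.
- by move=> s; rewrite scale0r mul0r.
- by move=> s t u; rewrite mulrA.
- by move=> s; rewrite scale1r mul1r.
- by move=> s t u; rewrite mulrDl.
- by move=> s t u; rewrite mulrDr.
- by move=> k l; rewrite scalerDl.
- by move=> k l; rewrite -scalerAl mul1r scalerA.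
- by move=> k s; rewrite -scalerAl -scalerAr mul1r mulr1.
Qed.
End Lift.

Lemma pa_1neq0 : (1 : palg) != 0.
Proof.
apply/eqP => /pclsP /(teval_pcong (@paugP _ P)) /= /eqP.
by rewrite scale1r scale0r oner_eq0.
Qed.

HB.instance Definition _ := GRing.PzSemiRing_isNonZero.Build palg pa_1neq0.
HB.instance Definition _ := GRing.Lmodule_isLalgebra.Build K palg pa_scaleAl.
HB.instance Definition _ := GRing.Lalgebra_isAlgebra.Build K palg pa_scaleAr.

Definition pgenr (x : pgen P) : palg := pcls (Gen x).

Lemma teval_pgenr t : teval pgenr t = pcls t.
Proof.
elim: t => //= [k|s -> t ->|s -> t ->].
- by rewrite -[LHS]/(pa_scale _ _) pa_scaleE; apply/pclsP;
    rewrite -{2}[k]mulr1; apply: pc_sym; apply: pc_cstM.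
- exact: pa_addE.
- exact: pa_mulE.
Qed.

Lemma pgenrP s t : prel s t -> teval pgenr s = teval pgenr t.
Proof. by move=> st; rewrite !teval_pgenr; apply/pclsP; apply: pc_rel. Qed.

Lemma palg_ind (Q : palg -> Prop) :
  (forall x, Q (pgenr x)) -> Q 1 -> (forall (k : K) x y, Q x -> Q y -> Q (k *: x + y)) ->
  (forall x y, Q x -> Q y -> Q (x * y)) -> forall x, Q x.
Proof.
move=> Qg Q1 QD QM x; have [t ->] := pcls_surj x.
have Q0 : Q 0 by rewrite -(addNr 1) -scaleN1r; apply: QD.
rewrite -teval_pgenr; elim: t => //= [k|s Qs t Qt|s Qs t Qt].
- by rewrite -[_ *: _]addr0; apply: QD.
- by rewrite -[teval _ s]scale1r; apply: QD.
- exact: QM.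
Qed.

Section LiftMorphism.
Variables (B : algType K) (f : pgen P -> B).
Hypothesis fP : forall s t, prel s t -> teval f s = teval f t.

Definition plift of (forall s t, prel s t -> teval f s = teval f t) :=
  fun x : palg => teval f (repr x).
Local Notation phi := (plift fP).

Lemma plift_pcls t : phi (pcls t) = teval f t.
Proof. exact: (teval_pcong fP (pcong_repr t)). Qed.

Lemma plift_gen x : phi (pgenr x) = f x.
Proof. exact: plift_pcls. Qed.

Lemma plift_linear : linear phi.
Proof.
move=> k x y; have [[s ->] [t ->]] := conj (pcls_surj x) (pcls_surj y).
rewrite -[_ *: _]/(pa_scale _ _) pa_scaleE.
rewrite -[pcls _ + _]/(pa_add _ _) pa_addE !plift_pcls /=.
by rewrite -scalerAl mul1r.
Qed.

Lemma plift_monoid_morphism : monoid_morphism phi.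
Proof.
split=> [|x y]; first by rewrite plift_pcls /= scale1r.
have [[s ->] [t ->]] := conj (pcls_surj x) (pcls_surj y).
by rewrite -[_ * _]/(pa_mul _ _) pa_mulE !plift_pcls.
Qed.

HB.instance Definition _ := GRing.isLinear.Build K palg B *:%R phi plift_linear.
HB.instance Definition _ :=
  GRing.isMonoidMorphism.Build palg B phi plift_monoid_morphism.
End LiftMorphism.

End PresentedAlgebra.

Arguments pgenr {K} P x.

(* The tensor product over K: formal sums of pure tensors modulo
   bilinearity. *)

Section TensorModule.
Variables (K : fieldType) (V W : lmodType K).

Inductive tterm : Type :=
| TPure of V & W
| TAdd of tterm & tterm
| TScale of K & tterm.

HB.instance Definition _ := gen_eqMixin tterm.
HB.instance Definition _ := gen_choiceMixin tterm.

Inductive tcong : tterm -> tterm -> Prop :=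
| tc_pureDl v v' w : tcong (TPure (v + v') w) (TAdd (TPure v w) (TPure v' w))
| tc_pureDr v w w' : tcong (TPure v (w + w')) (TAdd (TPure v w) (TPure v w'))
| tc_pureZl k v w : tcong (TPure (k *: v) w) (TScale k (TPure v w))
| tc_pureZr k v w : tcong (TPure v (k *: w)) (TScale k (TPure v w))
| tc_refl s : tcong s s
| tc_sym s t : tcong s t -> tcong t s
| tc_trans s t u : tcong s t -> tcong t u -> tcong s u
| tc_add s s' t t' : tcong s s' -> tcong t t' -> tcong (TAdd s t) (TAdd s' t')
| tc_scale k s s' : tcong s s' -> tcong (TScale k s) (TScale k s')
| tc_addA s t u : tcong (TAdd s (TAdd t u)) (TAdd (TAdd s t) u)
| tc_addC s t : tcong (TAdd s t) (TAdd t s)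
| tc_add0 s : tcong (TAdd (TPure 0 0) s) s
| tc_addN s : tcong (TAdd (TScale (-1) s) s) (TPure 0 0)
| tc_scaleA k l s : tcong (TScale k (TScale l s)) (TScale (k * l) s)
| tc_scale1 s : tcong (TScale 1 s) s
| tc_scaleDr k s t : tcong (TScale k (TAdd s t)) (TAdd (TScale k s) (TScale k t))
| tc_scaleDl s k l : tcong (TScale (k + l) s) (TAdd (TScale k s) (TScale l s)).

Definition tcongb : rel tterm := fun s t => `[< tcong s t >].

Lemma tcongb_refl : reflexive tcongb.
Proof. by move=> s; apply/asboolP; apply: tc_refl. Qed.
Lemma tcongb_sym : symmetric tcongb.
Proof. by move=> s t; apply/asboolP/asboolP; apply: tc_sym. Qed.
Lemma tcongb_trans : transitive tcongb.
Proof.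
by move=> t s u /asboolP st /asboolP tu; apply/asboolP; apply: tc_trans tu.
Qed.

Canonical tcong_equiv := EquivRel tcongb tcongb_refl tcongb_sym tcongb_trans.

Definition tensor : Type := {eq_quot tcong_equiv}.
HB.instance Definition _ := Choice.on tensor.
HB.instance Definition _ := EqQuotient.on tensor.

Definition tcls (t : tterm) : tensor := \pi_tensor t.

Lemma tclsP s t : tcls s = tcls t <-> tcong s t.
Proof. by split => [/eqmodP/asboolP|st] //; apply/eqmodP/asboolP. Qed.

Lemma tcls_surj (x : tensor) : exists t, x = tcls t.
Proof. by exists (repr x); rewrite /tcls reprK. Qed.

Lemma tcong_repr t : tcong (repr (tcls t)) t.
Proof. by apply/tclsP; rewrite /tcls reprK. Qed.

Definition tn_add (x y : tensor) := tcls (TAdd (repr x) (repr y)).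
Definition tn_scale (k : K) (x : tensor) := tcls (TScale k (repr x)).
Definition tn_opp (x : tensor) := tn_scale (-1) x.

Lemma tn_addE s t : tn_add (tcls s) (tcls t) = tcls (TAdd s t).
Proof. by apply/tclsP; apply: tc_add; apply: tcong_repr. Qed.
Lemma tn_scaleE k t : tn_scale k (tcls t) = tcls (TScale k t).
Proof. by apply/tclsP; apply: tc_scale; apply: tcong_repr. Qed.

Definition tn_E := (tn_addE, tn_scaleE).

Lemma tn_addA : associative tn_add.
Proof.
move=> x y z; have [[s ->] [t ->] [u ->]] :=
  And3 (tcls_surj x) (tcls_surj y) (tcls_surj z).
by rewrite !tn_E; apply/tclsP; apply: tc_addA.
Qed.
Lemma tn_addC : commutative tn_add.
Proof.
move=> x y; have [[s ->] [t ->]] := conj (tcls_surj x) (tcls_surj y).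
by rewrite !tn_E; apply/tclsP; apply: tc_addC.
Qed.
Lemma tn_add0 : left_id (tcls (TPure 0 0)) tn_add.
Proof.
by move=> x; have [s ->] := tcls_surj x; rewrite tn_E; apply/tclsP; apply: tc_add0.
Qed.
Lemma tn_addN : left_inverse (tcls (TPure 0 0)) tn_opp tn_add.
Proof.
move=> x; have [s ->] := tcls_surj x.
by rewrite /tn_opp !tn_E; apply/tclsP; apply: tc_addN.
Qed.

HB.instance Definition _ := GRing.isZmodule.Build tensor
  tn_addA tn_addC tn_add0 tn_addN.

Lemma tn_scaleA k l x : tn_scale k (tn_scale l x) = tn_scale (k * l) x.
Proof.
by have [s ->] := tcls_surj x; rewrite !tn_E; apply/tclsP; apply: tc_scaleA.
Qed.
Lemma tn_scale1 : left_id 1 tn_scale.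
Proof.
by move=> x; have [s ->] := tcls_surj x; rewrite !tn_E; apply/tclsP; apply: tc_scale1.
Qed.
Lemma tn_scaleDr : right_distributive tn_scale +%R.
Proof.
move=> k x y; have [[s ->] [t ->]] := conj (tcls_surj x) (tcls_surj y).
rewrite -![LHS]/(tn_scale _ (tn_add _ _)) -![RHS]/(tn_add _ _).
by rewrite !tn_E; apply/tclsP; apply: tc_scaleDr.
Qed.
Lemma tn_scaleDl x : {morph tn_scale^~ x : k l / k + l}.
Proof.
move=> k l; have [s ->] := tcls_surj x; rewrite -[RHS]/(tn_add _ _).
by rewrite !tn_E; apply/tclsP; apply: tc_scaleDl.
Qed.

HB.instance Definition _ := GRing.Zmodule_isLmodule.Build K tensor
  tn_scaleA tn_scale1 tn_scaleDr tn_scaleDl.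

Definition pure (v : V) (w : W) : tensor := tcls (TPure v w).

Lemma tcls_add s t : tcls (TAdd s t) = tcls s + tcls t.
Proof. by rewrite -tn_E. Qed.
Lemma tcls_scale k s : tcls (TScale k s) = k *: tcls s.
Proof. by rewrite -tn_E. Qed.

Lemma pureDl v v' w : pure (v + v') w = pure v w + pure v' w.
Proof. by rewrite -tcls_add; apply/tclsP; apply: tc_pureDl. Qed.
Lemma pureDr v w w' : pure v (w + w') = pure v w + pure v w'.
Proof. by rewrite -tcls_add; apply/tclsP; apply: tc_pureDr. Qed.
Lemma pureZl k v w : pure (k *: v) w = k *: pure v w.
Proof. by rewrite -tcls_scale; apply/tclsP; apply: tc_pureZl. Qed.
Lemma pureZr k v w : pure v (k *: w) = k *: pure v w.
Proof. by rewrite -tcls_scale; apply/tclsP; apply: tc_pureZr. Qed.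

Lemma tensor_ind (Q : tensor -> Prop) :
  (forall v w, Q (pure v w)) -> (forall x y, Q x -> Q y -> Q (x + y)) ->
  forall x, Q x.
Proof.
move=> Qp QD x; rewrite -[x]scale1r; move: 1 => k.
have [t ->] := tcls_surj x; elim: t k => [v w|s Qs t Qt|l s Qs] k.
- by rewrite -[tcls _]/(pure v w) -pureZl; apply: Qp.
- by rewrite tcls_add scalerDr; apply: QD.
- by rewrite tcls_scale scalerA.
Qed.

Section Lift.
Variable U : lmodType K.

Record bilin (f : V -> W -> U) : Prop := Bilin {
  bilinl : forall w, linear (fun v => f v w);
  bilinr : forall v, linear (f v)
}.

Fixpoint tteval (f : V -> W -> U) (t : tterm) : U :=
  match t with
  | TPure v w => f v w
  | TAdd s t => tteval f s + tteval f t
  | TScale k s => k *: tteval f s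
  end.

(* The linear map out of the tensor product induced by [f], meaningful only
   for bilinear [f]; see [tlift_pure] and [tlift_linear]. *)
Definition tlift (f : V -> W -> U) (x : tensor) : U := tteval f (repr x).

Variables (f : V -> W -> U) (fB : bilin f).

Lemma bilin0l w : f 0 w = 0.
Proof.
by have := bilinl fB w (-1) 0 0; rewrite scaler0 addr0 scaleN1r addNr.
Qed.

Lemma tteval_tcong s t : tcong s t -> tteval f s = tteval f t.
Proof.
elim=> {s t} /=.
- by move=> v v' w; have := bilinl fB w 1 v v'; rewrite !scale1r.
- by move=> v w w'; have := bilinr fB v 1 w w'; rewrite !scale1r.
- by move=> k v w; have := bilinl fB w k v 0; rewrite bilin0l !addr0.
- move=> k v w; have f0 : f v 0 = 0.
    by have := bilinr fB v (-1) 0 0; rewrite scaler0 addr0 scaleN1r addNr.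
  by have := bilinr fB v k w 0; rewrite f0 !addr0.
- by [].
- by move=> s t _ ->.
- by move=> s t u _ -> _ ->.
- by move=> s s' t t' _ -> _ ->.
- by move=> k s s' _ ->.
- by move=> s t u; rewrite addrA.
- by move=> s t; rewrite addrC.
- by move=> s; rewrite bilin0l add0r.
- by move=> s; rewrite bilin0l scaleN1r addNr.
- by move=> k l s; rewrite scalerA.
- by move=> s; rewrite scale1r.
- by move=> k s t; rewrite scalerDr.
- by move=> s k l; rewrite scalerDl.
Qed.

Lemma tlift_tcls t : tlift f (tcls t) = tteval f t.
Proof. exact: tteval_tcong (tcong_repr t). Qed.

Lemma tlift_pure v w : tlift f (pure v w) = f v w.
Proof. exact: tlift_tcls. Qed.

Lemma tlift_linear : linear (tlift f).
Proof.
move=> k x y; have [[s ->] [t ->]] := conj (tcls_surj x) (tcls_surj y).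
by rewrite -tcls_scale -tcls_add !tlift_tcls.
Qed.

Lemma tliftD x y : tlift f (x + y) = tlift f x + tlift f y.
Proof. by have := tlift_linear 1 x y; rewrite !scale1r. Qed.

Lemma tliftZ k x : tlift f (k *: x) = k *: tlift f x.
Proof.
have := tlift_linear k x 0; rewrite !addr0 => ->.
by have := tlift_linear (-1) 0 0; rewrite scaler0 addr0 scaleN1r addNr => ->; rewrite addr0.
Qed.
End Lift.
End TensorModule.

Notation "x \ox y" := (pure x y) (at level 40, left associativity) : ring_scope.

Lemma unital_functional (K : fieldType) (V : lmodType K) (e : V) :
  e != 0 -> exists2 l : V -> K^o, linear l & l e = 1.
Proof.
move=> e0.
pose sub (W : set V) := forall (k : K) x y, W x -> W y -> W (k *: x + y).
pose P (W : set V) := sub W /\ ~ W e.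
have [F FP Ftot|W [[Wsub We] Wmax]] := @Zorn_bigcup V P.
  split=> [k x y [X FX Xx] [Y FY Yy]|[X FX Xe]]; last by case: (FP X FX).
  have [XY|YX] := Ftot X Y FX FY.
    by exists Y => //; case: (FP Y FY) => + _; apply => //; apply: XY.
  by exists X => //; case: (FP X FX) => + _; apply => //; apply: YX.
have W0 : W 0.
  apply: contrapT => nW0.
  have Wempty x : ~ W x.
    by move=> Wx; apply: nW0; rewrite -(addNr x) -scaleN1r; apply: Wsub.
  apply: (Wmax [set 0]%classic); first by split=> [x /Wempty|/(_ 0 erefl)].
  by split=> [k x y -> ->|/eqP]; [rewrite scaler0 addr0|apply/negP].
have WZ k x : W x -> W (k *: x) by move=> Wx; rewrite -[_ *: _]addr0; apply: Wsub.
have WB x y : W x -> W y -> W (x - y).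
  by move=> Wx Wy; rewrite addrC -scaleN1r; apply: Wsub.
have Wdec x : exists c : K, W (x - c *: e).
  apply: contrapT => /forallNP nx.
  have nWx : ~ W x by move=> Wx; apply: (nx 0); rewrite scale0r subr0.
  apply: (Wmax [set y | exists c : K, W (y - c *: x)]%classic).
    split=> [y Wy|/(_ x)]; first by exists 0; rewrite scale0r subr0.
    by move/(_ (ex_intro _ 1 _)); rewrite scale1r subrr => /(_ W0).
  split=> [k y z [c Wc] [d Wd]|[c Wc]].
    exists (k * c + d); rewrite scalerDl -scalerA opprD addrACA -scalerBr.
    exact: Wsub.
  have [c0|c0] := eqVneq c 0; first by apply: We; rewrite -[e]subr0 -(scale0r x) -c0.
  apply: (nx c^-1).
  have := WZ (- c^-1) _ Wc.
  by rewrite scalerBr scalerA mulNr mulVf // !scaleNr scale1r opprK addrC.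
have Wuniq x c d : W (x - c *: e) -> W (x - d *: e) -> c = d.
  move=> Wc Wd; apply/eqP; rewrite -subr_eq0; apply/negPn/negP => cd.
  have := WZ (d - c)^-1 _ (WB _ _ Wc Wd).
  have -> : x - c *: e - (x - d *: e) = (d - c) *: e.
    by rewrite opprB addrC addrA subrK scalerBl.
  rewrite scalerA mulVf ?scale1r //.
  by rewrite -opprB oppr_eq0.
pose l x : K^o := projT1 (cid (Wdec x)).
have lP x : W (x - (l x : K) *: e) by rewrite /l; case: cid.
exists l => [k x y|]; last by apply: (Wuniq e) => //; rewrite scale1r subrr.
apply: (Wuniq (k *: x + y)) => //.
rewrite -[k *: l x]/(k * (l x : K)) scalerDl -scalerA opprD addrACA -scalerBr.
exact: Wsub.
Qed.

Section TensorAlgebra.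
Variables (K : fieldType) (A B : algType K).
Local Notation T := (tensor A B).

Definition tn_mul (x y : T) : T :=
  tlift (fun a b => tlift (fun a' b' => (a * a') \ox (b * b')) y) x.
Definition tn_one : T := 1 \ox 1.

Let mulB a b : bilin (fun (a' : A) (b' : B) => (a * a') \ox (b * b')).
Proof.
split=> [w|v] k x y; rewrite ?mulrDr -?scalerAr.
  by rewrite pureDl pureZl.
by rewrite pureDr pureZr.
Qed.

Let tlift_ext (V W U : lmodType K) (f g : V -> W -> U) x :
  bilin f -> bilin g -> (forall v w, f v w = g v w) -> tlift f x = tlift g x.
Proof.
move=> fB gB fg; elim/tensor_ind: x => [v w|x y Hx Hy].
  by rewrite !tlift_pure.
by rewrite !tliftD // Hx Hy.
Qed.

Let mulBB y : bilin (fun (a : A) (b : B) =>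
  tlift (fun a' b' => (a * a') \ox (b * b')) y).
Proof.
split=> [b|a] k u v; elim/tensor_ind: y => [a' b'|y z Hy Hz].
- by rewrite !tlift_pure // mulrDl -scalerAl pureDl pureZl.
- by rewrite !tliftD // Hy Hz scalerDr addrACA.
- by rewrite !tlift_pure // mulrDl -scalerAl pureDr pureZr.
- by rewrite !tliftD // Hy Hz scalerDr addrACA.
Qed.

Lemma tn_mul_pure a b a' b' : tn_mul (a \ox b) (a' \ox b') = (a * a') \ox (b * b').
Proof. by rewrite /tn_mul !tlift_pure. Qed.

Lemma tn_mulDl : left_distributive tn_mul +%R.
Proof. by move=> x y z; rewrite /tn_mul tliftD. Qed.

Lemma tn_mulDr : right_distributive tn_mul +%R.
Proof.
move=> x y z; elim/tensor_ind: x => [a b|x x' Hx Hx'].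
  by rewrite /tn_mul !tlift_pure // tliftD.
by rewrite !tn_mulDl Hx Hx' addrACA.
Qed.

Lemma tn_mulZl k x y : tn_mul (k *: x) y = k *: tn_mul x y.
Proof. by rewrite /tn_mul tliftZ. Qed.

Lemma tn_mulZr k x y : tn_mul x (k *: y) = k *: tn_mul x y.
Proof.
elim/tensor_ind: x => [a b|x x' Hx Hx'].
  by rewrite /tn_mul !tlift_pure // tliftZ.
by rewrite !tn_mulDl Hx Hx' scalerDr.
Qed.

Lemma tn_mulA : associative tn_mul.
Proof.
move=> x y z; elim/tensor_ind: x => [a b|x x' Hx Hx']; last first.
  by rewrite !tn_mulDl Hx Hx'.
elim/tensor_ind: y => [a' b'|y y' Hy Hy']; last first.
  by rewrite !(tn_mulDl, tn_mulDr) Hy Hy'.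
elim/tensor_ind: z => [a'' b''|z z' Hz Hz']; last first.
  by rewrite !tn_mulDr Hz Hz'.
by rewrite !tn_mul_pure !mulrA.
Qed.

Lemma tn_mul1 : left_id tn_one tn_mul.
Proof.
elim/tensor_ind => [a b|x y Hx Hy]; first by rewrite tn_mul_pure !mul1r.
by rewrite tn_mulDr Hx Hy.
Qed.

Lemma tn_mulx1 : right_id tn_one tn_mul.
Proof.
elim/tensor_ind => [a b|x y Hx Hy]; first by rewrite tn_mul_pure !mulr1.
by rewrite tn_mulDl Hx Hy.
Qed.

Lemma tn_1neq0 : tn_one != 0.
Proof.
have [l lL l1] := unital_functional (oner_neq0 A).
have [m mL m1] := unital_functional (oner_neq0 B).
have lmB : bilin (fun a b => (l a : K) *: (m b : K^o)).
  split=> [b|a] k u v.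
    by rewrite lL -[k *: l u]/(k * l u) scalerDl scalerA.
  by rewrite mL scalerDr !scalerA mulrC.
apply/eqP => /(congr1 (tlift (fun a b => (l a : K) *: (m b : K^o)))).
have t0 : tlift (fun a b => (l a : K) *: (m b : K^o)) (0 : T) = 0.
  by rewrite -(scale0r (0 : T)) tliftZ // scale0r.
rewrite t0 tlift_pure // l1 m1 scale1r => /eqP; apply/negP; exact: oner_neq0.
Qed.

HB.instance Definition _ := GRing.Zmodule_isNzRing.Build T
  tn_mulA tn_mul1 tn_mulx1 tn_mulDl tn_mulDr tn_1neq0.

Lemma tn_scaleAl (k : K) (x y : T) : k *: (x * y) = k *: x * y.
Proof. by rewrite -[RHS]/(tn_mul _ _) tn_mulZl. Qed.
HB.instance Definition _ := GRing.Lmodule_isLalgebra.Build K T tn_scaleAl.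
Lemma tn_scaleAr (k : K) (x y : T) : k *: (x * y) = x * (k *: y).
Proof. by rewrite -[RHS]/(tn_mul _ _) tn_mulZr. Qed.
HB.instance Definition _ := GRing.Lalgebra_isAlgebra.Build K T tn_scaleAr.

Lemma pureM a b a' b' : (a \ox b : T) * (a' \ox b') = (a * a') \ox (b * b').
Proof. exact: tn_mul_pure. Qed.
End TensorAlgebra.

(* [A^c] as a K-algebra: it is the target of the antipodes. *)

Section ConverseAlgebra.
Variables (K : fieldType) (A : algType K).

HB.instance Definition _ := GRing.Zmodule_isLmodule.Build K (A^c)
  (@scalerA K A) (@scale1r K A) (@scalerDr K A) (@scalerDl K A).
Let conv_scaleAl (k : K) (x y : A^c) : k *: (x * y) = k *: x * y.
Proof. exact: (@scalerAr K A). Qed.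
HB.instance Definition _ := GRing.Lmodule_isLalgebra.Build K (A^c) conv_scaleAl.
Let conv_scaleAr (k : K) (x y : A^c) : k *: (x * y) = x * (k *: y).
Proof. exact: (@scalerAl K A). Qed.
HB.instance Definition _ := GRing.Lalgebra_isAlgebra.Build K (A^c) conv_scaleAr.
End ConverseAlgebra.

Lemma comb11 (K : fieldType) (V : lmodType K) (v z : V) :
  v + (v + z) = (1 + 1 : K) *: v + z.
Proof. by rewrite scalerDl scale1r addrA. Qed.
Lemma comb1k (K : fieldType) (V : lmodType K) (k : K) (v z : V) :
  v + (k *: v + z) = (1 + k) *: v + z.
Proof. by rewrite scalerDl scale1r addrA. Qed.
Lemma combk1 (K : fieldType) (V : lmodType K) (k : K) (v z : V) :
  k *: v + (v + z) = (k + 1) *: v + z.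
Proof. by rewrite scalerDl scale1r addrA. Qed.
Lemma combkk (K : fieldType) (V : lmodType K) (k l : K) (v z : V) :
  k *: v + (l *: v + z) = (k + l) *: v + z.
Proof. by rewrite scalerDl addrA. Qed.
Lemma comb_kill (K : fieldType) (V : lmodType K) (k : K) (v z : V) :
  k = 0 -> z = 0 -> k *: v + z = 0.
Proof. by move=> -> ->; rewrite scale0r addr0. Qed.

Lemma comb_start (K : fieldType) (V : lmodType K) (x y : V) :
  x - y + 0 = 0 -> x = y.
Proof. by rewrite addr0 => /eqP; rewrite subr_eq0 => /eqP. Qed.

Lemma opp_pure (K : fieldType) (V W : lmodType K) (v : V) (w : W) :
  - (v \ox w) = (-1) *: (v \ox w).
Proof. by rewrite scaleN1r. Qed.

Ltac pullv v :=
  repeat match goal with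
  | |- context [@Algebra.add _ ?m (@Algebra.add _ (@GRing.scale _ _ ?l v) ?z)] =>
      lazymatch m with v => fail | @GRing.scale _ _ _ v => fail | _ => idtac end;
      rewrite (addrCA m (l *: v) z)
  | |- context [@Algebra.add _ ?m (@Algebra.add _ v ?z)] =>
      lazymatch m with v => fail | @GRing.scale _ _ _ v => fail | _ => idtac end;
      rewrite (addrCA m v z)
  end;
  rewrite ?(comb11, comb1k, combk1, combkk).

Ltac lincomb_step tac :=
  lazymatch goal with
  | |- @Algebra.add _ (@GRing.scale _ _ _ ?v) _ = _ =>
      pullv v; apply: comb_kill; first by tac
  | |- @Algebra.add _ ?v _ = _ => pullv v; apply: comb_kill; first by tac
  end.

Ltac lincomb tac :=
  apply: comb_start;
  rewrite ?(opprD, opprK, scalerDr, scalerN, scalerA, =^~ addrA);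
  rewrite -?scaleNr ?opp_pure;
  repeat (let x := fresh "p" in set x := (_ \ox _); move: x => x);
  repeat lincomb_step tac; try reflexivity.

Inductive Ugen := genE | genF | genK | genKi.

Section UqPresentation.
Variables (K0 : fieldType) (q : K0).
Local Notation E := (@Gen K0 _ genE).
Local Notation F := (@Gen K0 _ genF).
Local Notation K := (@Gen K0 _ genK).
Local Notation Ki := (@Gen K0 _ genKi).

Inductive Urel : term K0 Ugen -> term K0 Ugen -> Prop :=
| Urel_KKi : Urel (K * Ki) 1
| Urel_KiK : Urel (Ki * K) 1
| Urel_KE : Urel (K * E * Ki) ((q ^+ 2)%R *: E)
| Urel_KF : Urel (K * F * Ki) ((q ^- 2)%R *: F)
| Urel_EF : Urel (E * F - F * E) ((q - q^-1)^-1%R *: (K - Ki)).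

Definition Ueps (x : Ugen) : K0^o :=
  match x with genE | genF => 0 | genK | genKi => 1 end.

Lemma UepsP s t : Urel s t -> teval Ueps s = teval Ueps t.
Proof.
by case=> /=; rewrite ?(mulr0, mul0r, mulr1, mul1r, scale1r, add0r, scaleN1r, mulN1r, oppr0) // subrr mulr0.
Qed.

Definition Upres := Presentation UepsP.
Definition Uq : algType K0 := palg Upres.
End UqPresentation.

Inductive Cgen := gena | genb | genc | gend.

Section CqPresentation.
Variables (K0 : fieldType) (q : K0).
Local Notation a := (@Gen K0 _ gena).
Local Notation b := (@Gen K0 _ genb).
Local Notation c := (@Gen K0 _ genc).
Local Notation d := (@Gen K0 _ gend).

Inductive Crel : term K0 Cgen -> term K0 Cgen -> Prop :=
| Crel_ba : Crel (b * a) (q *: (a * b))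
| Crel_ca : Crel (c * a) (q *: (a * c))
| Crel_db : Crel (d * b) (q *: (b * d))
| Crel_dc : Crel (d * c) (q *: (c * d))
| Crel_cb : Crel (c * b) (b * c)
| Crel_ad : Crel (a * d - q^-1%R *: (b * c)) 1
| Crel_da : Crel (d * a - q *: (b * c)) 1.

Definition Ceps (x : Cgen) : K0^o :=
  match x with gena | gend => 1 | genb | genc => 0 end.

Lemma CepsP s t : Crel s t -> teval Ceps s = teval Ceps t.
Proof.
by case=> /=; rewrite ?(mulr0, mul0r, mulr1, mul1r, scale1r, add0r, oppr0, addr0).
Qed.

Definition Cpres := Presentation CepsP.
Definition CSL : algType K0 := palg Cpres.
End CqPresentation.


Section CoproductRelations.
Variables (K0 : fieldType) (q : K0) (A : algType K0).
Hypothesis q0 : q != 0.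

Lemma EF_coproduct (r : K0) (E F K Ki : A) :
  E * F = F * E + (r *: K - r *: Ki) ->
  K * F = q ^- 2 *: (F * K) -> Ki * E = q ^- 2 *: (E * Ki) ->
  (E \ox K + 1 \ox E) * (F \ox 1 + Ki \ox F)
   - (F \ox 1 + Ki \ox F) * (E \ox K + 1 \ox E) =
  r *: (K \ox K - Ki \ox Ki) :> tensor A A.
Proof.
move=> EF KF KiE.
rewrite !(mulrDl, mulrDr, pureM) ?(mul1r, mulr1) EF KF KiE.
rewrite !(pureDl, pureDr, pureZl, pureZr, =^~ scaleNr).
lincomb ltac:(ring).
Qed.

Lemma SL2_coproduct (a b c d : A)
  (Da := a \ox a + b \ox c : tensor A A) (Db := a \ox b + b \ox d : tensor A A)
  (Dc := c \ox a + d \ox c : tensor A A) (Dd := c \ox b + d \ox d : tensor A A) :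
  b * a = q *: (a * b) -> c * a = q *: (a * c) -> d * b = q *: (b * d) ->
  d * c = q *: (c * d) -> c * b = b * c ->
  a * d = 1 + q^-1 *: (b * c) -> d * a = 1 + q *: (b * c) ->
  [/\ Db * Da = q *: (Da * Db), Dc * Da = q *: (Da * Dc),
      Dd * Db = q *: (Db * Dd), Dd * Dc = q *: (Dc * Dd) &
      Dc * Db = Db * Dc] /\
  (Da * Dd - q^-1 *: (Db * Dc) = 1 /\ Dd * Da - q *: (Db * Dc) = 1).
Proof.
move=> ba ca db dc cb ad da.
have one : (1 : tensor A A) = 1 \ox 1 by [].
rewrite one /Da /Db /Dc /Dd; split; [split|split];
rewrite !(mulrDl, mulrDr, pureM) ?ba ?ca ?db ?dc ?cb ?ad ?da
  ?(pureDl, pureDr, pureZl, pureZr);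
lincomb ltac:(by field).
Qed.
End CoproductRelations.

Section HopfMaps.
Variables (K0 : fieldType) (q : K0).
Hypothesis q0 : q != 0.
Local Notation H := (Uq q).
Local Notation C := (CSL q).

Definition uE : H := pgenr (Upres q) genE.
Definition uF : H := pgenr (Upres q) genF.
Definition uK : H := pgenr (Upres q) genK.
Definition uKi : H := pgenr (Upres q) genKi.
Definition ca : C := pgenr (Cpres q) gena.
Definition cb : C := pgenr (Cpres q) genb.
Definition cc : C := pgenr (Cpres q) genc.
Definition cd : C := pgenr (Cpres q) gend.

Lemma uKKi : uK * uKi = 1.
Proof. by have := pgenrP (Urel_KKi q : @prel _ (Upres q) _ _); rewrite /= scale1r. Qed.
Lemma uKiK : uKi * uK = 1.
Proof. by have := pgenrP (Urel_KiK q : @prel _ (Upres q) _ _); rewrite /= scale1r. Qed.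
Lemma uKE : uK * uE = q ^+ 2 *: (uE * uK).
Proof.
have h : uK * uE * uKi = q ^+ 2 *: uE.
  have := pgenrP (Urel_KE q : @prel _ (Upres q) _ _).
  by rewrite /= -scalerAl mul1r.
by have := congr1 (fun x => x * uK) h; rewrite -mulrA uKiK mulr1 scalerAl.
Qed.
Lemma uKF : uK * uF = q ^- 2 *: (uF * uK).
Proof.
have h : uK * uF * uKi = q ^- 2 *: uF.
  have := pgenrP (Urel_KF q : @prel _ (Upres q) _ _).
  by rewrite /= -scalerAl mul1r.
by have := congr1 (fun x => x * uK) h; rewrite -mulrA uKiK mulr1 scalerAl.
Qed.
Lemma uEF : uE * uF = uF * uE + ((q - q^-1)^-1 *: uK - (q - q^-1)^-1 *: uKi).
Proof.
have := pgenrP (Urel_EF q : @prel _ (Upres q) _ _).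
rewrite /= -!scalerAl !mul1r !scaleN1r scalerBr -/uE -/uF => <-.
by rewrite addrC subrK.
Qed.
Lemma uKiE : uKi * uE = q ^- 2 *: (uE * uKi).
Proof.
have q2 : q ^+ 2 != 0 by rewrite expf_neq0 ?q0.
have := congr1 (fun x => uKi * x * uKi) uKE.
rewrite !mulrA uKiK mul1r -scalerAr -scalerAl -!mulrA uKKi mulr1 => ->.
by rewrite scalerA mulVf ?scale1r.
Qed.

Lemma cba : cb * ca = q *: (ca * cb).
Proof. by have := pgenrP (Crel_ba q : @prel _ (Cpres q) _ _); rewrite /= -scalerAl mul1r. Qed.
Lemma cca : cc * ca = q *: (ca * cc).
Proof. by have := pgenrP (Crel_ca q : @prel _ (Cpres q) _ _); rewrite /= -scalerAl mul1r. Qed.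
Lemma cdb : cd * cb = q *: (cb * cd).
Proof. by have := pgenrP (Crel_db q : @prel _ (Cpres q) _ _); rewrite /= -scalerAl mul1r. Qed.
Lemma cdc : cd * cc = q *: (cc * cd).
Proof. by have := pgenrP (Crel_dc q : @prel _ (Cpres q) _ _); rewrite /= -scalerAl mul1r. Qed.
Lemma ccb : cc * cb = cb * cc.
Proof. exact: pgenrP (Crel_cb q : @prel _ (Cpres q) _ _). Qed.
Lemma cad : ca * cd = 1 + q^-1 *: (cb * cc).
Proof.
have := pgenrP (Crel_ad q : @prel _ (Cpres q) _ _).
by rewrite /= -!scalerAl !mul1r scaleN1r scale1r => <-; rewrite subrK.
Qed.
Lemma cda : cd * ca = 1 + q *: (cb * cc).
Proof.
have := pgenrP (Crel_da q : @prel _ (Cpres q) _ _).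
by rewrite /= -!scalerAl !mul1r scaleN1r scale1r => <-; rewrite subrK.
Qed.

Definition epsH : {lrmorphism H -> K0^o} := plift (@paugP _ (Upres q)).
Definition epsC : {lrmorphism C -> K0^o} := plift (@paugP _ (Cpres q)).

Definition SHgen (x : Ugen) : H^c :=
  match x with
  | genE => - (uE * uKi) | genF => - (uK * uF) | genK => uKi | genKi => uK
  end.
Definition DHgen (x : Ugen) : tensor H H :=
  match x with
  | genE => uE \ox uK + 1 \ox uE
  | genF => uF \ox 1 + uKi \ox uF
  | genK => uK \ox uK
  | genKi => uKi \ox uKi
  end.
Definition SCgen (x : Cgen) : C^c :=
  match x with
  | gena => cd | genb => - q *: cb | genc => - q^-1 *: cc | gend => ca
  end.
Definition DCgen (x : Cgen) : tensor C C :=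
  match x with
  | gena => ca \ox ca + cb \ox cc
  | genb => ca \ox cb + cb \ox cd
  | genc => cc \ox ca + cd \ox cc
  | gend => cc \ox cb + cd \ox cd
  end.


Lemma DHgenP s t : Urel q s t -> teval DHgen s = teval DHgen t.
Proof.
case=> /=; rewrite -?scalerAl ?mul1r ?scale1r ?scaleN1r.
- by rewrite pureM !uKKi.
- by rewrite pureM !uKiK.
- rewrite !(mulrDl, mulrDr, pureM) uKE mulr1 -?scalerAl -!mulrA !uKKi !mulr1.
  by rewrite pureZl pureZr scalerDr.
- rewrite !(mulrDl, mulrDr, pureM) uKF mulr1 uKKi mul1r -?scalerAl -!mulrA !uKKi.
  by rewrite !mulr1 pureZl pureZr scalerDr.
- exact: EF_coproduct uEF uKF uKiE.
Qed.

Lemma DCgenP s t : Crel q s t -> teval DCgen s = teval DCgen t.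
Proof.
have [[ba ca' db dc cb'] [ad da]] :=
  SL2_coproduct q0 cba cca cdb cdc ccb cad cda.
by case=> /=; rewrite -?scalerAl ?mul1r ?scale1r ?scaleN1r.
Qed.

(* The products of [A^c] are spelled out, reversed, in [A]. *)
Lemma SHgenP s t : Urel q s t -> teval SHgen s = teval SHgen t.
Proof.
have q2 : q ^+ 2 != 0 by rewrite expf_neq0.
case.
- by change (uK * uKi = 1%:A); rewrite scale1r uKKi.
- by change (uKi * uK = 1%:A); rewrite scale1r uKiK.
- change (uK * (- (uE * uKi) * uKi) = - (uE * uKi) * (q ^+ 2)%:A).
  rewrite mulr_algr mulNr mulrN scalerN !mulrA uKE; congr (- _).
  by rewrite -!scalerAl -[uE * uK * uKi]mulrA uKKi mulr1.
- change (uK * (- (uK * uF) * uKi) = - (uK * uF) * (q ^- 2)%:A).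
  rewrite mulr_algr mulNr mulrN scalerN; congr (- _).
  rewrite uKF -scalerAl -[uF * uK * uKi]mulrA uKKi mulr1 -scalerAr uKF.
  by [].
- change (- (uK * uF) * - (uE * uKi) + (- (uE * uKi) * - (uK * uF)) * (-1)%:A
    = (uKi + uK * (-1)%:A) * ((q - q^-1)^-1)%:A).
  rewrite !mulr_algr !mulrNN !scaleN1r.
  have -> : uK * uF * (uE * uKi) = uF * uE.
    rewrite uKF -scalerAl !mulrA -[uF * uK * uE]mulrA uKE -scalerAr -scalerAl.
    by rewrite -!mulrA uKKi mulr1 scalerA mulVf // scale1r.
  have -> : uE * uKi * (uK * uF) = uE * uF.
    by rewrite -mulrA [uKi * _]mulrA uKiK mul1r.
  by rewrite uEF opprD addrA subrr add0r opprB scalerBr.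
Qed.

Lemma SCgenP s t : Crel q s t -> teval SCgen s = teval SCgen t.
Proof.
case.
- change (cd * (- q *: cb) = ((- q *: cb) * cd) * q%:A).
  by rewrite mulr_algr -scalerAr -scalerAl cdb scalerA mulrC scalerA.
- change (cd * (- q^-1 *: cc) = ((- q^-1 *: cc) * cd) * q%:A).
  by rewrite mulr_algr -scalerAr -scalerAl cdc scalerA mulrC scalerA.
- change ((- q *: cb) * ca = (ca * (- q *: cb)) * q%:A).
  by rewrite mulr_algr -scalerAr -scalerAl cba scalerA mulrC scalerA.
- change ((- q^-1 *: cc) * ca = (ca * (- q^-1 *: cc)) * q%:A).
  by rewrite mulr_algr -scalerAr -scalerAl cca scalerA mulrC scalerA.
- change ((- q *: cb) * (- q^-1 *: cc) = (- q^-1 *: cc) * (- q *: cb)).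
  by rewrite -!scalerAr -!scalerAl !scalerA mulrC ccb.
- change (ca * cd + (((- q^-1 *: cc) * (- q *: cb)) * (q^-1)%:A) * (-1)%:A = 1%:A).
  rewrite !mulr_algr -!scalerAr -!scalerAl !scalerA ccb cad scale1r.
  rewrite -addrA -scalerDl [X in X *: _](_ : _ = 0) ?scale0r ?addr0 //.
  by field.
- change (cd * ca + (((- q^-1 *: cc) * (- q *: cb)) * q%:A) * (-1)%:A = 1%:A).
  rewrite !mulr_algr -!scalerAr -!scalerAl !scalerA ccb cda scale1r.
  rewrite -addrA -scalerDl [X in X *: _](_ : _ = 0) ?scale0r ?addr0 //.
  by field.
Qed.

Definition DeltaH : {lrmorphism H -> tensor H H} :=
  @plift _ (Upres q) _ _ DHgenP.
Definition DeltaC : {lrmorphism C -> tensor C C} :=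
  @plift _ (Cpres q) _ _ DCgenP.
Definition SH : H -> H := @plift _ (Upres q) _ _ SHgenP.
Definition SC : C -> C := @plift _ (Cpres q) _ _ SCgenP.
End HopfMaps.

(* Sweedler notation: [sweedler2 D F x] is the sum of F x_(1) x_(2), and
   [sweedler3 D F x] that of F x_(1) x_(2) x_(3), for bilinear, resp.
   trilinear, F. *)
Definition sweedler2 (K : fieldType) (A U : lmodType K) (D : A -> tensor A A)
    (F : A -> A -> U) (x : A) : U :=
  tlift F (D x).
Definition sweedler3 (K : fieldType) (A U : lmodType K) (D : A -> tensor A A)
    (F : A -> A -> A -> U) (x : A) : U :=
  sweedler2 D (fun x1 => sweedler2 D (F x1)) x.

Section SweedlerTheory.
Variable K : fieldType.

Lemma linear_tlift (V W V' U : lmodType K) (G : V' -> V -> W -> U) t :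
  (forall v', bilin (G v')) -> (forall v w, linear (fun v' => G v' v w)) ->
  linear (fun v' => tlift (G v') t).
Proof.
move=> GB GL k x y; elim/tensor_ind: t => [v w|t t' Ht Ht'].
  by rewrite !tlift_pure // GL.
by rewrite !tliftD // Ht Ht' scalerDr addrACA.
Qed.

Record trilin (V1 V2 V3 U : lmodType K) (F : V1 -> V2 -> V3 -> U) : Prop :=
  Trilin {
    trilin1 : forall y z, linear (fun x => F x y z);
    trilin2 : forall x z, linear (fun y => F x y z);
    trilin3 : forall x y, linear (F x y)
  }.

Variables (A : lmodType K) (D : {linear A -> tensor A A}).

Lemma sweedler2_linear (U : lmodType K) (F : A -> A -> U) :
  bilin F -> linear (sweedler2 D F).
Proof. by move=> FB k x y; rewrite /sweedler2 linearP tlift_linear. Qed.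

Lemma bilin_trilin (U : lmodType K) (F : A -> A -> A -> U) x :
  trilin F -> bilin (F x).
Proof. by case=> F1 F2 F3; split. Qed.

Lemma sweedler3_bilin (U : lmodType K) (F : A -> A -> A -> U) :
  trilin F -> bilin (fun x1 => sweedler2 D (F x1)).
Proof.
move=> FT; split=> [w|v]; last exact/sweedler2_linear/bilin_trilin.
by apply: linear_tlift => [v|y z]; [exact: bilin_trilin|case: FT].
Qed.

Lemma sweedler3_linear (U : lmodType K) (F : A -> A -> A -> U) :
  trilin F -> linear (sweedler3 D F).
Proof. by move=> FT; apply/sweedler2_linear/sweedler3_bilin. Qed.

Lemma linear_sweedler3 (V U : lmodType K) (G : V -> A -> A -> A -> U) t :
  (forall v, trilin (G v)) -> (forall x y z, linear (fun v => G v x y z)) ->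
  linear (fun v => sweedler3 D (G v) t).
Proof.
move=> GT GL; apply: linear_tlift => [v|x w]; first exact: sweedler3_bilin.
by apply: linear_tlift => [v|y z] //; apply: bilin_trilin.
Qed.
End SweedlerTheory.

Section HopfPairing.
Variables (K0 : fieldType) (q : K0) (q0 : q != 0).
Local Notation H := (Uq q).
Local Notation C := (CSL q).
Local Notation DH := (DeltaH q0).
Local Notation DC := (DeltaC q0).

Definition pairing_gen (x : Cgen) (y : Ugen) : K0 :=
  match x, y with
  | gena, genK | gend, genKi => q
  | gena, genKi | gend, genK => q^-1
  | genb, genE | genc, genF => 1
  | _, _ => 0
  end.

Record is_Hopf_pairing (phi : C -> H -> K0^o) : Prop := IsHopfPairing {
  hp_bilin : bilin phi;
  hp_mulr : forall g h h',
    phi g (h * h') = sweedler2 DC (fun g1 g2 => phi g1 h * phi g2 h') g;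
  hp_mull : forall g g' h,
    phi (g * g') h = sweedler2 DH (fun h1 h2 => phi g h1 * phi g' h2) h;
  hp_1l : forall h, phi 1 h = epsH q h;
  hp_1r : forall g, phi g 1 = epsC q g;
  hp_S : forall g h, phi (SC q0 g) h = phi g (SH q0 h);
  hp_gen : forall x y,
    phi (pgenr (Cpres q) x) (pgenr (Upres q) y) = pairing_gen x y
}.

Variable phi : C -> H -> K0^o.

(* D(H) as a vector space; [g \ox h] stands for the product g.h of g in C^op
   and h in H. *)
Definition double : lmodType K0 := tensor C H.

(* (g.h)(g'.h') = g.(h.g').h', with h.g' given by the cross-relation; the
   product of g and g'_(2) in C^op is [g'2 * g]. *)
Definition dmul (x y : double) : double :=
  tlift (fun g h => tlift (fun g' h' =>
    sweedler3 DC (fun g'1 g'2 g'3 =>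
      sweedler3 DH (fun h1 h2 h3 =>
        (phi g'1 (SH q0 h1) * phi g'3 h3 : K0) *: ((g'2 * g) \ox (h2 * h'))) h) g')
    y) x.

(* D(H)^* consists of the f : double -> K0 with [scalar f]. *)
Definition lact (x : double) (f : double -> K0^o) : double -> K0^o :=
  fun y => f (dmul y x).
Definition ract (f : double -> K0^o) (x : double) : double -> K0^o :=
  fun y => f (dmul x y).

Record sub_bimodule (M : set (double -> K0^o)) : Prop := SubBimodule {
  sb_dual : forall f, M f -> scalar f;
  sb_0 : M 0;
  sb_lin : forall (k : K0) f g, M f -> M g -> M (k *: f + g);
  sb_lact : forall x f, M f -> M (lact x f);
  sb_ract : forall x f, M f -> M (ract f x)
}.

Definition gen_bimodule (f : double -> K0^o) : set (double -> K0^o) :=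
  [set g | forall M, sub_bimodule M -> M f -> M g]%classic.

Definition finite_dimensional (M : set (double -> K0^o)) : Prop :=
  exists n (b : 'I_n -> double -> K0^o), (forall i, M (b i)) /\
    forall f, M f -> exists c : 'I_n -> K0, f = \sum_i c i *: b i.

(* The inclusion of H \ox C in D(H)^*: h \ox g takes the value
   phi(g, h') phi(g', h) on g' \ox h'.  Beware that g' \ox h' is the product
   g'.h' of D(H), not h'.g': with the latter, x <| E would act only on the
   factor in C, by a twisted derivation sending a to c, and would not vanish
   on [v1] below. *)
Definition dual_embed (x : tensor H C) : double -> K0^o :=
  fun y => tlift (fun h g => tlift (fun g' h' => phi g h' * phi g' h) y) x.

Section DoubleTheory.
Hypothesis phiP : is_Hopf_pairing phi.

Let phil h : linear (fun g => phi g h : K0^o) := bilinl (hp_bilin phiP) h.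
Let phir g : linear (phi g) := bilinr (hp_bilin phiP) g.

Let dual_embed_bilin h g : bilin (fun g' h' => phi g h' * phi g' h : K0^o).
Proof.
split=> [h'|g'] k x y; first by rewrite phil mulrDr -scalerAr.
by rewrite phir mulrDl -scalerAl.
Qed.

Let dual_embed_bilin2 y :
  bilin (fun h g => tlift (fun g' h' => phi g h' * phi g' h : K0^o) y).
Proof.
split=> [g|h]; apply: linear_tlift => // g' h' k u v.
  by rewrite phir mulrDr -scalerAr.
by rewrite phil mulrDl -scalerAl.
Qed.

Lemma dual_embed_pure h g g' h' : dual_embed (h \ox g) (g' \ox h') = phi g h' * phi g' h.
Proof. by rewrite /dual_embed !tlift_pure. Qed.

Lemma dual_embed_scalar x : scalar (dual_embed x).
Proof.
elim/tensor_ind: x => [h g|x x' Hx Hx'] k u v.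
  by rewrite /dual_embed !tlift_pure // tlift_linear.
by move: (Hx k u v) (Hx' k u v); rewrite /dual_embed !tliftD // => -> ->;
  rewrite mulrDr addrACA.
Qed.

Lemma dual_embed_linear : linear dual_embed.
Proof. by move=> k x y; apply/funext => u; rewrite /dual_embed tlift_linear. Qed.

Let SH_linear : linear (SH q0).
Proof.
move=> k x y; exact: (@plift_linear _ (Upres q) _ _ (SHgenP q0) k x y).
Qed.

Local Notation dmulH g h h' g1 g2 g3 := (sweedler3 DH (fun h1 h2 h3 =>
  (phi g1 (SH q0 h1) * phi g3 h3 : K0) *: ((g2 * g : C) \ox (h2 * h' : H))) h).

Let dmulH_trilin (g : C) (h' : H) (g1 g2 g3 : C) : trilin (fun h1 h2 h3 =>
  (phi g1 (SH q0 h1) * phi g3 h3 : K0) *: ((g2 * g : C) \ox (h2 * h' : H))).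
Proof.
split=> x y k u v.
- rewrite SH_linear phir mulrDl scalerDl -[k *: _]/(k * _).
  by rewrite -mulrA scalerA.
- by rewrite mulrDl -scalerAl pureDr pureZr scalerDr !scalerA mulrC.
- by rewrite phir mulrDr scalerDl -[k *: _]/(k * _) mulrCA scalerA.
Qed.

Let dmulC_trilin (g : C) (h h' : H) : trilin (fun g1 g2 g3 : C => dmulH g h h' g1 g2 g3).
Proof.
split=> x y; apply: linear_sweedler3 => // h1 h2 h3 k u v.
- by rewrite phil mulrDl scalerDl -[k *: _]/(k * _) -mulrA scalerA.
- by rewrite mulrDl -scalerAl pureDl pureZl scalerDr !scalerA mulrC.
- by rewrite phil mulrDr scalerDl -[k *: _]/(k * _) mulrCA scalerA.
Qed.

Let dmul_bilinr (g : C) (h : H) : bilin (fun (g' : C) (h' : H) =>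
  sweedler3 DC (fun g1 g2 g3 => dmulH g h h' g1 g2 g3) g').
Proof.
split=> [h'|g']; first exact: sweedler3_linear.
apply: linear_sweedler3 => // g1 g2 g3.
apply: linear_sweedler3 => // h1 h2 h3 k u v.
by rewrite mulrDr -scalerAr pureDr pureZr scalerDr !scalerA mulrC.
Qed.

Let dmul_bilinl y : bilin (fun (g : C) (h : H) => tlift (fun (g' : C) (h' : H) =>
  sweedler3 DC (fun g1 g2 g3 => dmulH g h h' g1 g2 g3) g') y).
Proof.
split=> [h|g]; apply: linear_tlift => // g' h'; apply: linear_sweedler3 => // g1 g2 g3.
  apply: linear_sweedler3 => // h1 h2 h3 k u v.
  by rewrite mulrDr -scalerAr pureDl pureZl scalerDr !scalerA mulrC.
exact: sweedler3_linear.
Qed.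

Lemma dmul_pure g h g' h' : dmul (g \ox h) (g' \ox h') =
  sweedler3 DC (fun g'1 g'2 g'3 =>
    sweedler3 DH (fun h1 h2 h3 =>
      (phi g'1 (SH q0 h1) * phi g'3 h3 : K0) *: ((g'2 * g) \ox (h2 * h'))) h) g'.
Proof. by rewrite /dmul !tlift_pure. Qed.

(* The cross-relation of D(H). *)
Lemma dmul_cross h g : dmul (1 \ox h) (g \ox 1) =
  sweedler3 DC (fun g1 g2 g3 =>
    sweedler3 DH (fun h1 h2 h3 =>
      (phi g1 (SH q0 h1) * phi g3 h3 : K0) *: (g2 \ox h2)) h) g.
Proof.
rewrite dmul_pure; congr (sweedler3 DC _ g); do 3 (apply/funext => ?).
by congr (sweedler3 DH _ h); do 3 (apply/funext => ?); rewrite !mulr1.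
Qed.

Lemma dmul_bilin : bilin dmul.
Proof.
split=> [y|x]; first by move=> k u v; rewrite /dmul tlift_linear.
elim/tensor_ind: x => [g h|x x' Hx Hx'] k u v.
  by rewrite /dmul !(tlift_pure (dmul_bilinl _)) tlift_linear.
move: (Hx k u v) (Hx' k u v); rewrite /dmul !(tliftD (dmul_bilinl _)) => -> ->.
by rewrite scalerDr addrACA.
Qed.
End DoubleTheory.

Definition highest_weight : set (tensor H C) :=
  [set x | lact (1 \ox uE q) (dual_embed x) = 0 /\
           ract (dual_embed x) (1 \ox uE q) = 0]%classic.

Definition gen_subalg (A : algType K0) (G : set A) : set A :=
  [set x | forall S : {pred A},
    subalg_closed S -> (forall y, G y -> y \in S) -> x \in S]%classic.

Let E := uE q.
Let F := uF q.
Let K := uK q.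
Let Ki := uKi q.
Let a := ca q.
Let c := cc q.

Definition casimir : H :=
  E * F + (q - q^-1) ^- 2 *: (q^-1 *: K + q *: Ki).
Definition v1 : tensor H C :=
  (q - q^-1) *: ((E * Ki) \ox (a * c)) - 1 \ox (c ^+ 2).
Definition v2 : tensor H C :=
  (q - q^-1) *: (casimir \ox (a * c))
  - ((q + q^-1) / (q - q^-1)) *: (K \ox (a * c))
  - q ^- 2 *: ((F * K) \ox (c ^+ 2)) + E \ox (a ^+ 2).
Definition v3 : tensor H C := (E * Ki) \ox 1.
Definition v4 : tensor H C := casimir \ox 1.
End HopfPairing.

(* C(q), where C = R[i]. *)
Definition Cq (R : realType) : fieldType := {fraction {poly (complex R)}}.
Definition qvar (R : realType) : Cq R := tofrac ('X : {poly (complex R)}).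

Section Field.
Variable R : realType.
Local Notation q := (qvar R).

Lemma qvar_neq0 : q != 0.
Proof.
by rewrite /qvar -tofrac0 tofrac_eq polyX_eq0.
Qed.

Lemma qvarBV_neq0 : q - q^-1 != 0.
Proof.
rewrite subr_eq0; apply/eqP => /(congr1 ( *%R q)); rewrite divff ?qvar_neq0 //.
move=> /eqP; rewrite /qvar -tofracM -tofrac1 tofrac_eq => /eqP /(congr1 (size \o polyseq)) /=.
by rewrite -expr2 size_polyXn size_poly1.
Qed.
End Field.

(* Main.v *)
Require Import Defs.
From mathcomp Require Import all_boot all_algebra.
From mathcomp Require Import boolp classical_sets functions reals complex.
From mathcomp Require Import ring zify.

(** Write e = E K^-1. The transposes of left and right multiplication by E on
    D(H) are expressed by the two regular actions La and Ra of H on C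
    ([dmul_regular]). The pairing is nondegenerate on both sides
    ([C_nondegenerate], [H_nondegenerate]), so H \ox C embeds in D(H)^*, and the
    two highest weight conditions on x become equations in H \ox C
    ([highest_weightE]): the map 1 \ox La E kills x, and so does
      D : h \ox g |-> h e \ox g - e h \ox (Ra K g) + h \ox (Ra E g).
    Both maps are twisted derivations, so that their common zeros form a
    subalgebra; it contains the elements v1, v2, v3, v4 ([gen_HW]).

    For the converse, the kernel of La E on C is spanned by the monomials c^i a^l
    ([ker_E_span]), so that x is a sum of h_(i,l) \ox c^i a^l. The equation
    D x = 0 reads
      h_(i,l) e - q^(l-i) e h_(i,l) + [l+1] h_(i-1,l+1) = 0,
    hence x is determined by the coefficients h_(n,0) of the pure powers of c,
    and following the chain h_(n,0), h_(n-1,1), ..., h_(0,n) to its end shows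
    that the product of the operators h |-> h e - q^(2i-n) e h, for i <= n, kills
    h_(n,0). These operators are diagonal, up to a factor e, on the elements
    e^j K^m over the polynomials in the casimir. A power of e brings h_(n,0) to
    this form; the equation then bounds the exponents of K that occur, and
    dividing the power of e out again, [Dprod_ker] places h_(n,0) in degree n of
    the filtered algebra with generators e and the casimir in degree 0 and 1,
    F K, K, K^-1 in degree 2. All of these are coefficients of 1, respectively
    of c^2, in elements generated by v1, v2, v3, v4 without other pure powers of
    c ([Dprod_leading]): v3 and v4 give e and the casimir, v1 and v2 give 1 and
    F K, and K, K^-1 are combinations of the casimir, (F K) e and e (F K).
    Subtracting such elements from x leaves an element without pure powers of c,
    which is 0 ([HW_eq_gen]).

    For local finiteness, the matrix entries of a finite-dimensional
    representation of D(H) span a finite-dimensional sub-bimodule of D(H)^*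
    ([matrix_coef_dmul]), and the product of entries of two representations is an
    entry of their tensor product ([matrix_rep_tensor]). Each of v1, v2, v3, v4 is
    a combination of entries of one 4-dimensional representation, the product of
    the lower and the upper triangular L-operators ([v_representative]). *)

Set Implicit Arguments.
Unset Strict Implicit.
Unset Printing Implicit Defensive.

Import GRing.Theory.

Local Open Scope ring_scope.

(** * Linear maps, families and tensors *)

Section LinearMaps.
Variables (K : fieldType) (V U : lmodType K) (f : V -> U).
Hypothesis fL : linear f.

Lemma lin0 : f 0 = 0.
Proof. by have := fL (-1) 0 0; rewrite scaler0 addr0 scaleN1r addNr. Qed.

Lemma linD x y : f (x + y) = f x + f y.
Proof. by rewrite -[x]scale1r fL !scale1r. Qed.

Lemma linZ k x : f (k *: x) = k *: f x.
Proof. by rewrite -[_ *: _]addr0 fL lin0 addr0. Qed.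

Lemma linN x : f (- x) = - f x.
Proof. by rewrite -scaleN1r linZ scaleN1r. Qed.

Lemma linB x y : f (x - y) = f x - f y.
Proof. by rewrite linD linN. Qed.

Lemma lin_sum I (r : seq I) (P : pred I) F :
  f (\sum_(i <- r | P i) F i) = \sum_(i <- r | P i) f (F i).
Proof. exact: (big_morph f linD lin0). Qed.
End LinearMaps.

Lemma linear_tensor_ext (K : fieldType) (V W U : lmodType K)
    (f g : tensor V W -> U) : linear f -> linear g ->
  (forall v w, f (v \ox w) = g (v \ox w)) -> f =1 g.
Proof.
move=> fL gL fg x; elim/tensor_ind: x => [v w|x y Hx Hy]; first exact: fg.
by rewrite (linD fL) (linD gL) Hx Hy.
Qed.

Section Families.
Variables (K : fieldType) (V : lmodType K) (I : eqType) (m : I -> V).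

Definition lspan (x : V) : Prop :=
  exists s : seq (K * I), x = \sum_(t <- s) t.1 *: m t.2.

Definition lfree : Prop := forall (s : seq I) (c : I -> K), uniq s ->
  \sum_(i <- s) c i *: m i = 0 -> forall i, i \in s -> c i = 0.

Lemma lspan0 : lspan 0.
Proof. by exists [::]; rewrite big_nil. Qed.

Lemma lspan_gen i : lspan (m i).
Proof. by exists [:: (1, i)]; rewrite big_seq1 scale1r. Qed.

Lemma lspanP k x y : lspan x -> lspan y -> lspan (k *: x + y).
Proof.
move=> [s ->] [t ->]; exists ([seq (k * u.1, u.2) | u <- s] ++ t).
rewrite big_cat big_map scaler_sumr; congr (_ + _).
by apply: eq_bigr => u _; rewrite scalerA.
Qed.

Lemma lspanD x y : lspan x -> lspan y -> lspan (x + y).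
Proof. by rewrite -{2}[x]scale1r; exact: lspanP. Qed.

Lemma lspanZ k x : lspan x -> lspan (k *: x).
Proof. by move=> sx; rewrite -[_ *: _]addr0; exact: lspanP sx lspan0. Qed.

Lemma lspan_sum (J : Type) (r : seq J) (P : pred J) F :
  (forall j, P j -> lspan (F j)) -> lspan (\sum_(j <- r | P j) F j).
Proof. by move=> sF; elim/big_ind: _ => //; [exact: lspan0|exact: lspanD]. Qed.

Lemma lspan_uniq x : lspan x ->
  exists (s : seq I) (c : I -> K), uniq s /\ x = \sum_(i <- s) c i *: m i.
Proof.
move=> [s ->]; pose r := undup [seq t.2 | t <- s].
exists r, (fun i => \sum_(t <- s | t.2 == i) t.1); split; first exact: undup_uniq.
under [RHS]eq_bigr do rewrite scaler_suml.
rewrite (exchange_big_dep xpredT) //= big_seq [RHS]big_seq.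
apply: eq_bigr => t ts; have tr : t.2 \in r by rewrite mem_undup map_f.
rewrite big_mkcond (bigD1_seq t.2 tr) ?undup_uniq //= eqxx big1 ?addr0 // => i.
by rewrite eq_sym => /negPf ->.
Qed.

Lemma lfree_comp (J : eqType) (f : J -> I) (g : I -> J) :
  lfree -> cancel f g -> forall (s : seq J) (c : J -> K), uniq s ->
  \sum_(j <- s) c j *: m (f j) = 0 -> forall j, j \in s -> c j = 0.
Proof.
move=> mF fK s c us e0 j js.
have fI : injective f by apply: can_inj fK.
have := mF (map f s) (c \o g); rewrite (map_inj_uniq fI) us big_map => /(_ isT).
rewrite (eq_bigr (fun j => c j *: m (f j))) => [|i _]; last by rewrite /= fK.
by move=> /(_ e0 (f j)); rewrite /= fK map_f //; apply.
Qed.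
End Families.

Arguments lspanP {K V I m}.

Lemma lspan_sub (K : fieldType) (V U : lmodType K) (I J : eqType)
    (m : I -> V) (m' : J -> U) (f : V -> U) : linear f ->
  (forall i, lspan m' (f (m i))) -> forall x, lspan m x -> lspan m' (f x).
Proof.
move=> fL fm x [s ->]; rewrite (lin_sum fL); apply: lspan_sum => t _.
by rewrite (linZ fL); apply/lspanZ/fm.
Qed.

Lemma lspan_trans (K : fieldType) (V : lmodType K) (I J : eqType)
    (m : I -> V) (m' : J -> V) :
  (forall i, lspan m' (m i)) -> forall x, lspan m x -> lspan m' x.
Proof. by move=> mm'; apply: (@lspan_sub _ _ _ _ _ _ _ idfun). Qed.

Lemma pure_linl (K : fieldType) (V W : lmodType K) w :
  linear (fun v : V => v \ox w : tensor V W).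
Proof. by move=> k x y; rewrite pureDl pureZl. Qed.
Lemma pure_linr (K : fieldType) (V W : lmodType K) v :
  linear (fun w : W => v \ox w : tensor V W).
Proof. by move=> k x y; rewrite pureDr pureZr. Qed.

(** A tensor written with as few pure terms as possible has linearly
    independent left factors: a linear relation between them would let one
    term be absorbed into the others. *)
Lemma tensor_free_expansion (K : fieldType) (V W : lmodType K) (x : tensor V W) :
  exists n (u : 'I_n -> V) (w : 'I_n -> W),
    (forall c : 'I_n -> K, \sum_i c i *: u i = 0 -> forall i, c i = 0) /\
    x = \sum_i u i \ox w i.
Proof.
have [n [u [w xE]]] : exists n (u : 'I_n -> V) (w : 'I_n -> W),
    x = \sum_i u i \ox w i.
  elim/tensor_ind: x => [v w|x y [n [u [w ->]]] [n' [u' [w' ->]]]].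
    by exists 1%N, (fun=> v), (fun=> w); rewrite big_ord1.
  exists (n + n')%N, (fun i : 'I_(n + n') => match fintype.split i with inl j => u j | inr j => u' j end),
    (fun i : 'I_(n + n') => match fintype.split i with inl j => w j | inr j => w' j end).
  rewrite big_split_ord; congr (_ + _); apply: eq_bigr => i _.
    case: fintype.splitP => j /= e; last by have := ltn_ord i; rewrite e ltnNge leq_addr.
    by rewrite (val_inj e : i = j).
  case: fintype.splitP => j /= e; first by have := ltn_ord j; rewrite -e ltnNge leq_addr.
  by rewrite (val_inj (addnI e) : i = j).
elim: n => [|n IHn] in x u w xE *.
  by exists 0%N, u, w; split=> // c _ [].
case: (pselect (forall c : 'I_n.+1 -> K, \sum_i c i *: u i = 0 -> forall i, c i = 0)).
  by move=> uF; exists n.+1, u, w.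
move=> /existsNP [c /not_implyP [c0 /existsNP [i /eqP ci]]].
have uiE : u i = \sum_j (- (c (lift i j) / c i)) *: u (lift i j).
  move: c0; rewrite (bigD1_ord i) //= => /eqP; rewrite addr_eq0 => /eqP /(congr1 ( *:%R (c i)^-1)).
  rewrite scalerA mulVf // scale1r => ->; rewrite scalerN scaler_sumr -sumrN.
  by apply: eq_bigr => j _; rewrite scalerA scaleNr mulrC.
apply: (IHn x (fun j => u (lift i j)) (fun j => w (lift i j) - (c (lift i j) / c i) *: w i)).
rewrite xE (bigD1_ord i) //= uiE (lin_sum (pure_linl _)) -big_split /=.
apply: eq_bigr => j _; rewrite pureDr addrC; congr (_ + _).
by rewrite -scaleNr pureZl pureZr.
Qed.

(** Descending induction on the last coordinate: either it vanishes on the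
    subspace, or one vector of the subspace reduces all others to those on
    which it does. *)
Lemma subspace_finite_basis (K : fieldType) (V : lmodType K) n (b : 'I_n -> V)
    (M : V -> Prop) : M 0 -> (forall k x y, M x -> M y -> M (k *: x + y)) ->
  (forall x, M x -> exists c : 'I_n -> K, x = \sum_i c i *: b i) ->
  exists m (b' : 'I_m -> V), (forall i, M (b' i)) /\
    forall x, M x -> exists c : 'I_m -> K, x = \sum_i c i *: b' i.
Proof.
elim: n => [|n IHn] in b M *.
  move=> M0 _ Mb; exists 0%N, b; split=> //; by case.
move=> M0 ML Mb.
pose b0 (i : 'I_n) := b (lift ord0 i).
pose N x := M x /\ exists c : 'I_n -> K, x = \sum_i c i *: b0 i.
have N0 : N 0 by split=> //; exists (fun=> 0); rewrite big1 // => i _; rewrite scale0r.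
have NL k x y : N x -> N y -> N (k *: x + y).
  move=> [Mx [c xE]] [My [d yE]]; split; first exact: ML.
  exists (fun i => k * c i + d i); rewrite xE yE scaler_sumr -big_split /=.
  by apply: eq_bigr => i _; rewrite scalerDl scalerA.
have [m [b' [Nb' b'P]]] := IHn b0 N N0 NL (fun x h => h.2).
case: (pselect (exists f (c : 'I_n.+1 -> K), [/\ M f, f = \sum_i c i *: b i & c ord0 != 0])).
  move=> [f [c [Mf fE c0]]].
  exists m.+1, (fun i => oapp b' f (unlift ord0 i)); split.
    move=> i; case: unliftP => [j _|_] //=; by case: (Nb' j).
  move=> x Mx; have [d xE] := Mb x Mx.
  pose k := d ord0 / c ord0.
  have [|e eE] := b'P (- k *: f + x).
    split; first exact: ML.
    exists (fun i => d (lift ord0 i) - k * c (lift ord0 i)).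
    rewrite xE fE scaler_sumr -big_split big_ord_recl /= -[RHS]add0r; congr (_ + _).
      by rewrite scalerA -scalerDl mulNr divfK // addNr scale0r.
    by apply: eq_bigr => i _; rewrite scalerA -scalerDl mulNr addrC.
  exists (fun i => oapp e k (unlift ord0 i)); rewrite big_ord_recl unlift_none /=.
  under eq_bigr do rewrite liftK /=.
  by rewrite -eE addrA scaleNr subrr add0r.
move=> nf; exists m, b'; split=> [i|x Mx]; first by case: (Nb' i).
apply: b'P; split=> //; have [c xE] := Mb x Mx.
exists (fun i => c (lift ord0 i)); rewrite {1}xE big_ord_recl.
have [->|c0] := eqVneq (c ord0) 0; first by rewrite scale0r add0r.
by case: nf; exists x, c.
Qed.

Section TensorLift.
Variables (K : fieldType) (V W U X : lmodType K).

Lemma tlift_comp (f : U -> X) (F : V -> W -> U) t : linear f -> bilin F ->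
  f (tlift F t) = tlift (fun v w => f (F v w)) t.
Proof.
move=> fL FB; apply: (linear_tensor_ext (f := f \o tlift F)) t => [k x y|k x y|v w] /=.
- by rewrite tlift_linear // fL.
- by rewrite tlift_linear //; split=> [w|v] k' u u'; rewrite (bilinl FB, bilinr FB) fL.
- rewrite !tlift_pure //; split=> [v'|w'] k' u u';
  by rewrite (bilinl FB, bilinr FB) fL.
Qed.
End TensorLift.

Lemma palg_rmul_ind (K : fieldType) (P : presentation K) (Q : palg P -> Prop) :
  Q 1 -> (forall k x y, Q x -> Q y -> Q (k *: x + y)) ->
  (forall x g, Q x -> Q (x * pgenr P g)) -> forall x, Q x.
Proof.
move=> Q1 QL QM x; rewrite -[x]mul1r; move: 1 Q1.
elim/palg_ind: x => [g y|y|k x y Hx Hy z Qz|x y Hx Hy z Qz].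
- exact: QM.
- by rewrite mulr1.
- by rewrite mulrDr -scalerAr; apply: QL; [exact: Hx|exact: Hy].
- by rewrite mulrA; apply/Hy/Hx.
Qed.

Lemma qcommX (K : fieldType) (A : algType K) (k : K) (x y : A) n :
  x * y = k *: (y * x) -> x ^+ n * y = k ^+ n *: (y * x ^+ n).
Proof.
move=> xy; elim: n => [|n IHn]; first by rewrite !expr0 mul1r mulr1 scale1r.
by rewrite exprS -mulrA IHn -scalerAr !mulrA xy -scalerAl scalerA -mulrA -exprSr -exprS.
Qed.

Lemma qcommXX (K : fieldType) (A : algType K) (k : K) (x y : A) n m :
  x * y = k *: (y * x) -> x ^+ n * y ^+ m = k ^+ (n * m) *: (y ^+ m * x ^+ n).
Proof.
move=> /(@qcommX _ _ _ _ _ n) xy; elim: m => [|m IHm].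
  by rewrite muln0 !expr0 mul1r mulr1 scale1r.
rewrite [in LHS]exprSr mulrA IHm -scalerAl -[y ^+ m * _ * y]mulrA xy -scalerAr scalerA.
by rewrite -exprD mulrA -exprSr mulnS addnC.
Qed.

Lemma poly_vanish (K : fieldType) (p : {poly K}) (x : nat -> K) :
  injective x -> (forall t, p.[x t] = 0) -> p = 0.
Proof.
move=> xI px; apply/eqP; apply: contraT => p0.
have := max_poly_roots p0 (rs := [seq x t | t <- iota 0 (size p)]).
rewrite size_map size_iota ltnn; apply; last by rewrite map_inj_uniq ?iota_uniq.
by apply/allP => _ /mapP [t _ ->]; apply/rootP.
Qed.

(** * Quantum integers *)

Section QuantumIntegers.
Variables (K0 : fieldType) (q : K0).
Hypotheses (q0 : q != 0) (qX : forall n, q ^+ n.+1 != 1).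

Lemma qpow_inj : injective (fun n => q ^+ n).
Proof.
suff H m n : (m < n)%N -> q ^+ m != q ^+ n.
  move=> m n /eqP; case: (ltngtP m n) => // /H; last by rewrite eq_sym => /negPf ->.
  by move=> /negPf ->.
move=> mn; rewrite -(subnKC mn) addSnnS exprD -[X in X != _]mulr1.
by rewrite (inj_eq (mulfI (expf_neq0 m q0))) eq_sym qX.
Qed.

Lemma delta_neq0 : q - q^-1 != 0.
Proof.
rewrite subr_eq0; apply: contra (qX 1) => /eqP qE.
by rewrite expr2 {2}qE divff.
Qed.

Definition quantum_int n : K0 := (q ^+ n - q ^- n) / (q - q^-1).

Local Notation qint := quantum_int.

Lemma qint0 : qint 0 = 0.
Proof. by rewrite /quantum_int expr0 invr1 subrr mul0r. Qed.
Lemma qint1 : qint 1 = 1.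
Proof. by rewrite /quantum_int expr1 divff // delta_neq0. Qed.

Lemma qint_neq0 n : qint n.+1 != 0.
Proof.
rewrite mulf_neq0 ?invr_eq0 ?delta_neq0 // subr_eq0.
apply: contra (qX (n.*2.+1)) => /eqP qE.
by rewrite -doubleS -addnn exprD {2}qE divff // expf_neq0.
Qed.

Lemma qintS n : qint n.+1 = q ^- n + q * qint n.
Proof.
have := expf_neq0 n q0; have := delta_neq0; rewrite /quantum_int exprS; move: (q ^+ n) => y d0 y0.
by field; rewrite y0 q0 subr_eq0 -expr2 qX.
Qed.

Lemma qintS' n : qint n.+1 = q ^+ n + q^-1 * qint n.
Proof.
have := expf_neq0 n q0; have := delta_neq0; rewrite /quantum_int exprS; move: (q ^+ n) => y d0 y0.
by field; rewrite y0 q0 subr_eq0 -expr2 qX.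
Qed.

Definition quantum_fact n : K0 := \prod_(k < n) qint k.+1.
Local Notation qfact := quantum_fact.
Lemma qfact_neq0 n : qfact n != 0.
Proof. by apply/prodf_neq0 => k _; exact: qint_neq0. Qed.
Lemma qfactS n : qfact n.+1 = qfact n * qint n.+1.
Proof. by rewrite /quantum_fact big_ord_recr. Qed.
End QuantumIntegers.

(** * Sweedler sums and tensor algebras *)

Section SweedlerSums.
Variables (K : fieldType) (A : lmodType K) (D : A -> tensor A A).

(** Iterated coproducts as finite families, uniformly in the multilinear map:
    this turns rearrangements of Sweedler sums into exchanges of sums. *)
Lemma sweedler2_family x : exists s : seq (A * A),
  forall (U : lmodType K) (F : A -> A -> U), bilin F ->
    sweedler2 D F x = \sum_(t <- s) F t.1 t.2.
Proof.
rewrite /sweedler2; elim/tensor_ind: (D x) => [v w|y z [s sP] [t tP]].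
  by exists [:: (v, w)] => U F FB; rewrite tlift_pure // big_seq1.
by exists (s ++ t) => U F FB; rewrite tliftD // sP // tP // big_cat.
Qed.

Lemma sweedler3_family (DL : linear D) x : exists s : seq (A * A * A),
  forall (U : lmodType K) (F : A -> A -> A -> U), trilin F ->
    sweedler3 D F x = \sum_(t <- s) F t.1.1 t.1.2 t.2.
Proof.
have [s sP] := sweedler2_family x.
have [f fP] : exists f : A * A -> seq (A * A), forall t (U : lmodType K) (F : A -> A -> U),
    bilin F -> sweedler2 D F t.2 = \sum_(u <- f t) F u.1 u.2.
  by have [f fP] := choice (fun t : A * A => sweedler2_family t.2); exists f.
exists (flatten [seq [seq (t.1, u.1, u.2) | u <- f t] | t <- s]) => U F FT.
have B2 y : bilin (F y) by exact: bilin_trilin.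
rewrite /sweedler3 sP; last first.
  split=> [w k x' y'|y k x' y'].
    have LT : linear (fun y => tlift (F y) (D w)).
      by apply: linear_tlift => // u v; exact: trilin1 FT u v.
    exact: LT.
  by rewrite /sweedler2 DL (tlift_linear (B2 y)).
rewrite big_flatten big_map; apply: eq_bigr => t _.
by rewrite big_map fP.
Qed.
End SweedlerSums.

Section RightFactor.
Variables (K : fieldType) (A B B' : algType K).

Definition idt (f : B -> B') : tensor A B -> tensor A B' :=
  tlift (fun x y => x \ox f y : tensor A B').

Variable f : B -> B'.
Hypothesis fL : linear f.

Lemma idt_bilin : bilin (fun (x : A) y => x \ox f y : tensor A B').
Proof.
split=> [y|x] k u v; first by rewrite pureDl pureZl.
by rewrite fL pureDr pureZr.
Qed.
Lemma idt_pure x y : idt f (x \ox y) = x \ox f y.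
Proof. exact: tlift_pure idt_bilin _ _. Qed.
Lemma idt_lin : linear (idt f).
Proof. exact: tlift_linear idt_bilin. Qed.
End RightFactor.

Lemma idt_mul (K : fieldType) (A B : algType K) (f g : B -> B) :
  linear f -> linear g -> (forall y y', f (y * y') = f y * g y' + y * f y') ->
  forall u v : tensor A B, idt f (u * v) = idt f u * idt g v + u * idt f v.
Proof.
move=> fL gL fM u v; have [FL GL] := (idt_lin (A := A) fL, idt_lin (A := A) gL).
elim/tensor_ind: u => [x y|u u' Hu Hu']; last first.
  by rewrite !(mulrDl, linD FL, linD GL) Hu Hu' addrACA.
elim/tensor_ind: v => [x' y'|v v' Hv Hv']; last first.
  by rewrite !(mulrDr, linD FL, linD GL) Hv Hv' addrACA.
by rewrite !(pureM, idt_pure fL, idt_pure gL) fM pureDr.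
Qed.

Lemma idt_mulM (K : fieldType) (A B B' : algType K) (g : B -> B') :
  linear g -> (forall y y', g (y * y') = g y * g y') ->
  forall u v : tensor A B, idt g (u * v) = idt g u * idt g v.
Proof.
move=> gL gM u v; have GL := idt_lin (A := A) gL.
elim/tensor_ind: u => [x y|u u' Hu Hu']; last by rewrite !(mulrDl, linD GL) Hu Hu'.
elim/tensor_ind: v => [x' y'|v v' Hv Hv']; last by rewrite !(mulrDr, linD GL) Hv Hv'.
by rewrite !(pureM, idt_pure gL) gM.
Qed.

Section GeneratedSubalgebra.
Variables (K : fieldType) (A : algType K) (G : set A).

Lemma gen_subalg_in y : G y -> gen_subalg G y.
Proof. by move=> Gy S _; apply. Qed.
Lemma gen_subalg_1 : gen_subalg G 1.
Proof. by move=> S [S1 _ _] _. Qed.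
Lemma gen_subalgP k x y : gen_subalg G x -> gen_subalg G y -> gen_subalg G (k *: x + y).
Proof. by move=> Gx Gy S SA GS; have [_ SL _] := SA; apply: SL; [exact: Gx|exact: Gy]. Qed.
Lemma gen_subalgM x y : gen_subalg G x -> gen_subalg G y -> gen_subalg G (x * y).
Proof. by move=> Gx Gy S SA GS; have [_ _ SM] := SA; apply: SM; [exact: Gx|exact: Gy]. Qed.
Lemma gen_subalgZ k x : gen_subalg G x -> gen_subalg G (k *: x).
Proof.
move=> Gx; rewrite -[k *: x]addr0 -(subrr (1 : A)) addrA addrC -scaleN1r.
apply: gen_subalgP gen_subalg_1 _; apply: gen_subalgP Gx gen_subalg_1.
Qed.

Lemma gen_subalg_min (P : A -> Prop) : P 1 ->
  (forall k x y, P x -> P y -> P (k *: x + y)) -> (forall x y, P x -> P y -> P (x * y)) ->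
  (forall y, G y -> P y) -> forall x, gen_subalg G x -> P x.
Proof.
move=> P1 PL PM PG x /(_ [pred y | `[< P y >]]) H; apply/asboolP; apply: H.
  split=> [|k y z /asboolP Py /asboolP Pz|y z /asboolP Py /asboolP Pz]; apply/asboolP => //.
    exact: PL.
  exact: PM.
by move=> y Gy; apply/asboolP/PG.
Qed.
End GeneratedSubalgebra.

Section SweedlerProduct.
Variables (K : fieldType) (A : algType K) (D : {lrmorphism A -> tensor A A}).
Variables (U : lmodType K) (F : A -> A -> A -> U).
Hypothesis FT : trilin F.

Let DL : linear D. Proof. by move=> k x y; rewrite linearP. Qed.
Let lift3 (z : tensor A (tensor A A)) : U := tlift (fun x => tlift (F x)) z.

Let lift3_bilin : bilin (fun x => tlift (F x)).
Proof.
split=> [w|x]; last exact: tlift_linear (bilin_trilin x FT).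
by apply: linear_tlift => [x|y z]; [exact: bilin_trilin|exact: trilin1 FT y z].
Qed.

Let lift3_pure x y z : lift3 (x \ox (y \ox z)) = F x y z.
Proof. by rewrite /lift3 tlift_pure // tlift_pure //; exact: bilin_trilin. Qed.

Let sweedler3_lift x : sweedler3 D F x = lift3 (idt D (D x)).
Proof.
rewrite /sweedler3 /sweedler2; move: (D x).
apply: linear_tensor_ext => [||v w].
- exact: tlift_linear (sweedler3_bilin D FT).
- by move=> k u v; rewrite (idt_lin DL) /lift3 tlift_linear.
rewrite (idt_pure DL) (tlift_pure (sweedler3_bilin D FT)).
by rewrite /lift3 tlift_pure.
Qed.

Definition sweedler3_expansion (x : A) (s : seq (A * A * A)) : Prop :=
  forall (U : lmodType K) (F : A -> A -> A -> U), trilin F ->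
    sweedler3 D F x = \sum_(t <- s) F t.1.1 t.1.2 t.2.

(** A family that computes all Sweedler sums of x is an expression of its
    iterated coproduct in A \ox (A \ox A), and there the coproduct is an algebra
    morphism. *)
Lemma sweedler3_mul x y s t : sweedler3_expansion x s -> sweedler3_expansion y t ->
  sweedler3 D F (x * y) =
    \sum_(u <- s) \sum_(v <- t) F (u.1.1 * v.1.1) (u.1.2 * v.1.2) (u.2 * v.2).
Proof.
move=> sP tP; pose P (x1 x2 x3 : A) : tensor A (tensor A A) := x1 \ox (x2 \ox x3).
have PT : trilin P.
  by split=> u v k z w; rewrite /P ?pureDl ?pureZl ?pureDr ?pureZr.
have lift3L : linear lift3 by exact: tlift_linear lift3_bilin.
have famE z r : sweedler3_expansion z r -> idt D (D z) = \sum_(t <- r) P t.1.1 t.1.2 t.2.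
  move=> <- //; rewrite /sweedler3 /sweedler2; move: (D z).
  apply: linear_tensor_ext => [||v w]; first exact: idt_lin.
    exact: tlift_linear (sweedler3_bilin D PT).
  rewrite (idt_pure DL) (tlift_pure (sweedler3_bilin D PT)).
  rewrite /sweedler2; apply: (linear_tensor_ext (f := fun d => v \ox d) (g := tlift (P v))) => [||d1 d2].
  - exact: pure_linr.
  - exact: tlift_linear (bilin_trilin _ PT).
  by rewrite tlift_pure //; exact: bilin_trilin.
rewrite sweedler3_lift rmorphM (idt_mulM DL (rmorphM D)) (famE x s sP) (famE y t tP).
rewrite mulr_suml (lin_sum lift3L); apply: eq_bigr => u _.
rewrite mulr_sumr (lin_sum lift3L); apply: eq_bigr => v _.
by rewrite /P !pureM lift3_pure.
Qed.
End SweedlerProduct.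

(** * The regular actions of H on C *)

Section Pairing.
Variables (K0 : fieldType) (q : K0) (q0 : q != 0).
Hypothesis qX : forall n, q ^+ n.+1 != 1.
Variable phi : CSL q -> Uq q -> K0^o.
Hypothesis phiP : is_Hopf_pairing q0 phi.

Local Notation H := (Uq q).
Local Notation C := (CSL q).
Local Notation T := (tensor H C).
Local Notation DH := (DeltaH q0).
Local Notation DC := (DeltaC q0).
Local Notation E := (uE q).
Local Notation F := (uF q).
Local Notation K := (uK q).
Local Notation Ki := (uKi q).
Local Notation a := (ca q).
Local Notation b := (cb q).
Local Notation c := (cc q).
Local Notation d := (cd q).
Local Notation e := (E * Ki).
Local Notation delta := (q - q^-1).
Local Notation r := (delta ^- 2).
Local Notation qint := (quantum_int q).
Local Notation qfact := (quantum_fact q).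
Local Notation PP := {poly {poly K0}}.
Local Notation dual := (dual_embed phi).
Local Notation gen := (gen_subalg [set v1 q; v2 q; v3 q; v4 q]%classic).

Lemma phi_linl h : linear (fun g => phi g h).
Proof. exact: bilinl (hp_bilin phiP) h. Qed.

Lemma phi_linr g : linear (phi g).
Proof. exact: bilinr (hp_bilin phiP) g. Qed.

Lemma DH_E : DH E = E \ox K + 1 \ox E. Proof. exact: plift_gen. Qed.
Lemma DH_F : DH F = F \ox 1 + Ki \ox F. Proof. exact: plift_gen. Qed.
Lemma DH_K : DH K = K \ox K. Proof. exact: plift_gen. Qed.
Lemma DH_Ki : DH Ki = Ki \ox Ki. Proof. exact: plift_gen. Qed.
Lemma DC_a : DC a = a \ox a + b \ox c. Proof. exact: plift_gen. Qed.
Lemma DC_b : DC b = a \ox b + b \ox d. Proof. exact: plift_gen. Qed.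
Lemma DC_c : DC c = c \ox a + d \ox c. Proof. exact: plift_gen. Qed.
Lemma DC_d : DC d = c \ox b + d \ox d. Proof. exact: plift_gen. Qed.

Section SweedlerValues.
Variables (U : lmodType K0) (G : H -> H -> U).
Hypothesis GB : bilin G.

Lemma sweedler2_E : sweedler2 DH G E = G E K + G 1 E.
Proof. by rewrite /sweedler2 DH_E tliftD // !tlift_pure. Qed.
Lemma sweedler2_F : sweedler2 DH G F = G F 1 + G Ki F.
Proof. by rewrite /sweedler2 DH_F tliftD // !tlift_pure. Qed.
Lemma sweedler2_K : sweedler2 DH G K = G K K.
Proof. by rewrite /sweedler2 DH_K !tlift_pure. Qed.
Lemma sweedler2_Ki : sweedler2 DH G Ki = G Ki Ki.
Proof. by rewrite /sweedler2 DH_Ki !tlift_pure. Qed.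
Lemma sweedler2_1 : sweedler2 DH G 1 = G 1 1.
Proof. by rewrite /sweedler2 rmorph1 tlift_pure. Qed.
End SweedlerValues.

Lemma phi_bilin2 g g' : bilin (fun h h' => phi g h * phi g' h' : K0^o).
Proof.
by split=> [h'|h] k x y; rewrite phi_linr ?mulrDl ?mulrDr -?scalerAl -?scalerAr.
Qed.

Lemma phi_mul_E g g' : phi (g * g') E = phi g E * phi g' K + phi g 1 * phi g' E.
Proof. by rewrite (hp_mull phiP) sweedler2_E //; exact: phi_bilin2. Qed.
Lemma phi_mul_F g g' : phi (g * g') F = phi g F * phi g' 1 + phi g Ki * phi g' F.
Proof. by rewrite (hp_mull phiP) sweedler2_F //; exact: phi_bilin2. Qed.
Lemma phi_mul_K g g' : phi (g * g') K = phi g K * phi g' K.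
Proof. by rewrite (hp_mull phiP) sweedler2_K //; exact: phi_bilin2. Qed.
Lemma phi_mul_Ki g g' : phi (g * g') Ki = phi g Ki * phi g' Ki.
Proof. by rewrite (hp_mull phiP) sweedler2_Ki //; exact: phi_bilin2. Qed.
Lemma phi_mul_1 g g' : phi (g * g') 1 = phi g 1 * phi g' 1.
Proof. by rewrite (hp_mull phiP) sweedler2_1 //; exact: phi_bilin2. Qed.

Lemma epsC_gen x : phi (pgenr (Cpres q) x) 1 = Ceps K0 x.
Proof. by rewrite (hp_1r phiP) /epsC /= plift_gen. Qed.

Lemma phi1 h : phi 1 h = epsH q h. Proof. exact: hp_1l phiP h. Qed.

(** The left and right regular actions of H on C. *)
Definition La (h : H) (g : C) : C :=
  sweedler2 DC (fun g1 g2 => (phi g2 h : K0) *: g1) g.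
Definition Ra (h : H) (g : C) : C :=
  sweedler2 DC (fun g1 g2 => (phi g1 h : K0) *: g2) g.

Lemma La_bilin h : bilin (fun g1 g2 : C => (phi g2 h : K0) *: g1).
Proof.
split=> [g2|g1] k x y; last by rewrite phi_linl scalerDl -scalerA.
by rewrite scalerDr !scalerA mulrC.
Qed.
Lemma Ra_bilin h : bilin (fun g1 g2 : C => (phi g1 h : K0) *: g2).
Proof.
split=> [g2|g1] k x y; first by rewrite phi_linl scalerDl -scalerA.
by rewrite scalerDr !scalerA mulrC.
Qed.

Lemma La_lin h : linear (La h).
Proof. exact/sweedler2_linear/La_bilin. Qed.
Lemma Ra_lin h : linear (Ra h).
Proof. exact/sweedler2_linear/Ra_bilin. Qed.

Lemma phi_La g h h' : phi g (h' * h) = phi (La h g) h'.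
Proof.
rewrite (hp_mulr phiP) /La /sweedler2.
rewrite (tlift_comp (f := fun g => phi g h') _ (phi_linl h') (La_bilin h)).
congr tlift; apply/funext => g1; apply/funext => g2.
by rewrite (linZ (phi_linl h')) mulrC.
Qed.
Lemma phi_Ra g h h' : phi g (h * h') = phi (Ra h g) h'.
Proof.
rewrite (hp_mulr phiP) /Ra /sweedler2.
rewrite (tlift_comp (f := fun g => phi g h') _ (phi_linl h') (Ra_bilin h)).
congr tlift; apply/funext => g1; apply/funext => g2.
by rewrite (linZ (phi_linl h')).
Qed.

(** Both regular actions come from a map G with these properties. *)
Section ModuleAlgebra.
Variable G : H -> C -> C -> C.
Hypotheses (GB : forall h, bilin (G h)) (GL : forall g1 g2, linear (fun h => G h g1 g2)).
Hypothesis GM : forall h g1 g2 g1' g2', G h (g1 * g1') (g2 * g2') =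
  sweedler2 DH (fun h1 h2 => G h1 g1 g2 * G h2 g1' g2') h.

Lemma action_linh t : linear (fun h => tlift (G h) t).
Proof. exact: linear_tlift. Qed.

Lemma action_bilinh u v : bilin (fun h1 h2 => tlift (G h1) u * tlift (G h2) v).
Proof.
split=> [h2|h1] k x y; first by rewrite action_linh mulrDl scalerAl.
by rewrite action_linh mulrDr scalerAr.
Qed.

Lemma action_mul h u v : tlift (G h) (u * v) =
  sweedler2 DH (fun h1 h2 => tlift (G h1) u * tlift (G h2) v) h.
Proof.
have L k : linear (tlift (G k)) by exact: tlift_linear (GB k).
apply: (linear_tensor_ext (f := fun u => tlift (G h) (u * v))
  (g := fun u => sweedler2 DH (fun h1 h2 => tlift (G h1) u * tlift (G h2) v) h)) u
  => [k x y|k x y|g1 g2].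
- by rewrite mulrDl -scalerAl L.
- apply: (linear_tlift (G := fun u h1 h2 => tlift (G h1) u * tlift (G h2) v)) => [u|h1 h2 l z z'].
    exact: action_bilinh.
  by rewrite L mulrDl scalerAl.
apply: (linear_tensor_ext (f := fun v => tlift (G h) (g1 \ox g2 * v))
  (g := fun v => sweedler2 DH (fun h1 h2 => tlift (G h1) (g1 \ox g2) * tlift (G h2) v) h)) v
  => [k x y|k x y|g1' g2'].
- by rewrite mulrDr -scalerAr L.
- apply: (linear_tlift (G := fun v h1 h2 => tlift (G h1) (g1 \ox g2) * tlift (G h2) v))
    => [v|h1 h2 l z z'].
    exact: action_bilinh.
  by rewrite L mulrDr scalerAr.
rewrite pureM tlift_pure // GM; congr tlift; apply/funext => h1; apply/funext => h2.
by rewrite !tlift_pure.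
Qed.
End ModuleAlgebra.

Let La_form (h : H) (g1 g2 : C) : C := (phi g2 h : K0) *: g1.
Let Ra_form (h : H) (g1 g2 : C) : C := (phi g1 h : K0) *: g2.

Let La_form_linh g1 g2 : linear (fun h => La_form h g1 g2).
Proof. by move=> k x y; rewrite /La_form phi_linr scalerDl -scalerA. Qed.
Let Ra_form_linh g1 g2 : linear (fun h => Ra_form h g1 g2).
Proof. by move=> k x y; rewrite /Ra_form phi_linr scalerDl -scalerA. Qed.

Lemma La_linh g : linear (fun h => La h g).
Proof. exact: action_linh La_bilin La_form_linh (DC g). Qed.
Lemma Ra_linh g : linear (fun h => Ra h g).
Proof. exact: action_linh Ra_bilin Ra_form_linh (DC g). Qed.

Lemma La_bilinh g g' : bilin (fun h1 h2 => La h1 g * La h2 g').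
Proof. exact: action_bilinh La_bilin La_form_linh (DC g) (DC g'). Qed.
Lemma Ra_bilinh g g' : bilin (fun h1 h2 => Ra h1 g * Ra h2 g').
Proof. exact: action_bilinh Ra_bilin Ra_form_linh (DC g) (DC g'). Qed.

(** The axiom by which the pairing sends the product of C to the coproduct of
    H makes C a module algebra. *)
Lemma La_mul h g g' :
  La h (g * g') = sweedler2 DH (fun h1 h2 => La h1 g * La h2 g') h.
Proof.
rewrite {1}/La {1}/sweedler2 rmorphM; apply: (action_mul La_bilin La_form_linh).
move=> {}h g1 g2 g1' g2'; rewrite (hp_mull phiP) /sweedler2.
rewrite (tlift_comp (f := fun k : K0^o => (k : K0) *: (g1 * g1')) _ _ (phi_bilin2 _ _));
  last by move=> k x y; rewrite scalerDl -scalerA.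
congr tlift; apply/funext => h1; apply/funext => h2.
by rewrite -scalerAl -scalerAr scalerA.
Qed.

Lemma Ra_mul h g g' :
  Ra h (g * g') = sweedler2 DH (fun h1 h2 => Ra h1 g * Ra h2 g') h.
Proof.
rewrite {1}/Ra {1}/sweedler2 rmorphM; apply: (action_mul Ra_bilin Ra_form_linh).
move=> {}h g1 g2 g1' g2'; rewrite (hp_mull phiP) /sweedler2.
rewrite (tlift_comp (f := fun k : K0^o => (k : K0) *: (g2 * g2')) _ _ (phi_bilin2 _ _));
  last by move=> k x y; rewrite scalerDl -scalerA.
congr tlift; apply/funext => h1; apply/funext => h2.
by rewrite -scalerAl -scalerAr scalerA.
Qed.

Lemma phi_gens :
  (phi a E = 0) * (phi a F = 0) * (phi a K = q) * (phi a Ki = q^-1) * (phi a 1 = 1) *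
  (phi b E = 1) * (phi b F = 0) * (phi b K = 0) * (phi b Ki = 0) * (phi b 1 = 0) *
  (phi c E = 0) * (phi c F = 1) * (phi c K = 0) * (phi c Ki = 0) * (phi c 1 = 0) *
  (phi d E = 0) * (phi d F = 0) * (phi d K = q^-1) * (phi d Ki = q) * (phi d 1 = 1).
Proof.
by do !split; rewrite ?(hp_gen phiP) ?epsC_gen //;
  apply: (hp_gen phiP).
Qed.

Lemma La_gen h :
  (La h a = (phi a h : K0) *: a + (phi c h : K0) *: b) *
  (La h b = (phi b h : K0) *: a + (phi d h : K0) *: b) *
  (La h c = (phi a h : K0) *: c + (phi c h : K0) *: d) *
  (La h d = (phi b h : K0) *: c + (phi d h : K0) *: d).
Proof.
have LB := La_bilin h.
by do !split; rewrite /La /sweedler2 ?DC_a ?DC_b ?DC_c ?DC_d tliftD // !tlift_pure.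
Qed.

Lemma Ra_gen h :
  (Ra h a = (phi a h : K0) *: a + (phi b h : K0) *: c) *
  (Ra h b = (phi a h : K0) *: b + (phi b h : K0) *: d) *
  (Ra h c = (phi c h : K0) *: a + (phi d h : K0) *: c) *
  (Ra h d = (phi c h : K0) *: b + (phi d h : K0) *: d).
Proof.
have RB := Ra_bilin h.
by do !split; rewrite /Ra /sweedler2 ?DC_a ?DC_b ?DC_c ?DC_d tliftD // !tlift_pure.
Qed.

Lemma La_1r h : La h 1 = epsH q h *: (1 : C).
Proof.
rewrite /La /sweedler2 rmorph1 tlift_pure; last exact: La_bilin.
by rewrite (hp_1l phiP).
Qed.
Lemma Ra_1r h : Ra h 1 = epsH q h *: (1 : C).
Proof.
rewrite /Ra /sweedler2 rmorph1 tlift_pure; last exact: Ra_bilin.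
by rewrite (hp_1l phiP).
Qed.

Lemma epsH_gen :
  (epsH q E = 0 :> K0) * (epsH q F = 0 :> K0) * (epsH q K = 1 :> K0) * (epsH q Ki = 1 :> K0).
Proof. by do !split; rewrite /epsH /= plift_gen. Qed.

Lemma La_1 g : La 1 g = g.
Proof.
elim/palg_ind: g => [x||k x y Hx Hy|x y Hx Hy].
- by case: x; rewrite -?/(ca q) -?/(cb q) -?/(cc q) -?/(cd q) La_gen !phi_gens ?scale0r ?scale1r ?addr0 ?add0r.
- by rewrite La_1r rmorph1 scale1r.
- by rewrite La_lin Hx Hy.
- by rewrite La_mul sweedler2_1 ?Hx ?Hy //; exact: La_bilinh.
Qed.
Lemma Ra_1 g : Ra 1 g = g.
Proof.
elim/palg_ind: g => [x||k x y Hx Hy|x y Hx Hy].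
- by case: x; rewrite -?/(ca q) -?/(cb q) -?/(cc q) -?/(cd q) Ra_gen !phi_gens ?scale0r ?scale1r ?addr0 ?add0r.
- by rewrite Ra_1r rmorph1 scale1r.
- by rewrite Ra_lin Hx Hy.
- by rewrite Ra_mul sweedler2_1 ?Hx ?Hy //; exact: Ra_bilinh.
Qed.

Lemma La_mulE g g' : La E (g * g') = La E g * La K g' + g * La E g'.
Proof.
by rewrite La_mul sweedler2_E ?La_1 //; exact: La_bilinh.
Qed.
Lemma La_mulF g g' : La F (g * g') = La F g * g' + La Ki g * La F g'.
Proof.
by rewrite La_mul sweedler2_F ?La_1 //; exact: La_bilinh.
Qed.
Lemma La_mulK g g' : La K (g * g') = La K g * La K g'.
Proof. by rewrite La_mul sweedler2_K //; exact: La_bilinh. Qed.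
Lemma La_mulKi g g' : La Ki (g * g') = La Ki g * La Ki g'.
Proof. by rewrite La_mul sweedler2_Ki //; exact: La_bilinh. Qed.
Lemma Ra_mulE g g' : Ra E (g * g') = Ra E g * Ra K g' + g * Ra E g'.
Proof.
by rewrite Ra_mul sweedler2_E ?Ra_1 //; exact: Ra_bilinh.
Qed.
Lemma Ra_mulF g g' : Ra F (g * g') = Ra F g * g' + Ra Ki g * Ra F g'.
Proof.
by rewrite Ra_mul sweedler2_F ?Ra_1 //; exact: Ra_bilinh.
Qed.
Lemma Ra_mulK g g' : Ra K (g * g') = Ra K g * Ra K g'.
Proof. by rewrite Ra_mul sweedler2_K //; exact: Ra_bilinh. Qed.

Definition scale01 := (scale0r, scale1r, addr0, add0r).

Lemma La_E : (La E a = 0) * (La E b = a) * (La E c = 0) * (La E d = c).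
Proof. by do !split; rewrite La_gen !phi_gens !scale01. Qed.
Lemma La_F : (La F a = b) * (La F b = 0) * (La F c = d) * (La F d = 0).
Proof. by do !split; rewrite La_gen !phi_gens !scale01. Qed.
Lemma La_K : (La K a = q *: a) * (La K b = q^-1 *: b) * (La K c = q *: c) * (La K d = q^-1 *: d).
Proof. by do !split; rewrite La_gen !phi_gens !scale01. Qed.
Lemma La_Ki : (La Ki a = q^-1 *: a) * (La Ki b = q *: b) * (La Ki c = q^-1 *: c) * (La Ki d = q *: d).
Proof. by do !split; rewrite La_gen !phi_gens !scale01. Qed.
Lemma Ra_E : (Ra E a = c) * (Ra E c = 0).
Proof. by do !split; rewrite Ra_gen !phi_gens !scale01. Qed.
Lemma Ra_F : (Ra F a = 0) * (Ra F c = a).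
Proof. by do !split; rewrite Ra_gen !phi_gens !scale01. Qed.
Lemma Ra_K : (Ra K a = q *: a) * (Ra K c = q^-1 *: c).
Proof. by do !split; rewrite Ra_gen !phi_gens !scale01. Qed.
Lemma Ra_Ki : (Ra Ki a = q^-1 *: a) * (Ra Ki c = q *: c).
Proof. by do !split; rewrite Ra_gen !phi_gens !scale01. Qed.
Lemma regular_1 : (La E 1 = 0) * (La F 1 = 0) * (La K 1 = 1) * (La Ki 1 = 1) *
  (Ra E 1 = 0) * (Ra F 1 = 0) * (Ra K 1 = 1) * (Ra Ki 1 = 1).
Proof. by do !split; rewrite ?La_1r ?Ra_1r epsH_gen !scale01. Qed.

Lemma grouplikeX (f : C -> C) (k : K0) x n : f 1 = 1 ->
  (forall g g', f (g * g') = f g * f g') -> f x = k *: x -> f (x ^+ n) = k ^+ n *: x ^+ n.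
Proof.
move=> f1 fM fx; elim: n => [|n IHn]; first by rewrite !expr0 scale1r.
by rewrite !exprS fM fx IHn -scalerAl -scalerAr scalerA.
Qed.

Lemma skewX0 (f g : C -> C) x n : f 1 = 0 ->
  (forall y y', f (y * y') = f y * g y' + y * f y') -> f x = 0 -> f (x ^+ n) = 0.
Proof.
move=> f1 fM fx; elim: n => [|n IHn]; first by rewrite expr0.
by rewrite exprS fM fx IHn mul0r mulr0 addr0.
Qed.

Definition La_KX x k n := @grouplikeX (La K) k x n regular_1.1.1.1.1.1.2 La_mulK.
Definition La_KiX x k n := @grouplikeX (La Ki) k x n regular_1.1.1.1.1.2 La_mulKi.
Definition Ra_KX x k n := @grouplikeX (Ra K) k x n regular_1.1.2 Ra_mulK.

Lemma La_EX0 x n : La E x = 0 -> La E (x ^+ n) = 0.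
Proof. by apply: skewX0 La_mulE; rewrite regular_1. Qed.
Lemma Ra_EX0 x n : Ra E x = 0 -> Ra E (x ^+ n) = 0.
Proof. by apply: skewX0 Ra_mulE; rewrite regular_1. Qed.

(** * The kernel of E on C and nondegeneracy in C *)

Lemma ba j : b ^+ j * a = q ^+ j *: (a * b ^+ j).
Proof. exact/qcommX/cba. Qed.
Lemma bd j : b ^+ j * d = q ^- j *: (d * b ^+ j).
Proof. by rewrite -exprVn; apply: qcommX; rewrite cdb scalerA mulVf // scale1r. Qed.
Lemma bc j : b ^+ j * c = c * b ^+ j.
Proof. by have := @qcommX _ C 1 b c j; rewrite ccb expr1n !scale1r; apply. Qed.
Lemma ac n : a ^+ n * c = q ^- n *: (c * a ^+ n).
Proof. by rewrite -exprVn; apply: qcommX; rewrite cca scalerA mulVf // scale1r. Qed.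
Lemma dc n : d ^+ n * c = q ^+ n *: (c * d ^+ n).
Proof. exact/qcommX/cdc. Qed.
Lemma cac m n : c ^+ m * a ^+ n = q ^+ (m * n) *: (a ^+ n * c ^+ m).
Proof. exact/qcommXX/cca. Qed.

(** [iter p (La E)] maps the monomial of index (p, i, l) to a nonzero multiple
    of [c ^+ (i + (p - l)) * a ^+ l], and the next power kills it; one of the
    exponents [l - p] and [p - l] vanishes, in accordance with a d being a
    polynomial in b c. *)
Definition mono (t : nat * nat * nat) : C :=
  let: (p, i, l) := t in c ^+ i * a ^+ (l - p) * d ^+ (p - l) * b ^+ minn p l.

Lemma mono_a i n j : mono (j, i, (n + j)%N) = c ^+ i * a ^+ n * b ^+ j.
Proof.
rewrite /mono addnK (minn_idPl (leq_addl _ _)).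
have /eqP -> : (j - (n + j) == 0)%N by rewrite subn_eq0 leq_addl.
by rewrite expr0 mulr1.
Qed.
Lemma mono_d i n j : mono ((n + j)%N, i, j) = c ^+ i * d ^+ n * b ^+ j.
Proof.
rewrite /mono addnK (minn_idPr (leq_addl _ _)).
have /eqP -> : (j - (n + j) == 0)%N by rewrite subn_eq0 leq_addl.
by rewrite expr0 mulr1.
Qed.

Lemma mono_span g : lspan mono g.
Proof.
have Sa i n j : lspan mono (c ^+ i * a ^+ n * b ^+ j) by rewrite -mono_a; exact: lspan_gen.
have Sd i n j : lspan mono (c ^+ i * d ^+ n * b ^+ j) by rewrite -mono_d; exact: lspan_gen.
elim/palg_rmul_ind: g => [|k x y Hx Hy|x g Hx].
- by have := Sa 0 0 0; rewrite !expr0 !mulr1.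
- exact: lspanP.
apply: (@lspan_sub _ _ _ _ _ mono mono (fun x => x * pgenr (Cpres q) g)) Hx.
  by move=> k u v; rewrite mulrDl scalerAl.
move=> [[p i] l].
have [n [j [->|->]]] : exists n j, mono (p, i, l) = c ^+ i * a ^+ n * b ^+ j \/
    mono (p, i, l) = c ^+ i * d ^+ n * b ^+ j.
  case: (leqP p l) => [pl|/ltnW lp].
    by exists (l - p)%N, p; left; rewrite -{1}(subnK pl) mono_a.
  by exists (p - l)%N, l; right; rewrite -{1}(subnK lp) mono_d.
- case: g; rewrite -?/(ca q) -?/(cb q) -?/(cc q) -?/(cd q) -!mulrA.
  + by rewrite ba -!scalerAr [a ^+ n * _]mulrA -exprSr mulrA; exact/lspanZ/Sa.
  + by rewrite -exprSr mulrA; exact: Sa.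
  + by rewrite bc [a ^+ n * _]mulrA ac -!scalerAl -scalerAr mulrA mulrA -exprSr; exact/lspanZ/Sa.
  + rewrite bd -!scalerAr; apply: lspanZ; case: n => [|n].
      by rewrite expr0 mul1r mulrA -[d]expr1; exact: Sd.
    rewrite [a ^+ _ * _]mulrA exprSr -[a ^+ n * a * d]mulrA cad mulrDr mulr1 mulrDl mulrDr mulrA.
    apply: lspanD; first exact: Sa.
    rewrite -scalerAr -ccb [a ^+ n * (c * b)]mulrA ac -!scalerAl -!scalerAr -?scalerAl; apply/lspanZ/lspanZ.
    by rewrite !mulrA -exprSr -mulrA -exprS; exact: Sa.
- case: g; rewrite -?/(ca q) -?/(cb q) -?/(cc q) -?/(cd q) -!mulrA.
  + rewrite ba -!scalerAr; apply: lspanZ; case: n => [|n].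
      by rewrite expr0 mul1r mulrA -[a]expr1; exact: Sa.
    rewrite [d ^+ _ * _]mulrA exprSr -[d ^+ n * d * a]mulrA cda mulrDr mulr1 mulrDl mulrDr mulrA.
    apply: lspanD; first exact: Sd.
    rewrite -scalerAr -ccb [d ^+ n * (c * b)]mulrA dc -!scalerAl -!scalerAr -?scalerAl; apply/lspanZ/lspanZ.
    by rewrite !mulrA -exprSr -mulrA -exprS; exact: Sd.
  + by rewrite -exprSr mulrA; exact: Sd.
  + by rewrite bc [d ^+ n * _]mulrA dc -!scalerAl -scalerAr mulrA mulrA -exprSr; exact/lspanZ/Sd.
  + by rewrite bd -!scalerAr [d ^+ n * _]mulrA -exprSr mulrA; exact/lspanZ/Sd.
Qed.

Definition Etop p y z := iter p (La E) y = z /\ La E z = 0.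

(** If x is sent by E to z and z to 0, with weights q^-1 and q, then right
    multiplication by x raises the order of nilpotency of E by one. *)
Lemma Etop_mul x z p y w : La E x = z -> La E z = 0 -> La K x = q^-1 *: x ->
  La K z = q *: z -> Etop p y w -> Etop p.+1 (y * x) (qint p.+1 *: (w * z)).
Proof.
move=> Ex Ez Kx Kz [yw w0].
have LL := La_lin E.
have iterE k : iter k.+1 (La E) (y * x) =
    q ^- k.+1 *: (iter k.+1 (La E) y * x) + qint k.+1 *: (iter k (La E) y * z).
  elim: k => [|k IHk].
    by rewrite /= La_mulE // Ex Kx qint1 // scale1r expr1 -scalerAr.
  rewrite iterS IHk (linD LL) !(linZ LL) !La_mulE // Ex Ez Kx Kz mulr0 addr0.
  rewrite -!scalerAr scalerDr !scalerA -addrA -scalerDl [qint k.+2](qintS q0 qX) mulrC.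
  by rewrite [qint k.+1 * q]mulrC -!exprVn -exprS !exprVn.
split; last by rewrite (linZ LL) La_mulE // w0 Ez mul0r mulr0 addr0 scaler0.
by rewrite iterE iterS yw w0 mul0r scaler0 add0r.
Qed.

Definition top_exp (t : nat * nat * nat) : nat * nat :=
  let: (p, i, l) := t in ((i + (p - l))%N, l).

Definition mca (k : nat * nat) : C := c ^+ k.1 * a ^+ k.2.

Lemma La_E_mca k : La E (mca k) = 0.
Proof. by rewrite La_mulE // !La_EX0 ?La_E // mul0r mulr0 addr0. Qed.

Lemma mono_top t : Etop t.1.1 (mono t) (qfact t.1.1 *: mca (top_exp t)).
Proof.
have LE := La_E; have LK := La_K.
have Ed y w n : Etop 0 y w -> Etop n (y * d ^+ n) (qfact n *: (w * c ^+ n)).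
  move=> yw; elim: n => [|n IHn].
    by rewrite /quantum_fact big_ord0 scale1r !expr0 !mulr1.
  have := Etop_mul (x := d) (z := c) _ _ _ _ IHn; rewrite !LE !LK => /(_ erefl erefl erefl erefl).
  by rewrite -mulrA -exprSr -scalerAl scalerA mulrC -qfactS -mulrA -exprSr.
have Eb y w n m : Etop n y (qfact n *: w) ->
    Etop (n + m) (y * b ^+ m) (qfact (n + m) *: (w * a ^+ m)).
  move=> yw; elim: m => [|m IHm]; first by rewrite addn0 !expr0 !mulr1.
  have := Etop_mul (x := b) (z := a) _ _ _ _ IHm; rewrite !LE !LK => /(_ erefl erefl erefl erefl).
  by rewrite -mulrA -exprSr -scalerAl scalerA mulrC -qfactS -mulrA -exprSr addnS.
have E0 i n : Etop 0 (mca (i, n)) (mca (i, n)) by split=> //; exact: La_E_mca.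
case: t => [[p i] l]; case: (leqP p l) => [pl|/ltnW lp].
  rewrite -(subnK pl); move: (l - p)%N => n; rewrite mono_a /top_exp /mca /=.
  have /eqP -> : (p - (n + p) == 0)%N by rewrite subn_eq0 leq_addl.
  rewrite addn0 exprD mulrA -[p in Etop p]add0n -[p in qfact p]add0n; apply: Eb.
  by rewrite /quantum_fact big_ord0 scale1r; exact: E0.
rewrite -(subnK lp); move: (p - l)%N => n; rewrite mono_d /top_exp /mca /= addnK exprD.
by apply/Eb/Ed; have := E0 i 0; rewrite /mca expr0 mulr1.
Qed.

Lemma phi_E_iter g h p : phi g (h * E ^+ p) = phi (iter p (La E) g) h.
Proof.
elim: p => [|p IHp] in g *; first by rewrite mulr1.
by rewrite exprSr mulrA phi_La // IHp -iterSr.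
Qed.

Lemma Ra_F_mca i l : Ra F (mca (i, l)) = qint i *: mca (i.-1, l.+1).
Proof.
have RL := Ra_lin F.
rewrite /mca /=; elim: i => [|i IHi].
  rewrite !expr0 !mul1r qint0 scale0r; elim: l => [|l IHl].
    by rewrite regular_1.
  by rewrite exprS Ra_mulF // Ra_F // IHl mul0r mulr0 addr0.
rewrite exprS -mulrA Ra_mulF // IHi Ra_F // Ra_Ki //.
have -> : a * (c ^+ i * a ^+ l) = q ^- i *: (c ^+ i * a ^+ l.+1).
  rewrite mulrA; have := cac i 1; rewrite muln1 expr1 => /(congr1 ( *:%R (q ^- i))).
  rewrite scalerA mulVf ?expf_neq0 // scale1r => <-.
  by rewrite -scalerAl -mulrA -exprS.
case: i IHi => [|i] _.
  by rewrite qint0 !scale0r mulr0 addr0 expr0 invr1 !mul1r qint1.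
by rewrite /= -scalerAl -scalerAr scalerA [c * _]mulrA -[c * _]exprS -scalerDl (qintS q0 qX i.+1).
Qed.

Lemma phi_X1 g n : phi (g ^+ n) 1 = (phi g 1 : K0) ^+ n.
Proof.
elim: n => [|n IHn]; first by rewrite !expr0 phi1 // rmorph1.
by rewrite !exprS phi_mul_1 // IHn.
Qed.

Lemma phi_mca_F i l n : phi (mca (i, l)) (F ^+ n) = if i == n then qfact n else 0.
Proof.
elim: n => [|n IHn] in i l *.
  rewrite expr0 phi_mul_1 // !phi_X1 !phi_gens // expr1n mulr1.
  by case: i => [|i]; rewrite ?expr0 ?expr0n //= /quantum_fact big_ord0.
rewrite exprS phi_Ra // Ra_F_mca (linZ (phi_linl _)) IHn.
case: i => [|i] /=; first by rewrite qint0 scale0r.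
by rewrite eqSS; case: ifP => [/eqP ->|_]; rewrite ?scaler0 // qfactS mulrC.
Qed.

Lemma phi_mca_FK i l n t :
  phi (mca (i, l)) (F ^+ n * K ^+ t) = (q ^+ t) ^+ (i + l) * phi (mca (i, l)) (F ^+ n).
Proof.
elim: t => [|t IHt]; first by rewrite !expr0 expr1n mulr1 mul1r.
rewrite exprSr mulrA phi_La // La_mulK // !(La_KX _ (k := q)) ?La_K //.
rewrite -scalerAl -scalerAr scalerA -exprD (linZ (phi_linl _)) -/(mca (i, l)) IHt.
by rewrite exprSr exprMn -[_ *: _]/(_ * _) mulrCA mulrA.
Qed.

(** The values at F^n K^t select the monomials with c^n, and on these they are
    the values at q^t of a polynomial with the exponents n + l. *)
Lemma mca_free : lfree (fun k => phi (mca k) : H -> K0^o).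
Proof.
move=> s al us s0 k0 k0s.
have e0 h : \sum_(k <- s) al k * phi (mca k) h = 0.
  have := congr1 (fun f : H -> K0^o => f h) s0.
  by rewrite fct_sumE.
pose P : {poly K0} := \sum_(k <- s) (al k * phi (mca k) (F ^+ k0.1)) *: 'X^(k.1 + k.2).
have P0 : P = 0.
  apply: (poly_vanish (qpow_inj q0 qX)) => t.
  rewrite -(e0 (F ^+ k0.1 * K ^+ t)) horner_sum; apply: eq_bigr => -[i l] _.
  by rewrite hornerZ hornerXn phi_mca_FK mulrAC mulrA.
have := congr1 (fun P : {poly K0} => P`_(k0.1 + k0.2)) P0.
rewrite coef0 coef_sum (bigD1_seq k0) //= big1 => [|[i l] /=].
  rewrite addr0 coefZ coefXn eqxx mulr1 (surjective_pairing k0) phi_mca_F eqxx => /eqP.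
  by rewrite mulf_eq0 (negPf (qfact_neq0 _ _ _)) // orbF => /eqP.
rewrite coefZ coefXn phi_mca_F; case: (eqVneq i k0.1) => [->|_]; last by rewrite mulr0 mul0r.
rewrite eqn_add2l eq_sym; case: (eqVneq l k0.2) => [->|_ _]; last by rewrite mulr0.
by rewrite -surjective_pairing eqxx.
Qed.

(** The component of g of highest nilpotency order for E is detected by the
    corresponding power of E, which sends its monomials to distinct
    [mca k]; since these are independent as functionals on H, that component
    vanishes as soon as some lower power of E kills g. *)
Lemma ker_E_span g : (forall h, phi g (h * E) = 0) -> lspan mca g.
Proof.
have [s [al [us gE]]] := lspan_uniq (mono_span g).
have [P sP] : exists P, forall t, t \in s -> (t.1.1 <= P)%N.
  by exists (\max_(t <- s) t.1.1)%N => t ts; exact: (@leq_bigmax_seq _ s xpredT (fun t => t.1.1) t ts isT).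
elim: P => [|P IHP] in s us g gE sP *.
  move=> _; rewrite gE big_seq; apply: lspan_sum => -[[p i] l] /sP /=; rewrite leqn0 => /eqP ->.
  by have [/= -> _] := mono_top (0%N, i, l); apply/lspanZ/lspanZ/lspan_gen.
move=> g0.
have gtop h : \sum_(t <- s | t.1.1 == P.+1) al t *: phi (iter P.+1 (La E) (mono t)) h = 0.
  have : phi g (h * E ^+ P.+1) = 0 by rewrite exprSr mulrA g0.
  rewrite gE (lin_sum (phi_linl _)) big_seq (bigID (fun t => t.1.1 == P.+1)) /=.
  rewrite [X in _ + X]big1 ?addr0 => [|t /andP [ts tP]].
    rewrite -big_seq_cond => e; rewrite -[RHS]e; apply: eq_bigr => t _.
    by rewrite (linZ (phi_linl _)) phi_E_iter.
  have [Et0 Et1] := mono_top t; rewrite (linZ (phi_linl _)) phi_E_iter.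
  have tP' : (t.1.1 <= P)%N by rewrite -ltnS ltn_neqAle tP sP.
  rewrite -(subnK tP') -addnS iterD iterS Et0 Et1.
  suff -> : iter (P - t.1.1) (La E) 0 = 0 by rewrite (lin0 (phi_linl _)) scaler0.
  by elim: (P - _)%N => //= n ->; rewrite (lin0 (La_lin E)).
pose ind (k : nat * nat) := (P.+1, k.1, k.2).
pose sub (k : nat * nat) := ((k.1 - (P.+1 - k.2))%N, k.2).
have al0 t : t \in s -> t.1.1 == P.+1 -> al t = 0.
  move=> ts tP.
  pose s' := [seq (t.1.2, t.2) | t <- s & t.1.1 == P.+1].
  have indK u : u.1.1 == P.+1 -> ind (u.1.2, u.2) = u.
    by move: u => [[p i] l] /= /eqP ->.
  have us' : uniq s'.
    rewrite map_inj_in_uniq ?filter_uniq // => u v; rewrite !mem_filter => /andP [uP _] /andP [vP _].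
    by move=> /(congr1 ind); rewrite !indK.
  have subK : cancel (fun k => top_exp (ind k)) sub.
    by move=> [i l]; rewrite /sub /= addnK.
  have := lfree_comp mca_free subK (c := fun k => al (ind k) * qfact P.+1) us' _ (j := (t.1.2, t.2)).
  rewrite indK // => /(_ _ _)/eqP; rewrite mulf_eq0 (negPf (qfact_neq0 q0 qX _)) orbF => H0.
  apply/eqP/H0; last by apply: map_f; rewrite mem_filter tP.
  apply/funext => h; rewrite fct_sumE -[RHS](gtop h) big_map big_filter.
  apply: eq_bigr => u uP; have [e _] := mono_top u; rewrite (eqP uP) in e; rewrite e indK //.
  by rewrite (linZ (phi_linl _)) scalerA.
apply: (IHP [seq t <- s | t.1.1 != P.+1]) => //; first exact: filter_uniq.
  rewrite gE big_filter [RHS]big_mkcond [LHS]big_seq [RHS]big_seq; apply: eq_bigr => t ts.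
  by case: ifPn => // /negPn tP; rewrite al0 // scale0r.
by move=> t; rewrite mem_filter => /andP [tP ts]; rewrite -ltnS ltn_neqAle tP sP.
Qed.

(** An element orthogonal to H satisfies the hypothesis of [ker_E_span], so it
    is a combination of the [mca k], independent as functionals. *)
Lemma C_nondegenerate g : (forall h, phi g h = 0) -> g = 0.
Proof.
move=> g0; have [s [al [us gE]]] := lspan_uniq (ker_E_span (fun h => g0 (h * E))).
rewrite gE big_seq big1 // => k ks; rewrite (mca_free us (c := al)) ?scale0r //.
apply/funext => h; rewrite fct_sumE -[RHS](g0 h) gE (lin_sum (phi_linl _)).
by apply: eq_bigr => j _; rewrite (linZ (phi_linl _)).
Qed.

(** * The casimir and the polynomials in K *)

(** The casimir is a sum; sealing it keeps distributivity from opening it. *)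
Definition Om : H := locked (casimir q).

Lemma uKiF : Ki * F = q ^+ 2 *: (F * Ki).
Proof.
have := congr1 (fun x => Ki * x * Ki) (uKF q).
rewrite !mulrA uKiK mul1r -scalerAr -!scalerAl => ->.
by rewrite -!mulrA uKKi mulr1 scalerA divff ?scale1r ?expf_neq0.
Qed.

Lemma Om_EF : Om = E * F + r *: (q^-1 *: K + q *: Ki).
Proof. by rewrite /Om -lock. Qed.

Lemma Om_FE : Om = F * E + r *: (q *: K + q^-1 *: Ki).
Proof.
rewrite Om_EF uEF -addrA; congr (_ + _).
rewrite !scalerDr !scalerA addrACA -!scaleNr -!scalerDl.
have d0 := delta_neq0 q0 qX.
have q2 : q ^+ 2 - 1 != 0 by rewrite subr_eq0 qX.
by congr (_ *: _ + _ *: _); field; rewrite q0 -expr2 q2.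
Qed.

Lemma Om_central x : Om * x = x * Om.
Proof.
have q20 := expf_neq0 2 q0.
have KiK := uKiK q; have KKi := uKKi q.
have cE : Om * E = E * Om.
  rewrite {2}Om_FE Om_EF mulrDl mulrDr -mulrA; congr (_ + _).
  rewrite -scalerAl -scalerAr mulrDl mulrDr -!scalerAl -!scalerAr uKE uKiE // !scalerA.
  by congr (_ *: (_ *: _ + _ *: _)); field.
have cF : Om * F = F * Om.
  rewrite {1}Om_FE Om_EF mulrDl mulrDr -mulrA; congr (_ + _).
  rewrite -scalerAl -scalerAr mulrDl mulrDr -!scalerAl -!scalerAr uKF uKiF // !scalerA.
  by congr (_ *: (_ *: _ + _ *: _)); field.
have cK : Om * K = K * Om.
  rewrite Om_EF mulrDl mulrDr; congr (_ + _).
    rewrite mulrA uKE -mulrA -scalerAl -mulrA uKF -!scalerAr scalerA.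
    by rewrite divff // scale1r.
  by rewrite -scalerAl -scalerAr mulrDl mulrDr -!scalerAl -!scalerAr KiK KKi.
elim/palg_ind: x => [[]||k x y Hx Hy|x y Hx Hy] //.
- have := congr1 (fun x => Ki * x * Ki) cK.
  by rewrite !mulrA KiK mul1r -mulrA KKi mulr1 => ->.
- by rewrite mul1r mulr1.
- by rewrite mulrDr mulrDl -scalerAr -scalerAl Hx Hy.
- by rewrite mulrA Hx -mulrA Hy mulrA.
Qed.

Lemma alg_Om_central (p : {poly K0}) x : horner_alg Om p * x = x * horner_alg Om p.
Proof.
elim/poly_ind: p => [|p k IH]; first by rewrite rmorph0 mul0r mulr0.
rewrite rmorphD rmorphM /= horner_algX horner_algC mulrDl mulrDr.
by rewrite -mulrA Om_central [horner_alg Om p * _]mulrA IH -mulrA mulr_algl mulr_algr.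
Qed.

Lemma ev_comm : commr_rmorph (horner_alg Om) K.
Proof. by move=> p; rewrite /GRing.comm alg_Om_central. Qed.

(** The polynomial subalgebra generated by K and the casimir: the outer
    variable goes to K, the inner one to the casimir. *)
Definition ev : {rmorphism PP -> H} := horner_morph ev_comm.

Arguments ev : simpl never.

Lemma evX : ev 'X = K. Proof. exact: horner_morphX. Qed.
Lemma evXn n : ev 'X^n = K ^+ n. Proof. by rewrite rmorphXn evX. Qed.
Lemma evC p : ev p%:P = horner_alg Om p. Proof. exact: horner_morphC. Qed.
Lemma evCC k : ev k%:P%:P = k%:A. Proof. by rewrite evC horner_algC. Qed.
Lemma evCX : ev 'X%:P = Om. Proof. by rewrite evC horner_algX. Qed.
Lemma ev_wide n (P : PP) : (size P <= n)%N ->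
  ev P = \sum_(i < n) horner_alg Om P`_i * K ^+ i.
Proof.
move=> sP; rewrite /ev /= /horner_morph (@horner_coef_wide _ n).
  by apply: eq_bigr => i _; rewrite coef_map.
exact: leq_trans (size_poly _ _) sP.
Qed.

(** The substitution K -> k K. *)
Definition tw (k : K0) (P : PP) : PP := \poly_(i < size P) ((k ^+ i)%:P * P`_i).

Lemma coef_tw k P i : (tw k P)`_i = (k ^+ i)%:P * P`_i.
Proof.
rewrite coef_poly; case: ltnP => // sP.
by rewrite (nth_default _ sP) mulr0.
Qed.

Lemma ev_tw k x P : K * x = k *: (x * K) -> ev P * x = x * ev (tw k P).
Proof.
move=> Kx; rewrite (ev_wide (leqnn _)) (ev_wide (size_poly _ _ : size (tw k P) <= size P)%N).
rewrite mulr_suml mulr_sumr; apply: eq_bigr => i _.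
rewrite coef_tw rmorphM /= horner_algC mulr_algl -mulrA (qcommX _ Kx).
by rewrite -!scalerAr -scalerAl -scalerAr !mulrA alg_Om_central.
Qed.

Lemma Ke : K * e = q ^+ 2 *: (e * K).
Proof. by rewrite mulrA uKE -scalerAl -!mulrA uKKi uKiK. Qed.
Lemma KeX n : K ^+ n * e = (q ^+ 2) ^+ n *: (e * K ^+ n).
Proof. exact/qcommX/Ke. Qed.
Lemma KFX n : K ^+ n * F = (q ^- 2) ^+ n *: (F * K ^+ n).
Proof. exact/qcommX/uKF. Qed.
Lemma eKX n : e * K ^+ n = (q ^- 2) ^+ n *: (K ^+ n * e).
Proof. by rewrite KeX scalerA -exprMn mulVf ?expf_neq0 // expr1n scale1r. Qed.
Lemma FKX n : F * K ^+ n = (q ^+ 2) ^+ n *: (K ^+ n * F).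
Proof. by rewrite KFX scalerA -exprMn divff ?expf_neq0 // expr1n scale1r. Qed.
Lemma KiKX n : Ki * K ^+ n.+1 = K ^+ n.
Proof. by rewrite exprS mulrA uKiK mul1r. Qed.
Lemma KKiX n : K ^+ n * Ki ^+ n = 1.
Proof.
elim: n => [|n IHn]; first by rewrite !expr0 mulr1.
by rewrite exprSr exprS mulrA -[_ * K * Ki]mulrA uKKi mulr1.
Qed.

Definition polyFe : PP := 'X%:P * 'X - (r * q)%:P%:P * 'X^2 - (r * q^-1)%:P%:P.
Definition polyeF : PP :=
  (q ^+ 2)%:P%:P * ('X%:P * 'X) - (r * q)%:P%:P * 'X^2 - (r * q ^+ 3)%:P%:P.

Lemma ev_polyFe : F * e * K ^+ 2 = ev polyFe.
Proof.
rewrite /polyFe !rmorphB !rmorphM /= evCX !evX !evCC.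
rewrite Om_FE -mulrA -[E * _ * _]mulrA (KiKX 1) expr1 mulrA mulrDl !mulr_algl.
rewrite -scalerAl mulrDl -!scalerAl uKiK -expr2 scalerDr !scalerA -addrA -opprD.
by rewrite mul1r addrK.
Qed.
Lemma ev_polyeF : e * F * K ^+ 2 = ev polyeF.
Proof.
rewrite /polyeF !rmorphB !rmorphM /= evCX !evX !evCC.
rewrite Om_EF -[E * Ki * F]mulrA uKiF -scalerAr -scalerAl -!mulrA (KiKX 1) expr1 [E * (F * K)]mulrA.
rewrite mulrDl !mulr_algl -scalerAl mulrDl -!scalerAl uKiK -expr2 !scalerDr !scalerA -addrA -opprD.
move: r => z; have -> : q * q * (z / q) = z * q by field.
have -> : q * q * (z * q) = z * q * q * q by ring.
by rewrite addrK expr2.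
Qed.

(** The Laurent polynomial e^k F^k, made polynomial by K^(2k). *)
Fixpoint polyeFX (k : nat) : PP :=
  if k is k'.+1 then
    ((q ^+ 2) ^+ k' * (q ^+ 2) ^+ k')%:P%:P * (polyeFX k' * tw ((q ^- 2) ^+ k') polyeF)
  else 1.

Lemma ev_KX P n : ev P * K ^+ n = K ^+ n * ev P.
Proof. by rewrite -evX -rmorphXn -!rmorphM mulrC. Qed.

Lemma ev_polyeFX k : e ^+ k * F ^+ k * K ^+ (2 * k) = ev (polyeFX k).
Proof.
elim: k => [|k IHk]; first by rewrite !expr0 !mul1r rmorph1.
rewrite [RHS]rmorphM /= evCC mulr_algl rmorphM /= -IHk.
have KF : K * F ^+ k = (q ^- 2) ^+ k *: (F ^+ k * K).
  by have := qcommXX 1 k (uKF q); rewrite mul1n !expr1.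
have KF' : F ^+ k * K = (q ^+ 2) ^+ k *: (K * F ^+ k).
  by rewrite KF scalerA -exprMn divff ?expf_neq0 // expr1n scale1r.
rewrite -[_ * ev _]mulrA -ev_KX mulrA -[e ^+ k * _ * ev _]mulrA -(ev_tw _ KF) mulrA.
rewrite -ev_polyeF mulnS exprD exprSr [F ^+ k.+1]exprS.
have FK2 : F ^+ k * K ^+ 2 = ((q ^+ 2) ^+ k * (q ^+ 2) ^+ k) *: (K ^+ 2 * F ^+ k).
  by rewrite !expr2 [LHS]mulrA KF' -scalerAl -[K * _ * K]mulrA KF' -scalerAr scalerA mulrA.
have -> : e ^+ k * e * (F * F ^+ k) * (K ^+ 2 * K ^+ (2 * k)) =
  e ^+ k * e * F * (F ^+ k * K ^+ 2) * K ^+ (2 * k) by rewrite !mulrA.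
by rewrite FK2 -scalerAr -scalerAl !mulrA.
Qed.

Lemma polyeF_coef : polyeF`_0 = (- (r * q ^+ 3))%:P /\ polyeF`_2 = (- (r * q))%:P.
Proof.
rewrite /polyeF !(coefD, coefN, coefCM, coefXn, coefX, coefC) /=.
by rewrite !mulr0 ?mulr1 !sub0r !subr0 oppr0 add0r !polyCN.
Qed.

Lemma size_polyeF : (size polyeF <= 3)%N.
Proof.
apply/leq_sizeP => -[|[|[|j]]] // _.
by rewrite /polyeF !(coefD, coefN, coefCM, coefXn, coefX, coefC) /= !mulr0 !subr0.
Qed.

(** When a product with [polyeFX k] has known lowest and highest exponents of
    K, these facts give those of the other factor. *)
Lemma polyeFX_ends k : size (polyeFX k) = (2 * k).+1 /\ (polyeFX k)`_0 != 0.
Proof.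
elim: k => [|k [sk k0]]; first by rewrite size_poly1 coef1 oner_neq0.
have q2 : q ^+ 2 != 0 by rewrite expf_neq0.
have qk : (q ^+ 2) ^+ k * (q ^+ 2) ^+ k != 0 by rewrite mulf_neq0 ?expf_neq0.
have r0 : r != 0 by rewrite invr_eq0 expf_neq0 // delta_neq0.
have [p0 p2] := polyeF_coef.
pose T := tw ((q ^- 2) ^+ k) polyeF.
have T2 : T`_2 != 0.
  by rewrite coef_tw p2 -polyCM polyC_eq0 mulf_neq0 ?oppr_eq0 ?mulf_neq0 // !expf_neq0 ?invr_eq0.
have T0 : T`_0 != 0.
  by rewrite coef_tw p0 -polyCM polyC_eq0 mulf_neq0 ?oppr_eq0 ?mulf_neq0 // !expf_neq0 ?invr_eq0.
have sT : size T = 3%N.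
  apply/eqP; rewrite eqn_leq (leq_trans (size_poly _ _) size_polyeF) /=.
  by rewrite ltnNge; apply: contra T2 => /leq_sizeP ->.
split.
  rewrite /= mul_polyC size_scale ?polyC_eq0 // size_mul ?sk ?sT ?mulnS ?addnS ?addn0 //=.
    by rewrite -size_poly_eq0 sk.
  by rewrite -size_poly_eq0 -/T sT.
by rewrite /= coefCM coef0M !mulf_neq0 // ?polyC_eq0.
Qed.

(** * Nondegeneracy in H *)

Definition mab (l j : nat) : C := a ^+ l * b ^+ j.

Lemma La_K_mab l j : La K (mab l j) = (q ^+ l / q ^+ j) *: mab l j.
Proof.
rewrite La_mulK // (La_KX _ (k := q)) ?La_K // (La_KX _ (k := q^-1)) ?La_K //.
by rewrite -scalerAl -scalerAr scalerA exprVn.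
Qed.
Lemma La_Ki_mab l j : La Ki (mab l j) = (q ^+ j / q ^+ l) *: mab l j.
Proof.
rewrite La_mulKi // (La_KiX _ (k := q^-1)) ?La_Ki // (La_KiX _ (k := q)) ?La_Ki //.
by rewrite -scalerAl -scalerAr scalerA exprVn mulrC.
Qed.

Lemma La_E_mab l j : La E (mab l j) = qint j *: mab l.+1 j.-1.
Proof.
rewrite La_mulE // La_EX0 ?La_E // mul0r add0r.
suff -> : La E (b ^+ j) = qint j *: (a * b ^+ j.-1) by rewrite -scalerAr mulrA -exprSr.
elim: j => [|j IHj]; first by rewrite regular_1 // qint0 scale0r.
rewrite exprS La_mulE // La_E // (La_KX _ (k := q^-1)) ?La_K // IHj.
rewrite -!scalerAr exprVn; case: j {IHj} => [|j].
  by rewrite qint0 scale0r addr0 invr1 scale1r qint1 // scale1r.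
rewrite /= [b * _]mulrA cba -!scalerAl scalerA -[a * b * _]mulrA -[b * _]exprS -scalerDl.
by rewrite [qint _ * q]mulrC -(qintS q0 qX).
Qed.

Lemma La_F_mab l j : La F (mab l j) = qint l *: mab l.-1 j.+1.
Proof.
have bX0 : La F (b ^+ j) = 0.
  elim: j => [|j IHj]; first by rewrite regular_1.
  by rewrite exprS La_mulF // IHj La_F // mul0r mulr0 addr0.
rewrite La_mulF // bX0 mulr0 addr0.
suff -> : La F (a ^+ l) = qint l *: (a ^+ l.-1 * b) by rewrite -scalerAl -mulrA -exprS.
elim: l => [|l IHl]; first by rewrite regular_1 // qint0 scale0r.
rewrite exprS La_mulF // La_F // La_Ki // IHl -scalerAr -scalerAl scalerA.
have -> : b * a ^+ l = q ^+ l *: (a ^+ l * b).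
  by have := qcommXX 1 l (cba q); rewrite mul1n !expr1.
case: l {IHl} => [|l].
  by rewrite qint0 mul0r scale0r addr0 qint1 // !scale1r.
by rewrite /= [a * _]mulrA -exprS -scalerDl [_ * q^-1]mulrC -(qintS' q0 qX).
Qed.

(** The scalar by which the casimir acts on the simple module of highest
    weight q^n. *)
Definition cas_eig n : K0 := r * (q ^+ n.+1 + q ^- n.+1).

Lemma phi_mab_Om x l j : phi (mab l j) (x * Om) = cas_eig (l + j) * phi (mab l j) x.
Proof.
have LR := phi_linr (mab l j).
have -> : x * Om = x * E * F + r *: (q^-1 *: (x * K) + q *: (x * Ki)).
  by rewrite Om_EF mulrDr mulrA -scalerAr mulrDr -!scalerAr.
rewrite (linD LR) (linZ LR) (linD LR) !(linZ LR) !phi_La //.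
rewrite La_F_mab (linZ (La_lin _)) La_E_mab La_K_mab La_Ki_mab.
rewrite !(linZ (phi_linl _)) /=.
have -> : qint l *: (qint j.+1 *: phi (mab l.-1.+1 j) x) =
  qint l * qint j.+1 * phi (mab l j) x.
  by case: l {LR} => [|l]; rewrite ?qint0 ?mul0r ?scale0r //= scalerA.
move: (phi (mab l j) x) => f; rewrite -![_ *: _]/(_ * _) /cas_eig /quantum_int !exprS exprD.
have := expf_neq0 l q0; have := expf_neq0 j q0; move: (q ^+ l) (q ^+ j) => y z z0 y0.
by field; rewrite y0 z0 q0 subr_eq0 -expr2 qX.
Qed.

Lemma phi_mab_K x l j : phi (mab l j) (x * K) = (q ^+ l / q ^+ j) * phi (mab l j) x.
Proof. by rewrite phi_La // La_K_mab (linZ (phi_linl _)). Qed.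

Lemma phi_mab_ev x l j P :
  phi (mab l j) (x * ev P) = P.[(q ^+ l / q ^+ j)%:P].[cas_eig (l + j)] * phi (mab l j) x.
Proof.
have LR := phi_linr (mab l j).
have algE p y : phi (mab l j) (y * horner_alg Om p) = p.[cas_eig (l + j)] * phi (mab l j) y.
  elim/poly_ind: p y => [|p k IHp] y; first by rewrite rmorph0 mulr0 horner0 mul0r (lin0 LR).
  rewrite rmorphD rmorphM /= horner_algX horner_algC mulrDr mulr_algr (linD LR) (linZ LR).
  by rewrite mulrA phi_mab_Om IHp hornerMXaddC mulrDl mulrCA mulrA.
elim/poly_ind: P x => [|P p IHP] x; first by rewrite rmorph0 mulr0 !horner0 mul0r (lin0 LR).
rewrite rmorphD rmorphM /= evX evC mulrDr (linD LR) algE mulrA phi_mab_K IHP.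
by rewrite hornerMXaddC hornerD hornerM hornerC mulrDl mulrCA mulrA.
Qed.

Lemma phi_mab_eX l j t : (phi (mab l j) (e ^+ t) != 0) = (t == j).
Proof.
elim: t => [|t IHt] in l j *.
  rewrite expr0 phi_mul_1 // !phi_X1 // !phi_gens // expr1n mul1r.
  by case: j => [|j]; rewrite ?expr0 ?oner_neq0 // expr0n eqxx.
rewrite exprSr mulrA !phi_La // La_Ki_mab (linZ (La_lin _)) La_E_mab scalerA.
rewrite (linZ (phi_linl _)) -[_ *: _]/(_ * _).
case: j => [|j]; first by rewrite qint0 mulr0 mul0r eqxx.
rewrite mulf_eq0 negb_or IHt mulf_neq0 ?(qint_neq0 q0 qX) //.
by rewrite mulf_neq0 ?invr_eq0 ?expf_neq0.
Qed.

Lemma cas_eig_inj : injective cas_eig.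
Proof.
move=> n m /(mulfI _); rewrite invr_eq0 expf_neq0 ?delta_neq0 // => /(_ isT) e1.
have qn := expf_neq0 n.+1 q0; have qm := expf_neq0 m.+1 q0.
have : (q ^+ n.+1 - q ^+ m.+1) * (q ^+ (n.+1 + m.+1) - 1) = 0.
  rewrite exprD; move: e1 qn qm; move: (q ^+ n.+1) (q ^+ m.+1) => x y e1 x0 y0.
  have -> : (x - y) * (x * y - 1) = x * y * ((x + x^-1) - (y + y^-1)) by field; rewrite y0.
  by rewrite e1 subrr mulr0.
move=> /eqP; rewrite mulf_eq0 addSn [_ - 1 == 0]subr_eq0 (negPf (qX _)) orbF subr_eq0.
by move=> /eqP /(qpow_inj q0 qX) [].
Qed.

Lemma phi_null_ideal h x y : (forall g, phi g h = 0) -> forall g, phi g (x * h * y) = 0.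
Proof. by move=> h0 g; rewrite -mulrA phi_Ra // phi_La // h0. Qed.

(** The simple modules of large highest weight n contain many K-weights, and
    infinitely many casimir eigenvalues occur, so a polynomial in K and the
    casimir acting by zero on all of them vanishes. *)
Lemma ev_separated j0 (P : PP) :
  (forall l m, (j0 <= m)%N -> P.[(q ^+ l / q ^+ m)%:P].[cas_eig (l + m)] = 0) -> P = 0.
Proof.
move=> P0.
pose R n := map_poly (horner_eval (cas_eig n)) P.
have R0 n : (j0 + size P <= n)%N -> R n = 0.
  move=> jn; apply/eqP; apply: contraT => Rn0.
  pose x m := q ^+ (n - (j0 + m)) / q ^+ (j0 + m).
  have := max_poly_roots Rn0 (rs := [seq x m | m <- iota 0 (size P)]).
  have -> : (size [seq x m | m <- iota 0 (size P)] < size (R n))%N = false.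
    rewrite size_map size_iota; apply/negbTE; rewrite -leqNgt; exact: size_poly.
  apply.
    apply/allP => z /mapP [m]; rewrite mem_iota add0n => /= mP ->.
    have jmn : (j0 + m <= n)%N by apply: leq_trans jn; rewrite leq_add2l ltnW.
    apply/rootP; rewrite -[RHS](P0 (n - (j0 + m))%N (j0 + m)%N) ?leq_addr // subnK //.
    by have /= := horner_map (horner_eval (cas_eig n)) P (x m)%:P; rewrite /horner_eval /= hornerC => ->.
  rewrite map_inj_in_uniq ?iota_uniq // => m m'; rewrite !mem_iota !add0n => /= mP mP'.
  have jmn k : (k < size P)%N -> (j0 + k <= n)%N.
    by move=> kP; apply: leq_trans jn; rewrite leq_add2l ltnW.
  move=> /eqP; rewrite /x eqr_div ?expf_neq0 // -!exprD => /eqP /(qpow_inj q0 qX).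
  by have := jmn _ mP; have := jmn _ mP'; lia.
apply/polyP => i; rewrite coef0.
apply: (@poly_vanish _ _ (fun t => cas_eig (j0 + size P + t)%N)).
  by move=> t t' /cas_eig_inj /addnI.
move=> t; have := congr1 (fun p : {poly K0} => p`_i) (R0 _ (leq_addr t _)).
by rewrite coef0 coef_map.
Qed.

(** The functional [mab l m] detects only the m-th power of e; left
    multiplication by a power of e moves any chosen term to that position. *)
Lemma eX_separated N k0 (T : nat -> PP) :
  (forall g, phi g (\sum_(j < N) e ^+ (k0 + j) * ev (T j)) = 0) ->
  forall j, (j < N)%N -> T j = 0.
Proof.
move=> u0 j0 j0N; apply: (@ev_separated (k0 + j0)) => l m jm.
pose t := (m - (k0 + j0))%N.
have := phi_null_ideal (e ^+ t) 1 u0 (mab l m).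
rewrite mulr1 mulr_sumr (lin_sum (phi_linr _)) (bigD1 (Ordinal j0N)) //= big1 => [|j jj0].
  rewrite addr0 mulrA -exprD phi_mab_ev subnK // => /eqP; rewrite mulf_eq0.
  by have := phi_mab_eX l m m; rewrite eqxx => /negPf ->; rewrite orbF => /eqP.
rewrite mulrA -exprD phi_mab_ev; apply/eqP; rewrite mulf_eq0; apply/orP; right.
rewrite -[_ == 0]negbK phi_mab_eX; apply: contra jj0 => /eqP tm; apply/eqP/val_inj => /=.
by move: tm; rewrite /t; lia.
Qed.

(** The flag selects the powers of F, which start at 1 because the power 0 is
    listed among those of e. *)
Definition hterm (t : bool * nat * PP) : H :=
  (if t.1.1 then F ^+ t.1.2.+1 else e ^+ t.1.2) * ev t.2.

Lemma htermT k p : hterm (true, k, p) = F ^+ k.+1 * ev p. Proof. by []. Qed.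
Lemma htermF k p : hterm (false, k, p) = e ^+ k * ev p. Proof. by []. Qed.

Lemma hterm_ev P x : lspan hterm x -> lspan hterm (x * ev P).
Proof.
apply: (lspan_sub (f := fun x => x * ev P)) => [k u v|[[s k] p]].
  by rewrite mulrDl scalerAl.
by rewrite /hterm -mulrA -rmorphM; exact: (lspan_gen hterm (s, k, p * P)).
Qed.

Lemma hterm_e x : lspan hterm x -> lspan hterm (x * K ^+ 2 * e).
Proof.
apply: (lspan_sub (f := fun x => x * K ^+ 2 * e)) => [k u v|[[[] k] p]].
- by rewrite !mulrDl -!scalerAl.
- have -> : hterm (true, k, p) * K ^+ 2 * e =
      (q ^+ 2) ^+ 2 *: (F ^+ k * ev (polyFe * tw (q ^+ 2) p)).
    rewrite ?(htermT, htermF) -[LHS]mulrA KeX // -scalerAr; congr (_ *: _).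
    rewrite rmorphM -ev_polyFe [LHS]mulrA -[_ * ev p * e]mulrA (ev_tw _ Ke) exprSr.
    have := ev_KX (tw (q ^+ 2) p) 2; move: (K ^+ 2) => k2.
    by rewrite -!mulrA => ->.
  apply: lspanZ; case: k => [|k].
    exact: (lspan_gen hterm (false, 0%N, polyFe * tw (q ^+ 2) p)).
  exact: (lspan_gen hterm (true, k, polyFe * tw (q ^+ 2) p)).
- have -> : hterm (false, k, p) * K ^+ 2 * e = hterm (false, k.+1, tw (q ^+ 2) (p * 'X^2)).
    rewrite ?(htermT, htermF) -evXn -[_ * ev p * _]mulrA -rmorphM -mulrA.
    by rewrite (ev_tw _ Ke) mulrA [e ^+ k.+1]exprSr.
  exact: lspan_gen.
Qed.

Lemma hterm_F x : lspan hterm x -> lspan hterm (x * K ^+ 2 * F).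
Proof.
apply: (lspan_sub (f := fun x => x * K ^+ 2 * F)) => [k u v|[[[] k] p]].
- by rewrite !mulrDl -!scalerAl.
- have -> : hterm (true, k, p) * K ^+ 2 * F = hterm (true, k.+1, tw (q ^- 2) (p * 'X^2)).
    rewrite ?(htermT, htermF) -evXn -[_ * ev p * _]mulrA -rmorphM -mulrA.
    by rewrite (ev_tw _ (uKF q)) mulrA [F ^+ k.+2]exprSr.
  exact: lspan_gen.
- case: k => [|k].
    have -> : hterm (false, 0%N, p) * K ^+ 2 * F = hterm (true, 0%N, tw (q ^- 2) (p * 'X^2)).
      rewrite ?(htermT, htermF) expr0 mul1r -evXn -rmorphM.
      by rewrite (ev_tw _ (uKF q)).
    exact: lspan_gen.
  have -> : hterm (false, k.+1, p) * K ^+ 2 * F =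
      (q ^- 2) ^+ 2 *: hterm (false, k, polyeF * tw (q ^- 2) p).
    rewrite ?(htermT, htermF) -[LHS]mulrA KFX // -scalerAr; congr (_ *: _).
    rewrite rmorphM -ev_polyeF [LHS]mulrA -[_ * ev p * F]mulrA (ev_tw _ (uKF q)) exprSr.
    have := ev_KX (tw (q ^- 2) p) 2; move: (K ^+ 2) => k2.
    by rewrite -!mulrA => ->.
  exact/lspanZ/lspan_gen.
Qed.

(** As F e K^2 and e F K^2 are polynomials in K and the casimir, words with
    both generators collapse; inverse powers of K are absorbed by K^s. *)
Lemma hterm_normal h : exists s, lspan hterm (h * K ^+ s).
Proof.
have KX x n : lspan hterm x -> lspan hterm (x * K ^+ n).
  by rewrite -evXn; exact: hterm_ev.
elim/palg_rmul_ind: h => [|k x y [s xs] [t yt]|x g [s xs]].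
- exists 0%N; have -> : 1 * K ^+ 0 = hterm (false, 0%N, 1) :> H.
    by rewrite htermF rmorph1 !expr0 !mulr1.
  exact: lspan_gen.
- exists (s + t)%N; rewrite mulrDl -scalerAl; apply: lspanP.
    by rewrite exprD mulrA; exact: KX.
  by rewrite addnC exprD mulrA; exact: KX.
case: g; rewrite -?/(uE q) -?/(uF q) -?/(uK q) -?/(uKi q).
- exists s.+1; have -> : x * E * K ^+ s.+1 = (q ^- 2) ^+ (s + 2) *: (x * K ^+ s * K ^+ 2 * e).
    have EK : E = e * K by rewrite -mulrA uKiK mulr1.
    rewrite {1}EK -mulrA -[e * K * _]mulrA -exprS -(addn2 s) eKX // -scalerAr; congr (_ *: _).
    by rewrite exprD; move: (K ^+ 2) => k2; rewrite !mulrA.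
  exact/lspanZ/hterm_e.
- exists (s + 2)%N; rewrite -mulrA FKX // -scalerAr [K ^+ (s + 2)]exprD.
  have -> : x * (K ^+ s * K ^+ 2 * F) = x * K ^+ s * K ^+ 2 * F.
    by move: (K ^+ 2) => k2; rewrite !mulrA.
  exact/lspanZ/hterm_F.
- by exists s; rewrite -mulrA -exprS exprSr mulrA -[K in _ * K]expr1; exact: KX.
- by exists s.+1; rewrite -mulrA KiKX.
Qed.

Lemma hterm_sum x : lspan hterm x ->
  exists M0 (P Q : nat -> PP), forall M, (M0 <= M)%N ->
    x = \sum_(k < M) e ^+ k * ev (P k) + \sum_(k < M) F ^+ k.+1 * ev (Q k).
Proof.
have evZ' (k : K0) P : k *: ev P = ev (k%:P%:P * P).
  by rewrite rmorphM evCC mulr_algl.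
move=> [s ->]; elim: s => [|[k [[b n] p]] s [M0 [P [Q xE]]]].
  exists 0%N, (fun=> 0), (fun=> 0) => M _; rewrite big_nil.
  by rewrite !big1 ?addr0 // => i _; rewrite rmorph0 mulr0.
pose at_n := fun j => if j == n then k%:P%:P * p else 0 : PP.
exists (maxn M0 n.+1), (fun j => (if b then 0 else at_n j) + P j),
  (fun j => (if b then at_n j else 0) + Q j) => M.
rewrite geq_max => /andP [M0M nM]; rewrite big_cons (xE M M0M).
under [X in _ = X + _]eq_bigr do rewrite rmorphD mulrDr.
under [X in _ = _ + X]eq_bigr do rewrite rmorphD mulrDr.
rewrite !big_split /= addrACA; congr (_ + _).
have sum_at (y : nat -> H) : \sum_(j < M) y j * ev (at_n j) = k *: (y n * ev p).
  rewrite (bigD1 (Ordinal nM)) //= /at_n eqxx -evZ' -scalerAr big1 ?addr0 // => j jn.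
  by rewrite ifN ?rmorph0 ?mulr0.
case: b; rewrite ?(htermT, htermF).
  rewrite (sum_at (fun j => F ^+ j.+1)) big1 ?add0r // => j _; by rewrite rmorph0 mulr0.
rewrite (sum_at (fun j => e ^+ j)) big1 ?addr0 // => j _; by rewrite rmorph0 mulr0.
Qed.

(** Left multiplication by a high power of e turns all powers of F into
    powers of e, at the cost of the factors [polyeFX]. *)
Definition raised M (P Q : nat -> PP) (j : nat) : PP :=
  if (j < M)%N then polyeFX (M - j) * Q (M - j.+1)%N * 'X^(2 * j)
  else P (j - M)%N * 'X^(2 * M).

Lemma raise_e M (P Q : nat -> PP) :
  e ^+ M * (\sum_(k < M) e ^+ k * ev (P k) + \sum_(k < M) F ^+ k.+1 * ev (Q k)) * K ^+ (2 * M)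
  = \sum_(j < M + M) e ^+ j * ev (raised M P Q j).
Proof.
rewrite big_split_ord addrC mulrDr mulrDl; congr (_ + _).
  rewrite mulr_sumr mulr_suml (reindex_inj rev_ord_inj).
  apply: eq_bigr => j _; have jM := ltn_ord j.
  have -> : lshift M j = j :> nat by [].
  have -> : rev_ord j = (M - j.+1)%N :> nat by [].
  rewrite /raised jM !rmorphM evXn -ev_polyeFX.
  have -> : (M - j.+1).+1 = (M - j)%N by lia.
  have {1}-> : (M = j + (M - j))%N by lia.
  have -> : (2 * M = 2 * (M - j) + 2 * j)%N by lia.
  rewrite exprD [K ^+ (_ + _)]exprD.
  have := ev_KX (Q (M - j.+1)%N) (2 * (M - j)).
  move: (ev (Q _)) (e ^+ j) (e ^+ (M - j)) (F ^+ (M - j)) (K ^+ (2 * (M - j))) (K ^+ (2 * j)).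
  by move=> y e1 e2 F2 K2 K1 yK; rewrite !mulrA -[_ * y * K2]mulrA yK !mulrA.
rewrite mulr_sumr mulr_suml; apply: eq_bigr => j _.
have -> : rshift M j = (M + j)%N :> nat by [].
by rewrite /raised ltnNge leq_addr addKn rmorphM evXn exprD !mulrA.
Qed.

Lemma raised_eq0 M P Q : (forall j, (j < M + M)%N -> raised M P Q j = 0) ->
  forall k, (k < M)%N -> P k = 0 /\ Q k = 0.
Proof.
move=> R0 k kM; split.
  have := R0 (M + k)%N; rewrite ltn_add2l kM => /(_ isT) /eqP.
  by rewrite /raised ltnNge leq_addr addKn mulf_eq0 expf_eq0 polyX_eq0 andbF orbF => /eqP.
have := R0 (M - k.+1)%N; have jM : (M - k.+1 < M)%N by lia.
rewrite (leq_trans jM (leq_addr _ _)) => /(_ isT) /eqP.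
rewrite /raised jM; have -> : (M - (M - k.+1).+1 = k)%N by lia.
rewrite !mulf_eq0 expf_eq0 polyX_eq0 andbF orbF => /orP [|/eqP //].
by rewrite -size_poly_eq0 (polyeFX_ends _).1.
Qed.

(** Multiplied by a high power of e and of K, the normal form of h becomes a
    combination of powers of e over polynomials in K and the casimir, which the
    functionals [mab l m] separate. *)
Lemma H_nondegenerate h : (forall g, phi g h = 0) -> h = 0.
Proof.
move=> h0; have [s /hterm_sum [M [P [Q /(_ M (leqnn M)) hE]]]] := hterm_normal h.
have T0 : forall j, (j < M + M)%N -> raised M P Q j = 0.
  apply: (eX_separated (k0 := 0)) => g.
  under eq_bigr do rewrite add0n.
  by rewrite -raise_e -hE mulrA -mulrA; exact: phi_null_ideal.
have hK : h * K ^+ s = 0.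
  rewrite hE !big1 ?addr0 // => k _; have [Pk Qk] := raised_eq0 T0 (ltn_ord k);
  by rewrite ?Pk ?Qk rmorph0 mulr0.
by rewrite -[h]mulr1 -(KKiX s) mulrA hK mul0r.
Qed.

Lemma eX_free N k0 (T : nat -> PP) : \sum_(j < N) e ^+ (k0 + j) * ev (T j) = 0 ->
  forall j, (j < N)%N -> T j = 0.
Proof.
move=> T0; apply: (eX_separated (k0 := k0)) => g.
by rewrite T0 (lin0 (phi_linr _)).
Qed.

(** * Products of the operators h e - lam e h *)

Fixpoint Dprod (lam : nat -> K0) n (h : H) : H :=
  if n is n'.+1 then Dprod lam n' h * e - lam n' *: (e * Dprod lam n' h) else h.

(** Up to a factor e, the operators h -> h e - lam e h are diagonal on the
    elements e^j K^m with coefficients in the polynomials in the casimir, since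
    K^m e is a multiple of e K^m. *)
Lemma Dprod_eX (lam : nat -> K0) n h M S N (T : nat -> PP) :
  e ^+ M * h * K ^+ S = \sum_(j < N) e ^+ j * ev (T j) ->
  exists T' : nat -> PP,
    (forall j m, (T' j)`_m = (\prod_(i < n) ((q ^+ 2) ^+ m / (q ^+ 2) ^+ S - lam i))%:P * (T j)`_m) /\
    e ^+ M * Dprod lam n h * K ^+ S = \sum_(j < N) e ^+ (n + j) * ev (T' j).
Proof.
move=> hE; elim: n => [|n [T' [T'E DE]]].
  by exists T; split=> // j m; rewrite big_ord0 mul1r.
exists (fun j => ((q ^- 2) ^+ S)%:P%:P * tw (q ^+ 2) (T' j) - (lam n)%:P%:P * T' j); split=> [j m|].
  rewrite coefB !coefCM coef_tw T'E big_ord_recr [(q ^- 2) ^+ S]exprVn /=.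
  set t := (T j)`_m; set x := _ ^+ m; set p := \prod_(i < n) _; set s := _^-1; set l := lam n.
  by rewrite !polyCM polyCB polyCM; ring.
rewrite [Dprod _ _.+1 _]/= mulrBr mulrBl.
have -> : e ^+ M * (Dprod lam n h * e) * K ^+ S =
    (q ^- 2) ^+ S *: (e ^+ M * Dprod lam n h * K ^+ S * e).
  by rewrite -mulrA -[Dprod _ _ _ * e * _]mulrA eKX // -!scalerAr !mulrA.
have -> : e ^+ M * (lam n *: (e * Dprod lam n h)) * K ^+ S =
    lam n *: (e * (e ^+ M * Dprod lam n h * K ^+ S)).
  move: (E * Ki) (Dprod lam n h) => x y; rewrite -scalerAr -scalerAl !mulrA -exprSr -?exprS; congr (_ *: (_ * _ * _)).
rewrite DE mulr_suml mulr_sumr !scaler_sumr -sumrB; apply: eq_bigr => j _.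
rewrite rmorphB !rmorphM !evCC !mulr_algl mulrBr -!scalerAr; congr (_ *: _ - _ *: _).
  by rewrite -mulrA (ev_tw _ Ke) mulrA -exprSr addSn.
by rewrite mulrA -exprS addSn.
Qed.

Section Filtration.
(** A multiplicative filtration, to be specialized to [leading]; its generators
    are the coefficients that can be read off from v1, v2, v3, v4. *)
Variable A : nat -> H -> Prop.
Hypotheses (A0 : forall n, A n 0)
  (AL : forall n k x y, A n x -> A n y -> A n (k *: x + y))
  (AM : forall n m x y, A n x -> A m y -> A (n + m)%N (x * y))
  (A1 : A 0%N 1) (Ae : A 0%N e) (AOm : A 0%N Om)
  (A21 : A 2%N 1) (AK : A 2%N K) (AKi : A 2%N Ki) (AFK : A 2%N (F * K)).

Lemma AD n x y : A n x -> A n y -> A n (x + y).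
Proof. by rewrite -{2}[x]scale1r; exact: AL. Qed.
Lemma AZ n k x : A n x -> A n (k *: x).
Proof. by move=> Ax; rewrite -[_ *: _]addr0; exact: AL. Qed.
Lemma A_sum n (I : Type) (s : seq I) (P : pred I) (G : I -> H) :
  (forall i, P i -> A n (G i)) -> A n (\sum_(i <- s | P i) G i).
Proof. by move=> AG; elim/big_ind: _ => // x y; exact: AD. Qed.
Lemma A0X x n : A 0%N x -> A 0%N (x ^+ n).
Proof. by move=> Ax; elim: n => [|n IHn]; rewrite ?expr0 // exprS; exact: (AM Ax IHn). Qed.
Lemma A2X x n : A 2%N x -> A (2 * n)%N (x ^+ n).
Proof.
move=> Ax; elim: n => [|n IHn]; first by rewrite expr0.
by rewrite exprS mulnS; exact: AM.
Qed.
Lemma A_alg p : A 0%N (horner_alg Om p).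
Proof.
elim/poly_ind: p => [|p k Ap]; first by rewrite rmorph0.
rewrite rmorphD rmorphM /= horner_algX horner_algC; apply: AD; last exact: AZ.
exact: (AM Ap AOm).
Qed.

Lemma KXKiX m n : K ^+ (m + n) * Ki ^+ n = K ^+ m.
Proof. by rewrite exprD -mulrA KKiX mulr1. Qed.
Lemma KXKiX' m n : K ^+ n * Ki ^+ (n + m) = Ki ^+ m.
Proof. by rewrite exprD mulrA KKiX mul1r. Qed.

Lemma A_KXKiX N m s : (s <= m + N)%N -> (m <= s + N)%N -> A (2 * N)%N (K ^+ m * Ki ^+ s).
Proof.
move=> smN msN.
have A1X n x t : A (2 * t)%N x -> (t <= n)%N -> A (2 * n)%N x.
  move=> Ax tn; have := AM Ax (A2X (n - t) A21).
  by rewrite expr1n mulr1 -mulnDr subnKC.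
case: (leqP s m) => [sm|/ltnW ms].
  by rewrite -(subnK sm) KXKiX; apply: A1X (A2X _ AK) _; lia.
by rewrite -(subnKC ms) KXKiX'; apply: A1X (A2X _ AKi) _; lia.
Qed.

Lemma A_FXKX k : A (2 * k)%N (F ^+ k * K ^+ k).
Proof.
elim: k => [|k IHk]; first by rewrite !expr0 mulr1.
have -> : F ^+ k.+1 * K ^+ k.+1 = (q ^+ 2) ^+ k *: (F ^+ k * K ^+ k * (F * K)).
  rewrite exprSr [K ^+ k.+1]exprSr -mulrA [F * _]mulrA FKX // -scalerAl -scalerAr.
  by congr (_ *: _); rewrite !mulrA.
by apply: AZ; rewrite mulnS addnC; exact: AM.
Qed.

Lemma A_e_ev N k s (P : PP) : (forall m, P`_m != 0 -> (s <= m + N)%N /\ (m <= s + N)%N) ->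
  A (2 * N)%N (e ^+ k * ev P * Ki ^+ s).
Proof.
move=> sP; rewrite -mulrA -[(2 * N)%N]add0n; apply: AM; first exact: A0X.
rewrite (ev_wide (leqnn _)) mulr_suml; apply: A_sum => i _.
have [->|/sP [si iN]] := eqVneq P`_i 0; first by rewrite rmorph0 !mul0r.
by rewrite -mulrA -[(2 * N)%N]add0n; apply: AM; [exact: A_alg|exact: A_KXKiX].
Qed.

Lemma A_F_ev N k s (Q : PP) : (forall m, Q`_m != 0 -> (s + 2 * k <= m + N)%N /\ (m <= s + N)%N) ->
  A (2 * N)%N (F ^+ k * ev Q * Ki ^+ s).
Proof.
move=> sQ; rewrite -mulrA (ev_wide (leqnn _)) mulr_suml mulr_sumr; apply: A_sum => i _.
have [->|/sQ [si iN]] := eqVneq Q`_i 0; first by rewrite rmorph0 !mul0r mulr0.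
rewrite -mulrA mulrA -alg_Om_central -mulrA -[(2 * N)%N]add0n; apply: AM; first exact: A_alg.
have -> : F ^+ k * (K ^+ i * Ki ^+ s) = F ^+ k * K ^+ k * (K ^+ i * Ki ^+ (s + k)).
  rewrite -mulrA; congr (_ * _); rewrite mulrA -exprD addnC addnC [in RHS]addnC.
  by rewrite [(s + k)%N]addnC exprD exprD !mulrA -[_ * K ^+ k * _]mulrA KKiX mulr1.
have -> : (2 * N = 2 * k + 2 * (N - k))%N by lia.
by apply: AM; [exact: A_FXKX|apply: A_KXKiX; lia].
Qed.

(** On e^M h the operators of the product act diagonally, so only the powers
    K^m for which one factor vanishes survive; dividing by [polyeFX] turns
    this into the bounds that describe the filtration. *)
Lemma Dprod_ker n h :
  Dprod (fun i => (q ^+ 2) ^+ i / q ^+ n) n.+1 h = 0 -> A n h.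
Proof.
move=> Dh; have [s /hterm_sum [M [P [Q /(_ M (leqnn M)) hE]]]] := hterm_normal h.
pose S := (s + 2 * M)%N.
have hE' : e ^+ M * h * K ^+ S = \sum_(j < M + M) e ^+ j * ev (raised M P Q j).
  by rewrite -raise_e -hE exprD !mulrA.
have [T [TE TD]] := Dprod_eX (fun i => (q ^+ 2) ^+ i / q ^+ n) n.+1 hE'.
rewrite Dh mulr0 mul0r in TD.
have supp j m : (j < M + M)%N -> (raised M P Q j)`_m != 0 ->
    exists2 i, (i <= n)%N & (2 * m + n = 2 * i + 2 * S)%N.
  move=> jM R0; have := TE j m; rewrite (eX_free (esym TD) jM) coef0 => /esym/eqP.
  rewrite mulf_eq0 (negPf R0) orbF polyC_eq0 => /prodf_eq0 [i _].
  rewrite subr_eq0 eqr_div ?expf_neq0 // -!exprM -!exprD => /eqP /(qpow_inj q0 qX) e1.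
  by exists i; rewrite // -ltnS.
have hS : h = h * K ^+ s * Ki ^+ s by rewrite -mulrA KKiX mulr1.
(* For odd n, the parity in [supp] excludes every exponent. *)
have [odd_n|] := boolP (odd n).
  have R0 j : (j < M + M)%N -> raised M P Q j = 0.
    move=> jM; apply/polyP => m; rewrite coef0; apply/eqP; apply: contraT => /(supp _ _ jM).
    by move=> [i _ ni]; lia.
  rewrite hS hE !big1 ?addr0 ?mul0r // => k _; have [Pk Qk] := raised_eq0 R0 (ltn_ord k);
  by rewrite ?Pk ?Qk rmorph0 mulr0.
move=> /even_halfK; rewrite -mul2n => nN.
rewrite -nN; move: (n./2) => N in nN *.
rewrite hS hE mulrDl !mulr_suml; apply: AD; apply: A_sum => k _; have kM := ltn_ord k.
  apply: A_e_ev => m Pm.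
  have := supp (M + k)%N (m + 2 * M)%N; rewrite ltn_add2l kM /raised ltnNge leq_addr addKn.
  rewrite coefMXn ltnNge leq_addl addnK => /(_ isT Pm) [i iN]; rewrite /S; lia.
apply: A_F_ev => m Qm; have [sG G0] := polyeFX_ends k.+1.
have jM : (M - k.+1 < M)%N by lia.
have suppGQ m' : (polyeFX k.+1 * Q k)`_m' != 0 ->
    (s + 2 * k.+1 <= m' + N)%N /\ (m' <= s + 2 * k.+1 + N)%N.
  move=> GQ; have := supp (M - k.+1)%N (m' + 2 * (M - k.+1))%N.
  rewrite /raised jM; have -> : (M - (M - k.+1) = k.+1)%N by lia.
  have -> : (M - (M - k.+1).+1 = k)%N by lia.
  rewrite coefMXn [(m' + _ < _)%N]ltnNge leq_addl addnK => /(_ (leq_trans jM (leq_addr _ _)) GQ) [i iN].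
  rewrite /S; lia.
(* The extreme exponents of Q k are those of the product minus those of
   [polyeFX k.+1]. *)
have Q0 : Q k != 0 by apply: contraNneq Qm => ->; rewrite coef0.
have G0' : polyeFX k.+1 != 0 by rewrite -size_poly_eq0 sG.
split.
  have exm : exists m, (Q k)`_m != 0 by exists m.
  case: (ex_minnP exm) => m0 Qm0 m0min.
  have [] := suppGQ m0; last by have := m0min _ Qm; lia.
  rewrite coefM big_ord_recl /= subn0 big1 ?addr0 ?mulf_neq0 // => i _.
  rewrite [X in _ * X](_ : _ = 0) ?mulr0 //; apply/eqP; apply: contraT => /m0min.
  by rewrite /bump /=; have := ltn_ord i; lia.
have [] := suppGQ (size (polyeFX k.+1 * Q k)).-1.
  by rewrite -[_`__]/(lead_coef _) lead_coef_eq0 mulf_neq0.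
rewrite size_mul // sG; have : (m < size (Q k))%N.
  by rewrite ltnNge; apply: contra Qm => /leq_sizeP ->.
move: (size (Q k)) (2 * k.+1)%N => z w; rewrite addSn -[(w + z).+1.-2]/((w + z).-1); lia.
Qed.
End Filtration.

(** * The highest weight conditions in H \ox C *)

Lemma SH_lin : linear (SH q0).
Proof. exact: (@plift_linear _ (Upres q) _ _ (SHgenP q0)). Qed.
Lemma SH_1 : SH q0 1 = 1.
Proof. exact: (@plift_monoid_morphism _ (Upres q) _ _ (SHgenP q0)).1. Qed.
Lemma SH_mul x y : SH q0 (x * y) = SH q0 y * SH q0 x.
Proof. exact: (@plift_monoid_morphism _ (Upres q) _ _ (SHgenP q0)).2. Qed.
Lemma SH_gen : (SH q0 E = - (E * Ki)) * (SH q0 F = - (K * F)) * (SH q0 K = Ki) * (SH q0 Ki = K).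
Proof. by do !split; exact: (@plift_gen _ (Upres q) _ _ (SHgenP q0)). Qed.
Lemma SC_1 : SC q0 1 = 1.
Proof. exact: (@plift_monoid_morphism _ (Cpres q) _ _ (SCgenP q0)).1. Qed.

Lemma DH_lin : linear DH. Proof. by move=> k x y; rewrite linearP. Qed.
Lemma DC_lin : linear DC. Proof. by move=> k x y; rewrite linearP. Qed.

Lemma La_Ra x y g :
  La y (Ra x g) = sweedler3 DC (fun g1 g2 g3 => (phi g1 x * phi g3 y : K0) *: g2) g.
Proof.
rewrite {1}/Ra /sweedler2 (tlift_comp _ (La_lin y) (Ra_bilin x)).
congr tlift; apply/funext => g1; apply/funext => g2.
rewrite (linZ (La_lin y)) /La /sweedler2.
rewrite (tlift_comp (f := fun u => (phi g1 x : K0) *: u) _ _ (La_bilin y)); last first.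
  by move=> k u v; rewrite scalerDr !scalerA mulrC.
by congr tlift; apply/funext => u; apply/funext => v; rewrite scalerA.
Qed.

Lemma sweedler3_trilin_La (x y : H) (U : lmodType K0) (f : C -> U) : linear f ->
  trilin (fun g1 g2 g3 : C => (phi g1 x * phi g3 y : K0) *: f g2).
Proof.
move=> fL; split=> u v k s t.
- by rewrite phi_linl mulrDl scalerDl -[k *: phi s x]/(k * phi s x) -mulrA scalerA.
- by rewrite fL scalerDr !scalerA mulrC.
- by rewrite phi_linl mulrDr scalerDl -[k *: phi s y]/(k * phi s y) mulrCA scalerA.
Qed.

(** Through the regular actions, the product involves a single Sweedler sum,
    over H, with at most three terms when the element of H is a generator. *)
Lemma dmul_regular g h g' h' : dmul q0 phi (g \ox h) (g' \ox h') =
  sweedler3 DH (fun t1 t2 t3 => (La t3 (Ra (SH q0 t1) g') * g) \ox (t2 * h')) h.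
Proof.
have PL v : linear (fun w : C => w * g \ox v : tensor C H).
  by move=> k x y; rewrite mulrDl -scalerAl pureDl pureZl.
have PR w : linear (fun v : H => w \ox (v * h') : tensor C H).
  by move=> k x y; rewrite mulrDl -scalerAl pureDr pureZr.
have [s sP] := sweedler3_family DC_lin g'; have [t tP] := sweedler3_family DH_lin h.
have T1 (g1 g2 g3 : C) : trilin (fun h1 h2 h3 =>
    (phi g1 (SH q0 h1) * phi g3 h3 : K0) *: ((g2 * g) \ox (h2 * h') : tensor C H)).
  split=> x y k u v.
  - rewrite SH_lin phi_linr mulrDl scalerDl -[k *: phi _ (SH q0 u)]/(k * phi _ (SH q0 u)).
    by rewrite -mulrA scalerA.
  - by rewrite PR scalerDr !scalerA mulrC.
  - by rewrite phi_linr mulrDr scalerDl -[k *: phi _ u]/(k * phi _ u) mulrCA scalerA.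
rewrite (dmul_pure phiP) sP; last first.
  split=> x y; apply: linear_sweedler3 => // h1 h2 h3.
  - exact: trilin1 (sweedler3_trilin_La (SH q0 h1) h3 (PL (h2 * h'))) x y.
  - exact: trilin2 (sweedler3_trilin_La (SH q0 h1) h3 (PL (h2 * h'))) x y.
  - exact: trilin3 (sweedler3_trilin_La (SH q0 h1) h3 (PL (h2 * h'))) x y.
rewrite tP; last first.
  split=> x y.
  - move=> k u v; rewrite SH_lin (Ra_linh g') La_lin PL. by [].
  - exact: PR.
  - by move=> k u v; rewrite (La_linh _) PL.
under eq_bigr do rewrite tP //.
rewrite exchange_big; apply: eq_bigr => u _.
rewrite La_Ra sP; last exact: sweedler3_trilin_La (fun _ _ _ => erefl).
by rewrite (lin_sum (PL _)); apply: eq_bigr => v _; rewrite (linZ (PL _)).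
Qed.

Lemma dual_pure h g g' h' : dual (h \ox g) (g' \ox h') = phi g h' * phi g' h.
Proof. exact: dual_embed_pure. Qed.
Lemma dual_linx u : linear (fun x => dual x u).
Proof. by move=> k x y; rewrite (dual_embed_linear phiP). Qed.
Lemma dual_linu x : linear (dual x).
Proof. by move=> k u v; rewrite (dual_embed_scalar phiP). Qed.

(** Multiplication by h on the right changes only the component in H, so its
    transpose acts on the factor in C alone. *)
Lemma dual_lact_H x h u :
  dual x (dmul q0 phi u (1 \ox h)) = dual (idt (La h) x) u.
Proof.
have LL := La_lin h.
have dB := dmul_bilin phiP.
apply: (linear_tensor_ext (f := fun x => dual x (dmul q0 phi u (1 \ox h)))
  (g := fun x => dual (idt (La h) x) u)) x => [||h0 g0].
- exact: dual_linx.
- by move=> k x y; rewrite (idt_lin LL) dual_linx.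
apply: (linear_tensor_ext (f := fun u => dual (h0 \ox g0) (dmul q0 phi u (1 \ox h)))
  (g := dual (idt (La h) (h0 \ox g0)))) u => [||g' h'].
- by move=> k x y; rewrite (bilinl dB) dual_linu.
- exact: dual_linu.
rewrite idt_pure // dual_pure dmul_regular.
have phi1S t : phi 1 (SH q0 t) = phi 1 t by rewrite -(hp_S phiP) SC_1.
have [s sP] := sweedler3_family DH_lin h'.
have e1 : phi (La h g0) h' = phi (1 * (La h g0 * 1)) h' by rewrite mulr1 mul1r.
rewrite e1 (hp_mull phiP).
have -> : (fun h1 h2 => phi 1 h1 * phi (La h g0 * 1) h2) =
    (fun h1 h2 => sweedler2 DH (fun h2 h3 => phi 1 h1 * (phi (La h g0) h2 * phi 1 h3) : K0^o) h2).
  apply/funext => h1; apply/funext => h2; rewrite (hp_mull phiP) /sweedler2.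
  apply: (tlift_comp (f := fun k : K0^o => (phi 1 h1 * k : K0^o))); last exact: phi_bilin2.
  by move=> k x y; rewrite mulrDr -scalerAr.
rewrite -/(sweedler3 DH (fun h1 h2 h3 => phi 1 h1 * (phi (La h g0) h2 * phi 1 h3) : K0^o) h').
rewrite sP; last first.
  have PL v : linear (fun w : C => w * g' \ox v : tensor C H).
    by move=> k x y; rewrite mulrDl -scalerAl pureDl pureZl.
  split=> x y.
  - by move=> k z w; rewrite SH_lin Ra_linh La_lin PL.
  - by move=> k z w; rewrite mulrDl -scalerAl pureDr pureZr.
  - by move=> k z w; rewrite La_linh PL.
rewrite sP; last first.
  split=> x y k z w /=; rewrite phi_linr.
  - by rewrite mulrDl -scalerAl.
  - by rewrite mulrDl mulrDr -scalerAl -scalerAr.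
  - by rewrite -[k *: phi 1 z]/(k * phi 1 z) -[k *: _]/(k * _); ring.
rewrite (lin_sum (dual_linu (h0 \ox g0))) mulr_suml; apply: eq_bigr => -[[h1 h2] h3] _ /=.
rewrite dual_pure Ra_1r (linZ (La_lin _)) La_1r -!phi1 phi1S.
rewrite phi_La // -!scalerAl mul1r !(linZ (phi_linl _)) -![_ *: _]/(_ * _); ring.
Qed.

Definition e1 : T := e \ox 1.

(** Up to right multiplication by K, the transpose of left multiplication by E
    ([dual_ract_E]); its three terms are those of the iterated coproduct of E. *)
Definition Ddef (x : T) : T := x * e1 - e1 * idt (Ra K) x + idt (Ra E) x.

Lemma Ddef_lin : linear Ddef.
Proof.
have [RK RE] := (idt_lin (A := H) (Ra_lin K), idt_lin (A := H) (Ra_lin E)).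
move=> k x y; rewrite /Ddef RK RE mulrDl mulrDr -scalerAl -scalerAr !scalerDr scalerN opprD.
by rewrite !addrA; congr (_ + _); rewrite [LHS]addrAC; congr (_ + _); rewrite -!addrA; congr (_ + _); rewrite addrCA; congr (_ + _); rewrite addrC.
Qed.

Lemma Ddef_pure h g :
  Ddef (h \ox g) = (h * e) \ox g - (e * h) \ox Ra K g + h \ox Ra E g.
Proof.
rewrite /Ddef (idt_pure (Ra_lin K)) (idt_pure (Ra_lin E)).
by rewrite !pureM mulr1 mul1r.
Qed.

(** In particular the kernel of [Ddef] is a subalgebra. *)
Lemma Ddef_mul x y : Ddef (x * y) = x * Ddef y + Ddef x * idt (Ra K) y.
Proof.
have RK := Ra_lin K; have RE := Ra_lin E.
rewrite /Ddef (idt_mulM RK Ra_mulK) (idt_mul RE RK Ra_mulE).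
move: (idt (Ra K) x) (idt (Ra K) y) (idt (Ra E) x) (idt (Ra E) y) e1 => kx ky dx dy z.
rewrite !(mulrDr, mulrDl, mulrN, mulNr) !mulrA.
rewrite -!addrA; congr (_ + _); rewrite [RHS]addrCA [RHS]addrC -!addrA.
by rewrite addKr addrA.
Qed.

Lemma dual_ract_E x u :
  dual x (dmul q0 phi (1 \ox E) u) = dual (Ddef x * (K \ox 1)) u.
Proof.
have dB := dmul_bilin phiP.
apply: (linear_tensor_ext (f := fun x => dual x (dmul q0 phi (1 \ox E) u))
  (g := fun x => dual (Ddef x * (K \ox 1)) u)) x => [||h0 g0].
- exact: dual_linx.
- by move=> k x y; rewrite Ddef_lin mulrDl -scalerAl dual_linx.
apply: (linear_tensor_ext (f := fun u => dual (h0 \ox g0) (dmul q0 phi (1 \ox E) u))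
  (g := dual (Ddef (h0 \ox g0) * (K \ox 1)))) u => [||g' h'].
- by move=> k x y; rewrite (bilinr dB) dual_linu.
- exact: dual_linu.
rewrite dmul_regular.
have PL v : linear (fun w : C => w * 1 \ox v : tensor C H).
  by move=> k x y; rewrite mulrDl -scalerAl pureDl pureZl.
have FT : trilin (fun t1 t2 t3 : H => (La t3 (Ra (SH q0 t1) g') * 1) \ox (t2 * h') : tensor C H).
  split=> x y.
  - by move=> k z w; rewrite SH_lin Ra_linh La_lin PL.
  - by move=> k z w; rewrite mulrDl -scalerAl pureDr pureZr.
  - by move=> k z w; rewrite La_linh PL.
rewrite /sweedler3 (sweedler2_E (sweedler3_bilin DH FT)).
rewrite (sweedler2_K (bilin_trilin _ FT)) (sweedler2_E (bilin_trilin _ FT)).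
rewrite SH_1 !SH_gen !mulr1 !Ra_1 // mul1r.
rewrite !(linD (dual_linu (h0 \ox g0))) !dual_pure.
rewrite Ddef_pure mulrDl mulrBl !pureM !mulr1 (linD (dual_linx _)) (linB (dual_linx _)) !dual_pure.
rewrite -!phi_Ra -!phi_La -!phi_Ra mulNr (linN (phi_linr g')).
rewrite -[h0 * e * K]mulrA -[E * Ki * K]mulrA uKiK mulr1 !mulrA.
by ring.
Qed.

(** Independence of the left factors reduces injectivity to the nondegeneracy
    of the pairing on either side. *)
Lemma dual_inj x : dual x = 0 -> x = 0.
Proof.
move=> x0; have [n [u [w [uF xE]]]] := tensor_free_expansion x.
have w0 h i : phi (w i) h = 0.
  move: i; apply: (uF (fun i => phi (w i) h)); apply: H_nondegenerate => g.
  have := congr1 (fun f : Defs.double q -> K0^o => f (g \ox h)) x0.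
  rewrite xE (lin_sum (dual_linx _)) => e0; rewrite -[RHS]e0 (lin_sum (phi_linr g)).
  by apply: eq_bigr => i _; rewrite (linZ (phi_linr g)) dual_pure.
rewrite xE big1 // => i _; rewrite (C_nondegenerate (fun h => w0 h i)).
by rewrite (lin0 (pure_linr _)).
Qed.

Lemma highest_weightE x :
  highest_weight q0 phi x <-> idt (La E) x = 0 /\ Ddef x = 0.
Proof.
have eqE y z : (forall u, dual y u = dual z u) -> y = z.
  move=> yz; apply/eqP; rewrite -subr_eq0; apply/eqP/dual_inj/funext => u.
  by rewrite (linB (dual_linx u)) yz subrr.
have d0 u : dual 0 u = 0 by rewrite (lin0 (dual_linx u)).
split=> [[xl xr]|[xl xr]]; split.
- apply: eqE => u; rewrite -dual_lact_H d0.
  by have := congr1 (fun f : Defs.double q -> K0^o => f u) xl.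
- have : Ddef x * (K \ox 1) = 0.
    apply: (eqE (Ddef x * (K \ox 1)) 0) => u; rewrite -dual_ract_E d0.
    by have := congr1 (fun f : Defs.double q -> K0^o => f u) xr.
  move=> /(congr1 (fun y => y * (Ki \ox 1))); rewrite -mulrA pureM uKKi mulr1 mul0r.
  by rewrite -[1 \ox 1]/(1 : T) mulr1.
- by apply/funext => u; rewrite /lact dual_lact_H xl d0.
- by apply/funext => u; rewrite /ract dual_ract_E xr mul0r d0.
Qed.

(** * The subalgebra of highest weight elements *)

Lemma Om_casimir : casimir q = Om.
Proof. by rewrite /Om -lock. Qed.

Definition HW (x : T) := idt (La E) x = 0 /\ Ddef x = 0.

Lemma HW_1 : HW 1.
Proof.
rewrite /HW /= -[1]/(1 \ox 1 : T) (idt_pure (La_lin E)) Ddef_pure // !regular_1 //.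
by rewrite !(lin0 (pure_linr _)) mul1r mulr1 subrr addr0.
Qed.

Lemma HW_lin k x y : HW x -> HW y -> HW (k *: x + y).
Proof.
move=> [xl xr] [yl yr]; split; rewrite ?(idt_lin (La_lin E)) ?Ddef_lin.
  by rewrite xl yl scaler0 addr0.
by rewrite xr yr scaler0 addr0.
Qed.

Lemma HW_mul x y : HW x -> HW y -> HW (x * y).
Proof.
move=> [xl xr] [yl yr]; split.
  rewrite (idt_mul (La_lin E) (La_lin K) La_mulE).
  by rewrite xl yl mul0r mulr0 addr0.
by rewrite Ddef_mul xr yr mul0r mulr0 addr0.
Qed.

Lemma HW_v3 : HW (v3 q).
Proof.
rewrite /HW /v3 (idt_pure (La_lin E)) Ddef_pure // !regular_1 //.
by rewrite !(lin0 (pure_linr _)) subrr addr0.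
Qed.

Lemma HW_v4 : HW (v4 q).
Proof.
rewrite /HW /v4 (idt_pure (La_lin E)) Ddef_pure // !regular_1 // Om_casimir.
by rewrite Om_central // !(lin0 (pure_linr _)) subrr addr0.
Qed.

Lemma regular_quadratic :
  (La E (a * c) = 0) * (La E (c ^+ 2) = 0) * (La E (a ^+ 2) = 0) *
  (Ra K (a * c) = a * c) * (Ra K (c ^+ 2) = q ^- 2 *: c ^+ 2) * (Ra K (a ^+ 2) = q ^+ 2 *: a ^+ 2) *
  (Ra E (a * c) = q^-1 *: c ^+ 2) * (Ra E (c ^+ 2) = 0) * (Ra E (a ^+ 2) = (q ^+ 2 + 1) *: (a * c)).
Proof.
have LE := La_E; have RE := Ra_E; have RK := Ra_K.
do !split; rewrite ?expr2 ?La_mulE ?Ra_mulE ?Ra_mulK ?LE ?RE ?RK;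
  rewrite ?(mul0r, mulr0, addr0, add0r) -?scalerAl -?scalerAr ?scalerA ?mulfV ?mulVf ?scale1r //.
- by rewrite -invfM.
- by rewrite cca scalerA scalerDl scale1r.
Qed.

Lemma HW_v1 : HW (v1 q).
Proof.
have QR := regular_quadratic; have EL := idt_lin (A := H) (La_lin E).
rewrite /HW /v1 !(linB EL, linZ EL) !(idt_pure (La_lin E)) !QR !(lin0 (pure_linr _)).
split; first by rewrite scaler0 subr0.
have DL := Ddef_lin.
rewrite !(linB DL, linZ DL) !Ddef_pure // !QR !(lin0 (pure_linr _)) mul1r mulr1 !pureZr.
rewrite subrr add0r addr0 scalerA -[X in _ - (X - _)]scale1r -scalerBl -scalerBl.
by rewrite (_ : _ - _ = 0) ?scale0r //; field.
Qed.

Lemma v2E : v2 q = delta *: (Om \ox (a * c)) - ((q + q^-1) / delta) *: (K \ox (a * c))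
  - q ^- 2 *: ((F * K) \ox (c ^+ 2)) + E \ox (a ^+ 2).
Proof. by rewrite /v2 Om_casimir. Qed.

Lemma HW_v2 : HW (v2 q).
Proof.
have QR := regular_quadratic; have EL := idt_lin (A := H) (La_lin E).
have DL := Ddef_lin.
rewrite /HW v2E !(linD EL, linB EL, linZ EL) !(idt_pure (La_lin E)) !QR !(lin0 (pure_linr _)).
split; first by rewrite !(scaler0, oppr0, addr0).
rewrite !(linD DL, linB DL, linZ DL) !Ddef_pure // !QR !(lin0 (pure_linr _)) !pureZr addr0.
have d0 := delta_neq0 q0 qX; have q2 : q * q - 1 != 0 by rewrite -expr2 subr_eq0 qX.
have eEq : E * e = q ^+ 2 *: (e * E).
  have := uKiE q0; rewrite -[e * E]mulrA => ->.
  by rewrite -!scalerAr scalerA divff ?expf_neq0 // scale1r.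
have Ke' : K * e = q ^+ 2 *: E by rewrite Ke -mulrA uKiK mulr1.
have eK' : e * K = E by rewrite -mulrA uKiK mulr1.
have FKe : F * K * e = q ^+ 2 *: (Om - r *: (q *: K + q^-1 *: Ki)).
  by rewrite -mulrA Ke' -scalerAr Om_FE addrK.
have eFK : e * (F * K) = q ^+ 2 *: (Om - r *: (q^-1 *: K + q *: Ki)).
  rewrite mulrA -[E * Ki * F]mulrA uKiF // -scalerAr -scalerAl Om_EF addrK.
  by rewrite -!mulrA uKiK mulr1.
rewrite eEq Ke' eK' FKe eFK -Om_central subrr add0r.
rewrite !(pureZl, linB (pure_linl _), pureDl, pureZl).
rewrite subrr add0r -[LHS]addr0 ?(opprD, opprK, scalerDr, scalerN, scalerA, =^~ addrA) -?scaleNr.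
move: (Om \ox _) (E \ox _) (K \ox _) (Ki \ox _) => x y z w.
by repeat lincomb_step ltac:(by field; rewrite ?q0 ?q2).
Qed.

Lemma gen_HW x : gen x -> HW x.
Proof.
apply: gen_subalg_min; [exact: HW_1|exact: HW_lin|exact: HW_mul|].
by move=> y [[[->|->]|->]|->]; [exact: HW_v1|exact: HW_v2|exact: HW_v3|exact: HW_v4].
Qed.

Definition box B (h : nat -> nat -> H) : T := \sum_(i < B) \sum_(l < B) h i l \ox mca (i : nat, l : nat).

Lemma box_free B h : box B h = 0 -> forall i l, (i < B)%N -> (l < B)%N -> h i l = 0.
Proof.
move=> h0 i l iB lB; apply: H_nondegenerate => g.
pose s := [seq (i, l) | i <- iota 0 B, l <- iota 0 B].
have us : uniq s by apply: allpairs_uniq; rewrite ?iota_uniq // => -[? ?] [? ?].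
apply: (mca_free us (c := fun k => phi g (h k.1 k.2)) _ (i := (i, l))); last first.
  by apply/allpairsP; exists (i, l); rewrite !mem_iota.
apply/funext => h'; rewrite fct_sumE big_allpairs.
have bE (f : nat -> K0^o) : \sum_(j <- iota 0 B) f j = \sum_(j < B) f j.
  by rewrite -(big_mkord xpredT) /index_iota subn0.
have := congr1 (fun f : Defs.double q -> K0^o => f (g \ox h')) (congr1 dual h0).
rewrite (lin0 (dual_linx _)) => e0; rewrite -[RHS]e0 /box.
rewrite (lin_sum (dual_linx _)) bE; apply: eq_bigr => j _.
rewrite (lin_sum (dual_linx _)) bE; apply: eq_bigr => k _.
by rewrite dual_pure mulrC.
Qed.

(** * Coefficients of highest weight elements *)

Definition tterm (t : H * (nat * nat)) : T := t.1 \ox mca t.2.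

Lemma box_of_lspan (I : eqType) (f : I -> H * (nat * nat)) x :
  lspan (fun i => tterm (f i)) x -> exists B0 (h : nat -> nat -> H),
    [/\ forall B, (B0 <= B)%N -> x = box B h,
        forall i l, (B0 <= i)%N || (B0 <= l)%N -> h i l = 0 &
        forall i l, h i l != 0 -> exists j, (f j).2 = (i, l)].
Proof.
move=> [s ->]; elim: s => [|[k j] s [B0 [h [xE h0 hf]]]].
  exists 0%N, (fun _ _ => 0); split=> // [B _|i l]; last by rewrite eqxx.
  rewrite big_nil /box big1 // => i _; rewrite big1 // => l _; exact: (lin0 (pure_linl _)).
case fj : (f j) => [y [i0 l0]].
pose at_j i l : H := if (i == i0) && (l == l0) then k *: y else 0.
exists (maxn B0 (maxn i0 l0).+1), (fun i l => at_j i l + h i l); split.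
- move=> B; rewrite geq_max => /andP [B0B]; rewrite gtn_max => /andP [i0B l0B].
  rewrite big_cons (xE B B0B) /box.
  under [RHS]eq_bigr do under eq_bigr do rewrite pureDl.
  under [RHS]eq_bigr do rewrite big_split.
  rewrite big_split; congr (_ + _).
  rewrite (bigD1 (Ordinal i0B)) //= [X in _ = _ + X]big1 ?addr0 => [|i ii0]; last first.
    rewrite big1 // => l _; rewrite /at_j ifN ?(lin0 (pure_linl _)) //.
    by rewrite negb_and ii0.
  rewrite (bigD1 (Ordinal l0B)) //= [X in _ = _ + X]big1 ?addr0 => [|l ll0]; last first.
    by rewrite /at_j ifN ?(lin0 (pure_linl _)) // negb_and ll0 orbT.
  by rewrite /at_j !eqxx pureZl /tterm fj.
- move=> i l H0; have il0 : (B0 <= i)%N || (B0 <= l)%N by lia.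
  rewrite h0 // addr0 /at_j ifN //; apply/negP => /andP [/eqP ei /eqP el].
  by rewrite ei el in H0; lia.
- move=> i l; rewrite /at_j; case: ifP => [/andP [/eqP -> /eqP ->] _|_].
    by exists j; rewrite fj.
  by rewrite add0r => /hf.
Qed.

Lemma Ra_E_mca i l : Ra E (mca (i, l)) = qint l *: mca (i.+1, l.-1).
Proof.
rewrite Ra_mulE // Ra_EX0 ?Ra_E // mul0r add0r.
suff -> : Ra E (a ^+ l) = qint l *: (c * a ^+ l.-1) by rewrite -scalerAr mulrA -exprSr.
elim: l => [|l IHl]; first by rewrite regular_1 // qint0 scale0r.
rewrite exprS Ra_mulE // Ra_E // (Ra_KX _ (k := q)) ?Ra_K // IHl -!scalerAr.
case: l {IHl} => [|l]; first by rewrite qint0 scale0r addr0 qint1 // expr0.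
have ac1 : a * c = q^-1 *: (c * a) by have := ac 1; rewrite !expr1.
rewrite /= [a * _]mulrA ac1 -scalerAl scalerA -[c * a * _]mulrA -[a * _]exprS -scalerDl [_ * q^-1]mulrC.
by rewrite -(qintS' q0 qX).
Qed.

Lemma Ra_K_mca i l : Ra K (mca (i, l)) = (q ^+ l / q ^+ i) *: mca (i, l).
Proof.
rewrite Ra_mulK // (Ra_KX _ (k := q^-1)) ?Ra_K // (Ra_KX _ (k := q)) ?Ra_K //.
by rewrite -scalerAl -scalerAr scalerA exprVn mulrC.
Qed.

(** As [Ra E] sends c^i a^l to a multiple of c^(i+1) a^(l-1), each coefficient
    meets only its neighbour of the same total degree. *)
Lemma Ddef_box B0 h : (forall B, (B0 <= B)%N -> Ddef (box B h) = 0) ->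
  (forall i l, (B0 <= i)%N || (B0 <= l)%N -> h i l = 0) ->
  forall i l, h i l * e - (q ^+ l / q ^+ i) *: (e * h i l)
    + (if i is i'.+1 then qint l.+1 *: h i' l.+1 else 0) = 0.
Proof.
move=> D0 h0 i l; pose B := (maxn B0 (maxn i l)).+1.
have BB : (B0 <= B)%N by rewrite leqW // leq_maxl.
have hB i' l' : (B <= i')%N || (B <= l')%N -> h i' l' = 0.
  by move=> H0; apply: h0; case/orP: H0 => /(leq_trans BB) ->; rewrite ?orbT.
have DL := Ddef_lin.
pose dg i l := h i l * e - (q ^+ l / q ^+ i) *: (e * h i l).
pose sh i l := if i is i'.+1 then qint l.+1 *: h i' l.+1 else 0.
have DE : Ddef (box B.+1 h) = box B.+1 (fun i l => dg i l + sh i l).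
  rewrite /box (lin_sum DL).
  under eq_bigr do rewrite (lin_sum DL).
  under eq_bigr do under eq_bigr do
    rewrite Ddef_pure // Ra_K_mca Ra_E_mca !pureZr -!pureZl -(linB (pure_linl _)) -/(dg _ _).
  under eq_bigr do rewrite big_split /=.
  under [RHS]eq_bigr do under eq_bigr do rewrite pureDl.
  under [RHS]eq_bigr do rewrite big_split /=.
  rewrite !big_split /=; congr (_ + _).
  have z0 k : 0 \ox mca k = 0 :> T by exact: (lin0 (pure_linl _)).
  rewrite [LHS]big_ord_recr [RHS]big_ord_recl /= [X in _ + X = _]big1 => [|l' _]; last first.
    by rewrite hB ?leqnn // scaler0 z0.
  rewrite [X in _ = X + _]big1 ?addr0 ?add0r => [|l' _]; last by rewrite z0.
  apply: eq_bigr => i' _; rewrite [LHS]big_ord_recl [RHS]big_ord_recr /=.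
  rewrite qint0 scale0r z0 add0r [h i' B.+1]hB ?leqnSn ?orbT // scaler0 z0 addr0.
  by apply: eq_bigr.
have := D0 B.+1 (leqW BB); rewrite DE => /box_free H0.
by apply: (H0 i l); rewrite /B; lia.
Qed.

(** The exponent of a is positive: the pure powers of c are left out, because
    their coefficients determine all others. *)
Definition zterm (t : H * nat * nat) : T := t.1.1 \ox mca (t.1.2, t.2.+1).
Local Notation Za := (lspan zterm).

Lemma Za_pure h i l : Za (h \ox mca (i, l.+1)).
Proof. exact: (lspan_gen zterm (h, i, l)). Qed.

Lemma Za_tterm x : Za x -> lspan tterm x.
Proof.
by apply: lspan_trans => -[[h i] l]; exact: (lspan_gen tterm (h, (i, l.+1))).
Qed.

Lemma Za_mull h n x : Za x -> Za (h \ox mca (n, 0%N) * x).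
Proof.
apply: (lspan_sub (f := fun x => h \ox mca (n, 0%N) * x)) => [k u v|[[h' i] l]].
  by rewrite mulrDr scalerAr.
rewrite /zterm pureM /mca /= expr0 mulr1 mulrA -exprD.
exact: (Za_pure (h * h') (n + i) l).
Qed.

Lemma Za_mulr x y : Za x -> lspan tterm y -> Za (x * y).
Proof.
move=> Zx; apply: (lspan_sub (f := fun y => x * y)) => [k u v|[h' [i' l']]].
  by rewrite mulrDr scalerAr.
apply: (lspan_sub (f := fun x => x * tterm (h', (i', l')))) Zx => [k u v|[[h i] l]].
  by rewrite mulrDl scalerAl.
have acX m n : a ^+ n * c ^+ m = (q ^+ (m * n))^-1 *: (c ^+ m * a ^+ n).
  by rewrite cac scalerA mulVf ?expf_neq0 // scale1r.
rewrite /zterm /tterm pureM /mca /= -mulrA [a ^+ _ * (_ * _)]mulrA acX -scalerAl -scalerAr pureZr.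
apply: lspanZ; rewrite -!mulrA -exprD mulrA -exprD addSn.
exact: (Za_pure (h * h') (i + i') (l + l')).
Qed.

(** Highest weight elements are determined by their coefficients at the pure
    powers of c; these are the coefficients realized by the generators. *)
Definition leading (n : nat) (h : H) : Prop :=
  exists2 y, gen y & Za (y - h \ox mca (n, 0%N)).

Lemma leading_0 n : leading n 0.
Proof.
exists 0; first by rewrite -(scale0r 1); exact/gen_subalgZ/gen_subalg_1.
by rewrite (lin0 (pure_linl _)) subrr; exact: lspan0.
Qed.

Lemma leading_lin n k x y : leading n x -> leading n y -> leading n (k *: x + y).
Proof.
move=> [u gu Zu] [v gv Zv]; exists (k *: u + v); first exact: gen_subalgP.
by rewrite (pure_linl _) opprD addrACA -scalerBr; exact: lspanP.
Qed.

Lemma leading_mul n m x y : leading n x -> leading m y -> leading (n + m) (x * y).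
Proof.
move=> [u gu Zu] [v gv Zv]; exists (u * v); first exact: gen_subalgM.
have -> : u * v - (x * y) \ox mca ((n + m)%N, 0%N) =
    (u - x \ox mca (n, 0%N)) * v + x \ox mca (n, 0%N) * (v - y \ox mca (m, 0%N)).
  rewrite mulrBl mulrBr pureM addrA subrK; congr (_ - _ \ox _).
  by rewrite /mca /= !expr0 !mulr1 exprD.
apply: lspanD; last exact: Za_mull.
apply: Za_mulr => //; rewrite -[v](subrK (y \ox mca (m, 0%N))).
by apply: lspanD; [exact: Za_tterm|exact: (lspan_gen tterm (y, (m, 0%N)))].
Qed.

Lemma leadingZ n k x : leading n x -> leading n (k *: x).
Proof. by move=> lx; rewrite -[k *: x]addr0; apply: leading_lin lx (leading_0 n). Qed.

Lemma mca0 n : mca (n, 0%N) = c ^+ n.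
Proof. by rewrite /mca /= expr0 mulr1. Qed.

Lemma gen_v : [/\ gen (v1 q), gen (v2 q), gen (v3 q) & gen (v4 q)].
Proof. by split; apply: gen_subalg_in; rewrite /=; tauto. Qed.

Lemma ac_mca : a * c = q^-1 *: mca (1%N, 1%N).
Proof. by rewrite /mca /= !expr1 cca scalerA mulVf // scale1r. Qed.
Lemma aa_mca : a ^+ 2 = mca (0%N, 2).
Proof. by rewrite /mca /= expr0 mul1r. Qed.

Lemma leading_1 : leading 0 1.
Proof. by exists 1; [exact: gen_subalg_1|rewrite mca0 expr0 subrr; exact: lspan0]. Qed.
Lemma leading_e : leading 0 e.
Proof. by have [_ _ g3 _] := gen_v; exists (v3 q); rewrite // mca0 expr0 subrr; exact: lspan0. Qed.
Lemma leading_Om : leading 0 Om.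
Proof.
have [_ _ _ g4] := gen_v; exists (v4 q); rewrite // mca0 expr0 /v4 Om_casimir subrr.
exact: lspan0.
Qed.
Lemma leading2_1 : leading 2 1.
Proof.
have [g1 _ _ _] := gen_v; exists (- v1 q); first by rewrite -scaleN1r; exact: gen_subalgZ.
rewrite mca0 /v1 opprB [1 \ox _ - _]addrC addrK ac_mca pureZr -scalerN -scaleN1r !scalerA.
exact/lspanZ/Za_pure.
Qed.
Lemma leading2_FK : leading 2 (F * K).
Proof.
have [_ g2 _ _] := gen_v.
have : leading 2 (- q ^- 2 *: (F * K)).
  exists (v2 q) => //; rewrite (linZ (pure_linl _)) mca0 v2E scaleNr opprK.
  rewrite addrAC subrK ac_mca !pureZr !scalerA aa_mca -scaleNr.
  by apply: lspanD; [apply: lspanD; exact/lspanZ/Za_pure|exact: Za_pure].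
move=> /(leadingZ (- q ^+ 2)); rewrite scalerA mulrNN divff ?expf_neq0 //.
by rewrite scale1r.
Qed.

(** Up to scalars, q K + q^-1 K^-1 and q^-1 K + q K^-1 are the differences of
    the casimir with F E and with E F, and F E and E F are multiples of
    (F K) e and e (F K). *)
Lemma leading2_K : leading 2 K /\ leading 2 Ki.
Proof.
have q2 : q ^+ 2 != 0 by rewrite expf_neq0.
have r0 : r != 0 by rewrite invr_eq0 expf_neq0 // delta_neq0.
have lOm : leading 2 Om by rewrite -[Om]mulr1; exact: (leading_mul leading_Om leading2_1).
have lD n x y : leading n x -> leading n y -> leading n (x + y).
  by rewrite -{2}[x]scale1r; exact: leading_lin.
have lFE : leading 2 (q *: K + q^-1 *: Ki).
  have -> : q *: K + q^-1 *: Ki = r^-1 *: (Om - q ^- 2 *: (F * K * e)).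
    have -> : F * K * e = q ^+ 2 *: (F * E).
      by rewrite -mulrA Ke -[e * K]mulrA uKiK mulr1 scalerAr.
    by rewrite scalerA mulVf // scale1r Om_FE [F * E + _]addrC addrK scalerA mulVf // scale1r.
  apply/leadingZ/lD => //; rewrite -scaleNr; apply: leadingZ.
  exact: (leading_mul leading2_FK leading_e).
have lEF : leading 2 (q^-1 *: K + q *: Ki).
  have -> : q^-1 *: K + q *: Ki = r^-1 *: (Om - q ^- 2 *: (e * (F * K))).
    have -> : e * (F * K) = q ^+ 2 *: (E * F).
      rewrite mulrA -[E * Ki * F]mulrA uKiF // -scalerAr -scalerAl.
      by rewrite -!mulrA uKiK mulr1.
    by rewrite scalerA mulVf // scale1r Om_EF [E * F + _]addrC addrK scalerA mulVf // scale1r.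
  apply/leadingZ/lD => //; rewrite -scaleNr; apply: leadingZ.
  exact: (leading_mul leading_e leading2_FK).
have q4 : q ^+ 4 - 1 != 0 by rewrite subr_eq0 qX.
have q4' : q ^+ 2 - q ^- 2 != 0.
  apply: contra q4 => /eqP e0; apply/eqP.
  have -> : q ^+ 4 - 1 = q ^+ 2 * (q ^+ 2 - q ^- 2) by field.
  by rewrite e0 mulr0.
split.
  have -> : K = (q ^+ 2 - q ^- 2)^-1 *: (q *: (q *: K + q^-1 *: Ki) - q^-1 *: (q^-1 *: K + q *: Ki)).
    apply: (scalerI q4'); rewrite [RHS]scalerA mulfV // scale1r !scalerDr !scalerA mulfV // mulVf //.
    by rewrite opprD addrACA subrr addr0 -scalerBl expr2 invfM.
  by apply/leadingZ/lD; [exact: leadingZ|rewrite -scaleNr; exact: leadingZ].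
have -> : Ki = (q ^+ 2 - q ^- 2)^-1 *: (q *: (q^-1 *: K + q *: Ki) - q^-1 *: (q *: K + q^-1 *: Ki)).
  apply: (scalerI q4'); rewrite [RHS]scalerA mulfV // scale1r !scalerDr !scalerA mulfV // mulVf //.
  by rewrite opprD addrACA subrr add0r -scalerBl expr2 invfM.
by apply/leadingZ/lD; [exact: leadingZ|rewrite -scaleNr; exact: leadingZ].
Qed.

Lemma Dprod_leading n h :
  Dprod (fun i => (q ^+ 2) ^+ i / q ^+ n) n.+1 h = 0 -> leading n h.
Proof.
have [lK lKi] := leading2_K.
apply: (Dprod_ker leading_0 leading_lin leading_mul leading_1 leading_e leading_Om
  leading2_1 lK lKi leading2_FK).
Qed.

(** Over independent left factors, and with H acting faithfully on C, the
    condition La E = 0 passes to each right factor. *)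
Lemma HW_span x : HW x -> lspan tterm x.
Proof.
move=> [xl _]; have [n [u [w [uF xE]]]] := tensor_free_expansion x.
rewrite xE; apply: lspan_sum => i _.
have wE h : phi (w i) (h * E) = 0.
  move: i; apply: (uF (fun i => phi (w i) (h * E))); apply: H_nondegenerate => g.
  have := congr1 (fun f : Defs.double q -> K0^o => f (g \ox h)) (congr1 dual xl).
  rewrite (lin0 (dual_linx _)) xE (lin_sum (idt_lin (La_lin E))) (lin_sum (dual_linx _)).
  move=> e0; rewrite -[RHS]e0 (lin_sum (phi_linr g)); apply: eq_bigr => j _.
  by rewrite (linZ (phi_linr g)) (idt_pure (La_lin E)) dual_pure -phi_La.
have := ker_E_span wE.
apply: (lspan_sub (f := fun y => u i \ox y)); first exact: pure_linr.
by move=> k; exact: (lspan_gen tterm (u i, k)).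
Qed.

(** The condition [Ddef x = 0] determines the coefficients of c^i a^l from
    those of the pure powers of c, by iterating the operators of [Dprod]. *)
Lemma Ddef_chain B0 h : (forall B, (B0 <= B)%N -> Ddef (box B h) = 0) ->
  (forall i l, (B0 <= i)%N || (B0 <= l)%N -> h i l = 0) ->
  forall n, leading n (h n 0%N).
Proof.
move=> D0 h0 n; have rec := Ddef_box D0 h0; apply: Dprod_leading.
pose lam i := (q ^+ 2) ^+ i / q ^+ n.
have lamE l : (l <= n)%N -> q ^+ l / q ^+ (n - l) = lam l.
  move=> ln; rewrite /lam -exprM mul2n -addnn exprD.
  have -> : q ^+ n = q ^+ (n - l) * q ^+ l by rewrite -exprD subnK.
  have := expf_neq0 l q0; have := expf_neq0 (n - l) q0.
  by move: (q ^+ l) (q ^+ (n - l)) => u v v0 u0; field; rewrite u0.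
have chain l : (l <= n)%N -> exists2 k, k != 0 & h (n - l)%N l = k *: Dprod lam l (h n 0%N).
  elim: l => [|l IHl] ln; first by exists 1; rewrite ?oner_neq0 // subn0 scale1r.
  have [k k0 hE] := IHl (ltnW ln).
  exists (- (k / qint l.+1)).
    by rewrite oppr_eq0 mulf_neq0 // invr_eq0 qint_neq0.
  have := rec (n - l)%N l; rewrite lamE ?(ltnW ln) // hE subnS.
  case: (n - l)%N (subn_gt0 l n) => [|m _] /=; first by rewrite ln.
  move=> /eqP; rewrite -scalerAl -!scalerAr scalerA mulrC -scalerA -scalerBr addrC addr_eq0.
  move=> /eqP /(congr1 ( *:%R (qint l.+1)^-1)).
  by rewrite scalerA mulVf ?(qint_neq0 q0 qX) // scale1r => ->; rewrite scalerN scalerA scaleNr mulrC.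
have [k k0 hE] := chain n (leqnn n).
have := rec 0%N n; rewrite addr0; rewrite subnn in hE; rewrite hE.
have := lamE n (leqnn n); rewrite subnn => -> /eqP.
rewrite -scalerAl -!scalerAr scalerA mulrC -scalerA -scalerBr scaler_eq0 (negPf k0).
by move=> /eqP.
Qed.

(** Without pure powers of c, the recursion of [Ddef_box] starts from 0. *)
Lemma Za_Ddef0 z : Za z -> Ddef z = 0 -> z = 0.
Proof.
move=> Zz Dz; have [B0 [h [zE h0 hf]]] := box_of_lspan (f := fun t => (t.1.1, (t.1.2, t.2.+1))) Zz.
have D0 B : (B0 <= B)%N -> Ddef (box B h) = 0 by move=> BB; rewrite -zE.
have rec := Ddef_box D0 h0.
have hz l : forall i, h i l = 0.
  elim: l => [|l IHl] i.
    by apply/eqP; apply: contraT => /hf [[[y i'] l']].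
  have := rec i.+1 l; rewrite IHl mulr0 mul0r scaler0 subr0 add0r => /eqP.
  by rewrite scaler_eq0 (negPf (qint_neq0 q0 qX _)) => /eqP.
rewrite (zE B0 (leqnn _)) /box big1 // => i _; rewrite big1 // => l _.
by rewrite hz (lin0 (pure_linl _)).
Qed.

(** Subtracting, for each n, an element of the generated subalgebra with the
    same coefficient of c^n leaves no pure power of c. *)
Lemma HW_gen x : HW x -> gen x.
Proof.
move=> Hx; have [B0 [h [xE h0 _]]] := box_of_lspan (f := id) (HW_span Hx).
have D0 B : (B0 <= B)%N -> Ddef (box B h) = 0 by move=> BB; rewrite -xE //; case: Hx.
have /choice [y yP] n : exists y, gen y /\ Za (y - h n 0%N \ox mca (n, 0%N)).
  by have [y gy Zy] := Ddef_chain D0 h0 n; exists y.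
have gD u v : gen u -> gen v -> gen (u + v) by rewrite -{2}[u]scale1r; exact: gen_subalgP.
pose Y := \sum_(i < B0.+1) y i.
have gY : gen Y.
  apply: big_ind => // [|i _]; last by case: (yP i).
  by rewrite -(scale0r 1); exact/gen_subalgZ/gen_subalg_1.
suff z0 : x - Y = 0 by rewrite -[x](subrK Y) z0 add0r.
apply: Za_Ddef0; last first.
  by rewrite (linB Ddef_lin) Hx.2 (gen_HW gY).2 subrr.
rewrite (xE B0.+1 (leqnSn _)) /box /Y -sumrB; apply: lspan_sum => i _.
rewrite big_ord_recl addrAC; apply: lspanD.
  by rewrite -opprB -scaleN1r; apply: lspanZ; case: (yP i).
by apply: lspan_sum => l _; exact: Za_pure.
Qed.

Lemma HW_eq_gen : highest_weight q0 phi = gen.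
Proof.
apply/seteqP; split=> x.
  by move=> /highest_weightE; exact: HW_gen.
by move=> gx; apply/highest_weightE; exact: gen_HW _ gx.
Qed.

(** * Matrix representations of the quantum double *)

(** Data for a finite-dimensional representation of the quantum double in
    matrix form: H acts by the values of B, C by the values of A, and the last
    four conditions are the cross-relations for the generators of H.  The
    twists lam and mu allow the two 2-dimensional building blocks, which are
    honest representations only after adjoining a square root of K. *)
Record matrix_rep (lam mu : K0) (I : finType) (A : I -> I -> H) (B : I -> I -> C) : Prop :=
  MatrixRep {
    mr_A : forall i j, DH (A i j) = \sum_k A k j \ox A i k;
    mr_B : forall i j, DC (B i j) = \sum_k B i k \ox B k j;
    mr_1 : forall i j, phi (B i j) 1 = (i == j)%:R;
    mr_E : forall i j,
      \sum_k (lam * phi (B i k) K : K0) *: (E * A k j) + \sum_k (phi (B i k) E : K0) *: A k j =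
      \sum_k (phi (B k j) E : K0) *: (A i k * K) + mu *: (A i j * E);
    mr_F : forall i j,
      lam^-1 *: (F * A i j) + \sum_k (phi (B i k) F : K0) *: (Ki * A k j) =
      \sum_k (phi (B k j) F : K0) *: A i k + \sum_k (mu^-1 * phi (B k j) Ki : K0) *: (A i k * F);
    mr_K : forall i j,
      \sum_k (phi (B i k) K : K0) *: (K * A k j) = \sum_k (phi (B k j) K : K0) *: (A i k * K);
    mr_Ki : forall i j,
      \sum_k (phi (B i k) Ki : K0) *: (Ki * A k j) = \sum_k (phi (B k j) Ki : K0) *: (A i k * Ki)
  }.

Lemma DH_mul x y : DH (x * y) = DH x * DH y. Proof. exact: rmorphM. Qed.
Lemma DC_mul x y : DC (x * y) = DC x * DC y. Proof. exact: rmorphM. Qed.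

Lemma sum_delta (I : finType) (V : lmodType K0) (G : I -> V) i :
  \sum_k ((i == k)%:R : K0) *: G k = G i.
Proof.
rewrite (bigD1 i) //= eqxx scale1r big1 ?addr0 // => k; rewrite eq_sym => /negPf ->.
by rewrite scale0r.
Qed.
Lemma sum_delta' (I : finType) (V : lmodType K0) (G : I -> V) j :
  \sum_k ((k == j)%:R : K0) *: G k = G j.
Proof. by rewrite -[RHS]sum_delta; apply: eq_bigr => k _; rewrite eq_sym. Qed.

Section TensorProduct.
Variables (lam mu nu : K0) (I J : finType).
Variables (A : I -> I -> H) (B : I -> I -> C) (A' : J -> J -> H) (B' : J -> J -> C).
Hypotheses (R : matrix_rep lam mu A B) (R' : matrix_rep mu nu A' B').

Definition tensorA (i j : I * J) : H := A i.1 j.1 * A' i.2 j.2.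
Definition tensorB (i j : I * J) : C := B i.1 j.1 * B' i.2 j.2.

Lemma pair_sum (V : nmodType) (G : I * J -> V) : \sum_p G p = \sum_i \sum_j G (i, j).
Proof. by rewrite pair_bigA; apply: eq_bigr => -[i j]. Qed.

Let sumM (X : I -> H) (Y : J -> H) (x : I -> K0) (y : J -> K0) :
  \sum_p (x p.1 * y p.2) *: (X p.1 * Y p.2) = (\sum_i x i *: X i) * (\sum_j y j *: Y j).
Proof.
rewrite pair_sum mulr_suml; apply: eq_bigr => i _; rewrite mulr_sumr; apply: eq_bigr => j _.
by rewrite -scalerAl -scalerAr scalerA.
Qed.

(** The twist mu in the middle cancels: the E- and F-relations of the two factors
    are combined by means of the K-relation of the other one. *)
Lemma matrix_rep_tensor : matrix_rep lam nu tensorA tensorB.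
Proof.
split.
- move=> [i i'] [j j']; rewrite /tensorA /= DH_mul (mr_A R) (mr_A R') pair_sum mulr_suml.
  apply: eq_bigr => k _; rewrite mulr_sumr; apply: eq_bigr => k' _.
  by rewrite pureM.
- move=> [i i'] [j j']; rewrite /tensorB /= DC_mul (mr_B R) (mr_B R') pair_sum mulr_suml.
  apply: eq_bigr => k _; rewrite mulr_sumr; apply: eq_bigr => k' _.
  by rewrite pureM.
- move=> [i i'] [j j']; rewrite /tensorB /= phi_mul_1 // (mr_1 R) (mr_1 R').
  by rewrite xpair_eqE; case: (i == j); case: (i' == j'); rewrite /= ?mulr1 ?mul0r ?mulr0.
- move=> [i i'] [j j']; rewrite /tensorA /tensorB /=.
  pose QK k := phi (B i k) K : K0; pose QK' k := phi (B' i' k) K : K0.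
  have s1 : \sum_p (lam * phi (B i p.1 * B' i' p.2) K : K0) *: (E * (A p.1 j * A' p.2 j')) =
      (\sum_k (lam * QK k) *: (E * A k j)) * (\sum_k QK' k *: A' k j').
    by rewrite -sumM; apply: eq_bigr => p _; rewrite phi_mul_K // !mulrA.
  have s2 : \sum_p (phi (B i p.1 * B' i' p.2) E : K0) *: (A p.1 j * A' p.2 j') =
      (\sum_k (phi (B i k) E : K0) *: A k j) * (\sum_k QK' k *: A' k j') +
      A i j * (\sum_k (phi (B' i' k) E : K0) *: A' k j').
    rewrite -(sum_delta (fun k => A k j) i) -!sumM -big_split; apply: eq_bigr => p _.
    by rewrite phi_mul_E // (mr_1 R) scalerDl.
  have s3 : \sum_p (phi (B p.1 j * B' p.2 j') E : K0) *: (A i p.1 * A' i' p.2 * K) =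
      (\sum_k (phi (B k j) E : K0) *: A i k) * (\sum_k (phi (B' k j') K : K0) *: (A' i' k * K)) +
      A i j * (\sum_k (phi (B' k j') E : K0) *: (A' i' k * K)).
    rewrite -(sum_delta' (fun k => A i k) j) -!sumM -big_split; apply: eq_bigr => p _.
    by rewrite phi_mul_E // (mr_1 R) scalerDl !mulrA.
  rewrite s1 s2 s3 addrA -mulrDl (mr_E R) -(mr_K R') mulrDl -!addrA; congr (_ + _).
    rewrite mulr_suml mulr_suml; apply: eq_bigr => k _; rewrite -!scalerAl; congr (_ *: _).
    rewrite -mulrA; congr (_ * _); rewrite mulr_sumr; apply: eq_bigr => k' _.
    by rewrite -scalerAr.
  rewrite -scalerAl -[A i j * A' i' j' * E]mulrA scalerAr -mulrA scalerAr -!mulrDr; congr (_ * _).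
  rewrite -(mr_E R'); congr (_ + _); rewrite scaler_sumr mulr_sumr; apply: eq_bigr => k _.
  by rewrite scalerA -scalerAr.
- move=> [i i'] [j j']; rewrite /tensorA /tensorB /=.
  have s1 : \sum_p (phi (B i p.1 * B' i' p.2) F : K0) *: (Ki * (A p.1 j * A' p.2 j')) =
      (\sum_k (phi (B i k) F : K0) *: (Ki * A k j)) * A' i' j' +
      (\sum_k (phi (B i k) Ki : K0) *: (Ki * A k j)) * (\sum_k (phi (B' i' k) F : K0) *: A' k j').
    rewrite -(sum_delta (fun k => A' k j') i') -!sumM -big_split; apply: eq_bigr => p _.
    by rewrite phi_mul_F // (mr_1 R') scalerDl !mulrA.
  have s2 : \sum_p (phi (B p.1 j * B' p.2 j') F : K0) *: (A i p.1 * A' i' p.2) =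
      (\sum_k (phi (B k j) F : K0) *: A i k) * A' i' j' +
      (\sum_k (phi (B k j) Ki : K0) *: A i k) * (\sum_k (phi (B' k j') F : K0) *: A' i' k).
    rewrite -(sum_delta' (fun k => A' i' k) j') -!sumM -big_split; apply: eq_bigr => p _.
    by rewrite phi_mul_F // (mr_1 R') scalerDl.
  have s3 : \sum_p (nu^-1 * phi (B p.1 j * B' p.2 j') Ki : K0) *: (A i p.1 * A' i' p.2 * F) =
      (\sum_k (phi (B k j) Ki : K0) *: A i k) * (\sum_k (nu^-1 * phi (B' k j') Ki : K0) *: (A' i' k * F)).
    rewrite -sumM; apply: eq_bigr => p _; rewrite phi_mul_Ki // !mulrA.
    by rewrite [nu^-1 * _]mulrC.
  rewrite s1 s2 s3 [F * _]mulrA scalerAl addrA -mulrDl (mr_F R) (mr_Ki R) mulrDl -!addrA; congr (_ + _).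
  rewrite -mulrDr -(mr_F R') mulrDr; congr (_ + _).
    rewrite mulr_suml mulr_suml; apply: eq_bigr => k _.
    by rewrite -!scalerAl -scalerAr scalerA !mulrA mulrC.
  rewrite !mulr_suml; apply: eq_bigr => k _; rewrite -!scalerAl -mulrA; congr (_ *: (_ * _)).
  by rewrite mulr_sumr; apply: eq_bigr => k' _; rewrite -scalerAr.
- move=> [i i'] [j j']; rewrite /tensorA /tensorB /=.
  have s1 : \sum_p (phi (B i p.1 * B' i' p.2) K : K0) *: (K * (A p.1 j * A' p.2 j')) =
      (\sum_k (phi (B i k) K : K0) *: (K * A k j)) * (\sum_k (phi (B' i' k) K : K0) *: A' k j').
    by rewrite -sumM; apply: eq_bigr => p _; rewrite phi_mul_K // !mulrA.
  have s2 : \sum_p (phi (B p.1 j * B' p.2 j') K : K0) *: (A i p.1 * A' i' p.2 * K) =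
      (\sum_k (phi (B k j) K : K0) *: A i k) * (\sum_k (phi (B' k j') K : K0) *: (A' i' k * K)).
    by rewrite -sumM; apply: eq_bigr => p _; rewrite phi_mul_K // !mulrA.
  rewrite s1 s2 (mr_K R) -(mr_K R') !mulr_suml; apply: eq_bigr => k _.
  rewrite -!scalerAl -mulrA; congr (_ *: (_ * _)).
  by rewrite mulr_sumr; apply: eq_bigr => k' _; rewrite -scalerAr.
- move=> [i i'] [j j']; rewrite /tensorA /tensorB /=.
  have s1 : \sum_p (phi (B i p.1 * B' i' p.2) Ki : K0) *: (Ki * (A p.1 j * A' p.2 j')) =
      (\sum_k (phi (B i k) Ki : K0) *: (Ki * A k j)) * (\sum_k (phi (B' i' k) Ki : K0) *: A' k j').
    by rewrite -sumM; apply: eq_bigr => p _; rewrite phi_mul_Ki // !mulrA.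
  have s2 : \sum_p (phi (B p.1 j * B' p.2 j') Ki : K0) *: (A i p.1 * A' i' p.2 * Ki) =
      (\sum_k (phi (B k j) Ki : K0) *: A i k) * (\sum_k (phi (B' k j') Ki : K0) *: (A' i' k * Ki)).
    by rewrite -sumM; apply: eq_bigr => p _; rewrite phi_mul_Ki // !mulrA.
  rewrite s1 s2 (mr_Ki R) -(mr_Ki R') !mulr_suml; apply: eq_bigr => k _.
  rewrite -!scalerAl -mulrA; congr (_ *: (_ * _)).
  by rewrite mulr_sumr; apply: eq_bigr => k' _; rewrite -scalerAr.
Qed.
End TensorProduct.

(** The 2-dimensional corepresentation, [false] being the first index. *)
Definition fund (i j : bool) : C :=
  match i, j with false, false => a | false, true => b | true, false => c | true, true => d end.

(** Up to powers of the square root of K, the lower and upper triangular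
    L-operators of the fundamental representation. *)
Definition Llow (i j : bool) : H :=
  match i, j with
  | false, false => 1 | false, true => 0 | true, false => - delta *: E | true, true => K
  end.
Definition Lupp (i j : bool) : H :=
  match i, j with
  | false, false => 1 | false, true => delta *: F | true, false => 0 | true, true => Ki
  end.

Lemma DH_0 : DH 0 = 0. Proof. exact: lin0 DH_lin. Qed.
Lemma DH_1 : DH 1 = 1 \ox 1. Proof. exact: rmorph1. Qed.

Lemma fund_corepresentation : (forall i j, DC (fund i j) = \sum_k fund i k \ox fund k j) /\
  (forall i j, phi (fund i j) 1 = (i == j)%:R).
Proof.
split=> [] [] []; rewrite ?big_bool /= ?DC_a ?DC_b ?DC_c ?DC_d ?phi_gens //; by rewrite addrC.
Qed.

Lemma Llow_rep : matrix_rep 1 q^-1 Llow fund.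
Proof.
have [fB f1] := fund_corepresentation; have g := phi_gens.
have z1 (x : H) : x \ox (0 : H) = 0 by exact: (lin0 (pure_linr _)).
have z2 (x : H) : (0 : H) \ox x = 0 by exact: (lin0 (pure_linl _)).
have d0 := delta_neq0 q0 qX; have q20 := expf_neq0 2 q0.
split=> //.
- move=> [] []; rewrite big_bool /= ?DH_1 ?DH_0 ?DH_K ?z1 ?z2 ?addr0 ?add0r //.
  by rewrite (linZ DH_lin) DH_E pureZl pureZr scalerDr addrC.
- move=> [] []; rewrite !big_bool /= !g ?(mulr0, mul0r, mulr1, mul1r, scale0r, scale1r, addr0, add0r, scaler0, invr1, invrK) //.
  + rewrite uKE -scalerAl scalerA -scalerDl; congr (_ *: _); by field.
  + by rewrite -scalerAl -scalerAr.
  + by rewrite -scalerDl; congr (_ *: _); ring.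
- move=> [] []; rewrite !big_bool /= !g ?(mulr0, mul0r, mulr1, mul1r, scale0r, scale1r, addr0, add0r, scaler0, invr1, invrK) ?(divff q0) ?scale1r //.
  + by rewrite uKF scalerA -expr2 divff // scale1r.
  + rewrite -scalerAl -scalerAr uEF scalerDr scalerBr !scalerA mulNr divff //.
    by rewrite !scaleN1r opprK [RHS]addrCA [K + _]addrA subrr add0r.
- move=> [] []; rewrite !big_bool /= !g ?(mulr0, mul0r, mulr1, mul1r, scale0r, scale1r, addr0, add0r, scaler0, invr1, invrK) //.
  by rewrite -scalerAl -scalerAr uKE !scalerA; congr (_ *: _); field.
- move=> [] []; rewrite !big_bool /= !g ?(mulr0, mul0r, mulr1, mul1r, scale0r, scale1r, addr0, add0r, scaler0, invr1, invrK) //.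
    by rewrite uKKi uKiK.
  by rewrite -scalerAl -scalerAr uKiE // !scalerA; congr (_ *: _); field.
Qed.

Lemma Lupp_rep : matrix_rep q^-1 1 Lupp fund.
Proof.
have [fB f1] := fund_corepresentation; have g := phi_gens.
have z1 (x : H) : x \ox (0 : H) = 0 by exact: (lin0 (pure_linr _)).
have z2 (x : H) : (0 : H) \ox x = 0 by exact: (lin0 (pure_linl _)).
have d0 := delta_neq0 q0 qX; have q20 := expf_neq0 2 q0.
split=> //.
- move=> [] []; rewrite big_bool /= ?DH_1 ?DH_0 ?DH_Ki ?z1 ?z2 ?addr0 ?add0r //.
  by rewrite (linZ DH_lin) DH_F pureZl pureZr scalerDr addrC.
- move=> [] []; rewrite !big_bool /= !g ?(mulr0, mul0r, mulr1, mul1r, scale0r, scale1r, addr0, add0r, scaler0, invr1, invrK) //.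
  + by rewrite uKiE //; congr (_ *: _); field.
  + rewrite mulVf // scale1r -scalerAr -scalerAl uEF scalerDr scalerBr !scalerA divff //.
    by rewrite !scale1r -addrA subrK addrC.
  + by rewrite mulVf // scale1r.
- move=> [] []; rewrite !big_bool /= !g ?(mulr0, mul0r, mulr1, mul1r, scale0r, scale1r, addr0, add0r, scaler0, invr1, invrK) //.
  + rewrite -scalerAr uKiF // !scalerA -scalerDl; congr (_ *: _); by field.
  + by rewrite -scalerAr -scalerAl.
  + by rewrite -scalerDl; congr (_ *: _); ring.
- move=> [] []; rewrite !big_bool /= !g ?(mulr0, mul0r, mulr1, mul1r, scale0r, scale1r, addr0, add0r, scaler0, invr1, invrK) //.
    by rewrite uKKi uKiK.
  by rewrite -scalerAl -scalerAr uKF !scalerA; congr (_ *: _); field.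
- move=> [] []; rewrite !big_bool /= !g ?(mulr0, mul0r, mulr1, mul1r, scale0r, scale1r, addr0, add0r, scaler0, invr1, invrK) //.
  by rewrite -scalerAl -scalerAr uKiF // !scalerA; congr (_ *: _); field.
Qed.

Section MatrixCoefficients.
Variables (I : finType) (A : I -> I -> H) (B : I -> I -> C).
Hypothesis R : matrix_rep 1 1 A B.

Lemma phi_B i j h h' : phi (B i j) (h * h') = \sum_k (phi (B i k) h * phi (B k j) h' : K0).
Proof.
have FB : bilin (fun g1 g2 => phi g1 h * phi g2 h' : K0^o).
  by split=> [g|g] k x y; rewrite phi_linl ?mulrDl ?mulrDr -?scalerAl -?scalerAr.
rewrite (hp_mulr phiP) /sweedler2 (mr_B R) (lin_sum (tlift_linear FB)).
by apply: eq_bigr => k _; rewrite tlift_pure.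
Qed.

Lemma phi_A g g' i j : phi (g * g') (A i j) = \sum_k (phi g (A k j) * phi g' (A i k) : K0).
Proof.
have FB := phi_bilin2 g g'.
rewrite (hp_mull phiP) /sweedler2 (mr_A R) (lin_sum (tlift_linear FB)).
by apply: eq_bigr => k _; rewrite tlift_pure.
Qed.

Lemma ad_trilin (g : C) (x : H) :
  trilin (fun h1 h2 h3 : H => (phi g h2 : K0) *: (SH q0 h1 * x * h3)).
Proof.
split=> u v k z w.
- by rewrite SH_lin !mulrDl -!scalerAl scalerDr !scalerA mulrC.
- by rewrite phi_linr scalerDl -scalerA.
- by rewrite mulrDr -scalerAr scalerDr !scalerA mulrC.
Qed.

(** The cross-relation between A and h is multiplicative in h, so it spreads
    from the generators to all of H. *)
Lemma ad_A h i j :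
  \sum_k sweedler3 DH (fun h1 h2 h3 => (phi (B k j) h2 : K0) *: (SH q0 h1 * A i k * h3)) h =
  \sum_k (phi (B i k) h : K0) *: A k j.
Proof.
have s3L k j' i' : linear (sweedler3 DH (fun h1 h2 h3 => (phi (B k j') h2 : K0) *: (SH q0 h1 * A i' k * h3))).
  exact/sweedler3_linear/ad_trilin.
have B1 (X : I -> H) j' : \sum_k (phi (B k j') 1 : K0) *: X k = X j'.
  by rewrite -(sum_delta' X); apply: eq_bigr => k _; rewrite (mr_1 R).
elim/palg_ind: h i j => [g||k x y Hx Hy|x y Hx Hy] i j.
- have T k := ad_trilin (B k j) (A i k).
  case: g; rewrite -?/(uE q) -?/(uF q) -?/(uK q) -?/(uKi q).
  + under eq_bigr do rewrite /sweedler3 (sweedler2_E (sweedler3_bilin DH (T _)))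
      (sweedler2_K (bilin_trilin _ (T _))) (sweedler2_E (bilin_trilin _ (T _))).
    rewrite !big_split /= !SH_gen SH_1.
    have mE : \sum_k (phi (B i k) K : K0) *: (E * A k j) + \sum_k (phi (B i k) E : K0) *: A k j =
        \sum_k (phi (B k j) E : K0) *: (A i k * K) + A i j * E.
      have := mr_E R i j; rewrite scale1r => <-; congr (_ + _).
      by apply: eq_bigr => k _; rewrite mul1r.
    have -> : \sum_k (phi (B k j) K : K0) *: (- e * A i k * K) =
        - (e * (\sum_k (phi (B k j) K : K0) *: (A i k * K))).
      by rewrite mulr_sumr -sumrN; apply: eq_bigr => k _; rewrite !mulNr scalerN -scalerAr mulrA.
    have -> : e * (\sum_k (phi (B k j) K : K0) *: (A i k * K)) =
        \sum_k (phi (B i k) K : K0) *: (E * A k j).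
      rewrite -(mr_K R) mulr_sumr; apply: eq_bigr => k _.
      by rewrite -scalerAr mulrA -[E * Ki * K]mulrA uKiK mulr1.
    have -> : \sum_k (phi (B k j) 1 : K0) *: (1 * A i k * E) = A i j * E.
      by rewrite -(B1 (fun k => A i k * E)); apply: eq_bigr => k _; rewrite mul1r.
    have -> : \sum_k (phi (B k j) E : K0) *: (1 * A i k * K) = \sum_k (phi (B k j) E : K0) *: (A i k * K).
      by apply: eq_bigr => k _; rewrite mul1r.
    by rewrite -mE addKr.
  + under eq_bigr do rewrite /sweedler3 (sweedler2_F (sweedler3_bilin DH (T _)))
      (sweedler2_1 (bilin_trilin _ (T _))) (sweedler2_F (bilin_trilin _ (T _))).
    rewrite !big_split /= !SH_gen.
    have mF : F * A i j + \sum_k (phi (B i k) F : K0) *: (Ki * A k j) =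
        \sum_k (phi (B k j) F : K0) *: A i k + \sum_k (phi (B k j) Ki : K0) *: (A i k * F).
      have := mr_F R i j; rewrite invr1 scale1r => ->; congr (_ + _).
      by apply: eq_bigr => k _; rewrite mul1r.
    under eq_bigr do rewrite mulr1.
    rewrite (B1 (fun k => - (K * F) * A i k)).
    under [X in _ + (X + _)]eq_bigr do rewrite mulr1 scalerAr.
    rewrite -mulr_sumr.
    under [X in _ + (_ + X)]eq_bigr do rewrite -mulrA scalerAr.
    rewrite -mulr_sumr -mulrDr -mF mulrDr mulNr !mulrA addKr mulr_sumr.
    by apply: eq_bigr => k _; rewrite -scalerAr mulrA uKKi mul1r.
  + under eq_bigr do rewrite /sweedler3 (sweedler2_K (sweedler3_bilin DH (T _)))
      (sweedler2_K (bilin_trilin _ (T _))) !SH_gen -mulrA scalerAr.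
    rewrite -mulr_sumr -(mr_K R) mulr_sumr; apply: eq_bigr => k _.
    by rewrite -scalerAr mulrA uKiK mul1r.
  + under eq_bigr do rewrite /sweedler3 (sweedler2_Ki (sweedler3_bilin DH (T _)))
      (sweedler2_Ki (bilin_trilin _ (T _))) !SH_gen -mulrA scalerAr.
    rewrite -mulr_sumr -(mr_Ki R) mulr_sumr; apply: eq_bigr => k _.
    by rewrite -scalerAr mulrA uKKi mul1r.
- have T k := ad_trilin (B k j) (A i k).
  under eq_bigr do rewrite /sweedler3 (sweedler2_1 (sweedler3_bilin DH (T _)))
      (sweedler2_1 (bilin_trilin _ (T _))) SH_1 mul1r mulr1.
  rewrite B1 -(sum_delta (fun k => A k j) i); apply: eq_bigr => k _.
  by rewrite (mr_1 R).
- under eq_bigr do rewrite s3L.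
  rewrite big_split -scaler_sumr Hx Hy scaler_sumr -big_split; apply: eq_bigr => l _.
  by rewrite phi_linr scalerDl scalerA.
have [s sP] := sweedler3_family DH_lin x.
have [t tP] := sweedler3_family DH_lin y.
under [RHS]eq_bigr do rewrite phi_B scaler_suml.
rewrite exchange_big.
transitivity (\sum_k (phi (B i k) x : K0) *:
    \sum_l sweedler3 DH (fun h1 h2 h3 => (phi (B l j) h2 : K0) *: (SH q0 h1 * A k l * h3)) y); last first.
  by apply: eq_bigr => k _; rewrite Hy scaler_sumr; apply: eq_bigr => l _; rewrite scalerA.
under eq_bigr do rewrite (sweedler3_mul (ad_trilin _ _) sP tP).
have FB k l : sweedler3 DH (fun h1 h2 h3 => (phi (B l j) h2 : K0) *: (SH q0 h1 * A k l * h3)) y =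
    \sum_(v <- t) (phi (B l j) v.1.2 : K0) *: (SH q0 v.1.1 * A k l * v.2).
  exact: tP (ad_trilin _ _).
under [RHS]eq_bigr do rewrite scaler_sumr.
rewrite [RHS]exchange_big /=.
have adx l : \sum_k (phi (B i k) x : K0) *: A k l =
    \sum_k \sum_(u <- s) (phi (B k l) u.1.2 : K0) *: (SH q0 u.1.1 * A i k * u.2).
  by rewrite -Hx; apply: eq_bigr => k _; rewrite (sP _ _ (ad_trilin _ _)).
transitivity (\sum_l \sum_(v <- t) (phi (B l j) v.1.2 : K0) *:
    (SH q0 v.1.1 * (\sum_k (phi (B i k) x : K0) *: A k l) * v.2)); last first.
  apply: eq_bigr => l _.
  under [RHS]eq_bigr do rewrite FB scaler_sumr.
  rewrite exchange_big; apply: eq_bigr => v _.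
  rewrite mulr_sumr mulr_suml scaler_sumr; apply: eq_bigr => k _.
  by rewrite -scalerAr -scalerAl !scalerA mulrC.
under eq_bigr do rewrite exchange_big.
rewrite exchange_big [RHS]exchange_big; apply: eq_bigr => v _.
under [RHS]eq_bigr do rewrite adx mulr_sumr mulr_suml scaler_sumr.
rewrite [RHS]exchange_big; apply: eq_bigr => k _ /=.
under [RHS]eq_bigr do rewrite mulr_sumr mulr_suml scaler_sumr.
rewrite [RHS]exchange_big; apply: eq_bigr => u _.
rewrite SH_mul phi_B scaler_suml; apply: eq_bigr => l _.
by rewrite -scalerAr -scalerAl scalerA !mulrA mulrC.
Qed.

Definition matrix_coef (i j : I) : T := \sum_k A i k \ox B k j.

Lemma dual_sum (J : finType) (X : J -> T) u : dual (\sum_k X k) u = \sum_k dual (X k) u.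
Proof. exact: (lin_sum (dual_linx u)). Qed.

(** Thus the matrix entries [matrix_coef] come from a representation of the
    quantum double, and left and right translates of one of them are
    combinations of entries of the same matrix. *)
Lemma matrix_coef_dmul i j u v : dual (matrix_coef i j) (dmul q0 phi u v) =
  \sum_k dual (matrix_coef i k) u * dual (matrix_coef k j) v.
Proof.
have dB := dmul_bilin phiP; have dL x := dual_linu x.
have sumL (f : I -> Defs.double q -> K0^o) (k : I -> K0) : (forall i, linear (f i)) ->
    linear (fun u => \sum_i (f i u * k i : K0^o)).
  move=> fL l x y; rewrite scaler_sumr -big_split; apply: eq_bigr => m _.
  by rewrite fL mulrDl -scalerAl.
have sumR (f : I -> Defs.double q -> K0^o) (k : I -> K0) : (forall i, linear (f i)) ->
    linear (fun u => \sum_i (k i * f i u : K0^o)).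
  move=> fL l x y; rewrite scaler_sumr -big_split; apply: eq_bigr => m _.
  by rewrite fL mulrDr -[l *: (_ * _)]/(l * (_ * _)) -[l *: _]/(l * _) mulrCA.
apply: (linear_tensor_ext (f := fun u => dual (matrix_coef i j) (dmul q0 phi u v) : K0^o)
  (g := fun u => \sum_k (dual (matrix_coef i k) u * dual (matrix_coef k j) v : K0^o))) u => [||g h].
- by move=> k x y; rewrite (bilinl dB) dL.
- exact: (sumL (fun k => dual (matrix_coef i k)) (fun k => dual (matrix_coef k j) v)).
apply: (linear_tensor_ext (f := fun v => dual (matrix_coef i j) (dmul q0 phi (g \ox h) v) : K0^o)
  (g := fun v => \sum_k (dual (matrix_coef i k) (g \ox h) * dual (matrix_coef k j) v : K0^o))) v => [||g' h'].
- by move=> k x y; rewrite (bilinr dB) dL.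
- exact: (sumR (fun k => dual (matrix_coef k j)) (fun k => dual (matrix_coef i k) (g \ox h))).
rewrite dmul_regular.
have [t tP] := sweedler3_family DH_lin h.
rewrite tP; last first.
  have PL w : linear (fun z : C => z * g \ox w : tensor C H).
    by move=> k x y; rewrite mulrDl -scalerAl pureDl pureZl.
  split=> x y.
  - by move=> k z w; rewrite SH_lin Ra_linh La_lin PL.
  - by move=> k z w; rewrite mulrDl -scalerAl pureDr pureZr.
  - by move=> k z w; rewrite La_linh PL.
have coefE k l g1 h1 : dual (matrix_coef k l) (g1 \ox h1) =
    \sum_m (phi (B m l) h1 * phi g1 (A k m) : K0).
  by rewrite dual_sum; apply: eq_bigr => m _; rewrite dual_pure.
rewrite (lin_sum (dL (matrix_coef i j))).
transitivity (\sum_(w <- t) \sum_k \sum_m \sum_l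
   (phi g (A i l) * phi (B m j) h' *
     (phi (B k m) w.1.2 * phi g' (SH q0 w.1.1 * A l k * w.2)) : K0)).
  apply: eq_bigr => w _; rewrite coefE; apply: eq_bigr => k _.
  rewrite phi_B phi_A big_distrlr /=; apply: eq_bigr => m _; apply: eq_bigr => l _.
  rewrite -[SH _ _ * _ * _]mulrA phi_Ra phi_La; ring.
have ad_phi l m : \sum_k \sum_(w <- t) (phi (B k m) w.1.2 * phi g' (SH q0 w.1.1 * A l k * w.2) : K0) =
    \sum_k (phi (B l k) h * phi g' (A k m) : K0).
  have := congr1 (phi g') (ad_A h l m); rewrite !(lin_sum (phi_linr g')) => adE.
  transitivity (\sum_k phi g' (sweedler3 DH
      (fun h1 h2 h3 => (phi (B k m) h2 : K0) *: (SH q0 h1 * A l k * h3)) h)).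
    apply: eq_bigr => k _; rewrite (tP _ _ (ad_trilin _ _)) (lin_sum (phi_linr g')).
    by apply: eq_bigr => w _; rewrite (linZ (phi_linr g')).
  by rewrite adE; apply: eq_bigr => k _; rewrite (linZ (phi_linr g')).
transitivity (\sum_m \sum_l (phi g (A i l) * phi (B m j) h' *
    \sum_k (phi (B l k) h * phi g' (A k m)) : K0)).
  under [RHS]eq_bigr do under eq_bigr do rewrite -ad_phi.
  rewrite exchange_big; under eq_bigr do rewrite exchange_big.
  rewrite exchange_big; apply: eq_bigr => m _ /=.
  under eq_bigr do rewrite exchange_big.
  rewrite exchange_big; apply: eq_bigr => l _ /=.
  rewrite mulr_sumr; apply: eq_bigr => k _; rewrite mulr_sumr; exact: eq_bigr.
under eq_bigr do under eq_bigr do rewrite mulr_sumr.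
under eq_bigr do rewrite exchange_big.
rewrite exchange_big; apply: eq_bigr => k _ /=.
rewrite !coefE exchange_big big_distrlr /=; apply: eq_bigr => l _; apply: eq_bigr => m _.
ring.
Qed.

Lemma sub_bimodule_coef :
  sub_bimodule q0 phi [set f | exists k : I -> I -> K0,
    f = \sum_i \sum_j k i j *: dual (matrix_coef i j)]%classic.
Proof.
have evalE (k : I -> I -> K0) u : (\sum_i \sum_j k i j *: dual (matrix_coef i j)) u =
    \sum_i \sum_j (k i j * dual (matrix_coef i j) u : K0).
  by rewrite fct_sumE; apply: eq_bigr => i _; rewrite fct_sumE.
split=> [f [k ->]||l f g [k ->] [m ->]|x f [k ->]|x f [k ->]].
- move=> l u v; rewrite !evalE mulr_sumr -big_split; apply: eq_bigr => i _.
  rewrite mulr_sumr -big_split; apply: eq_bigr => j _.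
  by rewrite dual_linu -[l *: _]/(l * _) mulrDr mulrCA.
- exists (fun _ _ => 0); rewrite big1 // => i _; rewrite big1 // => j _; by rewrite scale0r.
- exists (fun i j => l * k i j + m i j); rewrite scaler_sumr -big_split; apply: eq_bigr => i _.
  rewrite scaler_sumr -big_split; apply: eq_bigr => j _.
  by rewrite /= scalerA -scalerDl.
- exists (fun i p => \sum_j k i j * (dual (matrix_coef p j) x : K0)); apply/funext => u.
  rewrite /lact !evalE; apply: eq_bigr => i _.
  under [RHS]eq_bigr do rewrite mulr_suml.
  rewrite [RHS]exchange_big; apply: eq_bigr => j _ /=.
  rewrite matrix_coef_dmul mulr_sumr; apply: eq_bigr => p _; ring.
exists (fun p j => \sum_i k i j * (dual (matrix_coef i p) x : K0)); apply/funext => u.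
rewrite /ract !evalE exchange_big [RHS]exchange_big; apply: eq_bigr => j _ /=.
under [RHS]eq_bigr do rewrite mulr_suml.
rewrite [RHS]exchange_big; apply: eq_bigr => i _ /=.
rewrite matrix_coef_dmul mulr_sumr; apply: eq_bigr => p _; ring.
Qed.
End MatrixCoefficients.

(** * Local finiteness *)

Definition matrix_entry (x : T) : Prop := exists (I : finType) (A : I -> I -> H) (B : I -> I -> C) i j,
  matrix_rep 1 1 A B /\ x = matrix_coef A B i j.

Lemma matrix_entry_mul x y : matrix_entry x -> matrix_entry y -> matrix_entry (x * y).
Proof.
move=> [I [A [B [i [j [R ->]]]]]] [J [A' [B' [k [l [R' ->]]]]]].
exists (I * J)%type, (tensorA A A'), (tensorB B B'), (i, k), (j, l).
split; first exact: (matrix_rep_tensor R R').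
rewrite /matrix_coef pair_sum mulr_suml; apply: eq_bigr => p _.
by rewrite mulr_sumr; apply: eq_bigr => s _; rewrite pureM.
Qed.

Definition representative (x : T) : Prop := exists2 s : seq (K0 * T),
  forall t, t \in s -> matrix_entry t.2 & x = \sum_(t <- s) t.1 *: t.2.

Lemma representative_entry x : matrix_entry x -> representative x.
Proof.
by move=> Ex; exists [:: (1, x)]; [move=> t; rewrite inE => /eqP ->|rewrite big_seq1 scale1r].
Qed.

Lemma representative_lin k x y : representative x -> representative y -> representative (k *: x + y).
Proof.
move=> [s sE ->] [t tE ->]; exists ([seq (k * u.1, u.2) | u <- s] ++ t).
  by move=> u; rewrite mem_cat => /orP [/mapP [v vs ->]|/tE //]; exact: sE v vs.
rewrite big_cat big_map scaler_sumr; congr (_ + _).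
by apply: eq_bigr => u _; rewrite scalerA.
Qed.

Lemma representative0 : representative 0.
Proof. by exists [::] => //; rewrite big_nil. Qed.

Lemma representativeZ k x : representative x -> representative (k *: x).
Proof. by move=> Lx; rewrite -[_ *: _]addr0; apply: representative_lin Lx representative0. Qed.

Lemma representative_mul x y : representative x -> representative y -> representative (x * y).
Proof.
move=> [s sE ->] [t tE ->]; rewrite mulr_suml big_seq; elim/big_ind: _ => [|u v Lu Lv|u us].
- exact: representative0.
- by rewrite -[u]scale1r; exact: representative_lin.
rewrite mulr_sumr big_seq; elim/big_ind: _ => [|v w Lv Lw|v vt].
- exact: representative0.
- by rewrite -[v]scale1r; exact: representative_lin.
rewrite -scalerAl -scalerAr; apply/representativeZ/representativeZ/representative_entry.
by apply: matrix_entry_mul; [exact: sE|exact: tE].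
Qed.

Local Notation Lentry i j := (matrix_coef (tensorA Llow Lupp) (tensorB fund fund) i j).

Lemma Lentry_representative i j : representative (Lentry i j).
Proof.
apply: representative_entry; exists (bool * bool)%type, (tensorA Llow Lupp),
  (tensorB fund fund), i, j; split => //.
exact: (matrix_rep_tensor Llow_rep Lupp_rep).
Qed.

Lemma representative_1 : representative 1.
Proof.
have S1 (V : nmodType) (G : unit -> V) : \sum_k G k = G tt.
  by rewrite (bigD1 tt) //= big1 ?addr0 // => -[].
apply: representative_entry; exists unit, (fun _ _ => 1), (fun _ _ => 1), tt, tt; split; last first.
  by rewrite /matrix_coef S1.
have p1 h : phi 1 h = epsH q h by exact: phi1.
have g := epsH_gen.
split=> [i j|i j|[] []|i j|i j|i j|i j]; rewrite ?S1 ?p1 ?g ?invr1 ?mulr1 ?mul1r ?scale1r ?scale0r ?addr0 ?add0r //;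
  by rewrite ?rmorph1.
Qed.

(** The entries in the column of a \ox a give [v1] and [v2]; the combinations
    with -q^-1 contract the two copies of the fundamental corepresentation by the
    quantum determinant, which leaves only the factor in H, for [v3] and [v4]. *)
Lemma v_representative :
  [/\ representative (v1 q), representative (v2 q), representative (v3 q) & representative (v4 q)].
Proof.
have z2 (x : C) : (0 : H) \ox x = 0 by exact: (lin0 (pure_linl _)).
have XE i j : Lentry i j = \sum_k \sum_l (Llow i.1 k * Lupp i.2 l) \ox (fund k j.1 * fund l j.2).
  by rewrite /matrix_coef pair_sum.
have d0 := delta_neq0 q0 qX; have q20 := expf_neq0 2 q0.
have LX := Lentry_representative.
have q2 : q * q - 1 != 0 by rewrite -expr2 subr_eq0 qX.
have L x y : representative x -> representative y -> representative (x + y).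
  by rewrite -{2}[x]scale1r; exact: representative_lin.
split.
- have -> : v1 q = -1 *: Lentry (true, true) (false, false).
    rewrite XE !big_bool /= ?(mul0r, mulr0, mul1r, mulr1, z2, addr0, add0r).
    rewrite /v1 uKKi -scalerAl pureZl scalerDr scalerA mulrNN mul1r scaleN1r addrC.
    by rewrite expr2.
  exact: representativeZ.
- have -> : v2 q = (- delta^-1) *: Lentry (true, false) (false, false)
      + (q / delta) *: Lentry (false, true) (false, false).
    rewrite !XE !big_bool /= ?(mul0r, mulr0, mul1r, mulr1, z2, addr0, add0r).
    rewrite /v2 /casimir -?scalerAl -?scalerAr -?scalerAl uKF cca !expr2.
    rewrite !(pureZl, pureZr, pureDl, scalerDr, scalerA).
    lincomb ltac:(by field; rewrite ?q0 ?q2).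
  by apply: (L); exact: representativeZ.
- have -> : v3 q = (- delta^-1) *: (Lentry (true, true) (false, true) + (- q^-1) *: Lentry (true, true) (true, false)).
    rewrite !XE !big_bool /= ?(mul0r, mulr0, mul1r, mulr1, z2, addr0, add0r).
    rewrite /v3 uKKi -!scalerAl cdc cad !(pureZl, pureZr, pureDr).
    lincomb ltac:(by field; rewrite ?q0 ?q2).
  by apply: representativeZ; apply: (L) => //; exact: representativeZ.
have -> : v4 q = (- delta ^- 2) *: (Lentry (true, false) (false, true) + (- q^-1) *: Lentry (true, false) (true, false))
    + (q / delta ^+ 2) *: (Lentry (false, true) (false, true) + (- q^-1) *: Lentry (false, true) (true, false)).
  rewrite !XE !big_bool /= ?(mul0r, mulr0, mul1r, mulr1, z2, addr0, add0r).
  rewrite /v4 /casimir -?scalerAl -?scalerAr -?scalerAl uKF cba cdc cad cda ccb.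
  rewrite !(pureZl, pureZr, pureDl, pureDr, scalerDr, scalerA).
  lincomb ltac:(by field; rewrite ?q0 ?q2).
by apply: (L); apply: representativeZ; apply: (L) => //; exact: representativeZ.
Qed.

Lemma gen_representative x : gen x -> representative x.
Proof.
have [r1 r2 r3 r4] := v_representative.
apply: gen_subalg_min; [exact: representative_1|exact: representative_lin|exact: representative_mul|].
by move=> y [[[->|->]|->]|->].
Qed.

Local Notation fspace := (Defs.double q -> (K0 : fieldType)^o).

Definition fin_bimodule (f : fspace) : Prop := exists M : set fspace,
  [/\ sub_bimodule q0 phi M, M f &
    exists (J : finType) (b : J -> fspace), forall g, M g -> exists k : J -> K0, g = \sum_j k j *: b j].

Lemma fin_bimodule_entry x : matrix_entry x -> fin_bimodule (dual x).
Proof.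
move=> [I [A [B [i [j [R ->]]]]]]; eexists; split; first exact: (sub_bimodule_coef R).
  exists (fun i' j' => ((i' == i) && (j' == j))%:R).
  rewrite (bigD1 i) //= [X in _ + X]big1 ?addr0 => [|i' /negPf ni]; last first.
    by rewrite big1 // => j' _; rewrite ni scale0r.
  rewrite (bigD1 j) //= big1 ?addr0 => [|j' /negPf nj]; first by rewrite !eqxx scale1r.
  by rewrite nj andbF scale0r.
exists (I * I)%type, (fun p => dual (matrix_coef A B p.1 p.2)) => g [k ->].
by exists (fun p => k p.1 p.2); rewrite pair_bigA.
Qed.

Lemma fin_bimodule_lin k f g : fin_bimodule f -> fin_bimodule g -> fin_bimodule (k *: f + g).
Proof.
move=> [M [MS Mf [J [b Mb]]]] [N [NS Ng [J' [b' Nb]]]].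
exists [set h | exists u v, [/\ M u, N v & h = u + v]]%classic; split.
- have ME := sb_lin MS; have NE := sb_lin NS.
  split=> [h [u [v [Mu Nv ->]]]||l h h' [u [v [Mu Nv ->]]] [u' [v' [Mu' Nv' ->]]]|x h [u [v [Mu Nv ->]]]|x h [u [v [Mu Nv ->]]]].
  + move=> l y z; have := sb_dual MS Mu l y z; have := sb_dual NS Nv l y z.
    rewrite -![(u + v) _]/(u _ + v _) => -> ->; by rewrite mulrDr addrACA.
  + by exists 0, 0; split; [exact: sb_0 MS|exact: sb_0 NS|rewrite addr0].
  + exists (l *: u + u'), (l *: v + v'); split; [exact: ME|exact: NE|].
    by rewrite scalerDr addrACA.
  + by exists (lact q0 phi x u), (lact q0 phi x v); split; [exact: sb_lact MS _ _ Mu|exact: sb_lact NS _ _ Nv|].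
  + by exists (ract q0 phi u x), (ract q0 phi v x); split; [exact: sb_ract MS _ _ Mu|exact: sb_ract NS _ _ Nv|].
- exists (k *: f), g; split=> //; rewrite -[k *: f]addr0; apply: (sb_lin MS) => //; exact: sb_0 MS.
exists (J + J')%type, (fun s => match s with inl j => b j | inr j => b' j end).
move=> h [u [v [/Mb [l ->] /Nb [l' ->] ->]]].
by exists (fun s => match s with inl j => l j | inr j => l' j end); rewrite big_sumType.
Qed.

(** The basis has to lie in the generated sub-bimodule itself, which is only a
    subspace of the given finite-dimensional one. *)
Lemma fin_bimodule_gen f : fin_bimodule f -> finite_dimensional (gen_bimodule q0 phi f).
Proof.
move=> [M [MS Mf [J [b Mb]]]].
apply: (@subspace_finite_basis _ _ #|J| (fun i => b (enum_val i)) (gen_bimodule q0 phi f)).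
- by move=> N NS _; exact: sb_0 NS.
- by move=> k x y gx gy N NS Nf; apply: (sb_lin NS); [exact: gx|exact: gy].
move=> g gg; have [k ->] := Mb g (gg M MS Mf).
by exists (k \o enum_val); rewrite (reindex_onto enum_val enum_rank) //= => [|j _]; [apply: eq_bigl => i; rewrite enum_valK eqxx|rewrite enum_rankK].
Qed.

Lemma representative_finite x : representative x ->
  finite_dimensional (gen_bimodule q0 phi (dual x)).
Proof.
move=> [s sE ->]; apply: fin_bimodule_gen.
have sE' t : t \in s -> fin_bimodule (dual t.2) by move=> ts; exact/fin_bimodule_entry/sE.
elim: s {sE} sE' => [|t s IHs] sE.
  rewrite big_nil; have -> : dual 0 = 0.
    by apply/funext => u; rewrite (lin0 (dual_linx u)).
  exists [set 0]%classic; split=> //; last by exists void, (fun=> 0) => g ->; exists (fun=> 0); rewrite big1.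
  split=> [f ->|//|k f g -> ->|y f ->|y f ->] //.
    by move=> k u v; rewrite mulr0 addr0.
  by rewrite /= scaler0 addr0.
rewrite big_cons (dual_embed_linear phiP); apply: fin_bimodule_lin.
  by apply: sE; rewrite inE eqxx.
by apply: IHs => u us; apply: sE; rewrite inE us orbT.
Qed.
End Pairing.

(** * Specialization to the indeterminate q *)

Lemma qvar_not_root (R : realType) n : (qvar R) ^+ n.+1 != 1.
Proof.
rewrite /qvar -tofracXn -tofrac1 tofrac_eq; apply/eqP => /(congr1 (size \o polyseq)) /=.
by rewrite size_polyXn size_poly1.
Qed.

Local Open Scope classical_set_scope.

Theorem proposition1p9 (R : realType)
    (phi : CSL (qvar R) -> Uq (qvar R) -> (Cq R)^o)
    (phiP : is_Hopf_pairing (qvar_neq0 R) phi) :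
  (forall x : tensor (Uq (qvar R)) (CSL (qvar R)),
     highest_weight (qvar_neq0 R) phi x ->
     finite_dimensional (gen_bimodule (qvar_neq0 R) phi (dual_embed phi x))) /\
  highest_weight (qvar_neq0 R) phi =
    gen_subalg [set v1 (qvar R); v2 (qvar R); v3 (qvar R); v4 (qvar R)].
Proof.
have qX := @qvar_not_root R; have HWE := HW_eq_gen qX phiP.
split=> [x|//]; rewrite HWE => /(gen_representative qX phiP).
exact: (representative_finite phiP).
Qed.
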